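(* Let $n\ge2$ be an integer. If $X$ is a vector space such that $C_c^\infty(\mathbb R^n)\subseteq X\subseteq C_0(\mathbb R^n)\cap L^1(\mathbb R^n)$, then $$\Delta_n=\vartheta^X_{\mathrm{SP}}(\mathrm{COP}(\mathbb R^n)_{\mathrm{inv}}).$$ In particular, $\Delta_n=\vartheta^{\mathcal S(\mathbb R^n)}_{\mathrm{SP}}(\mathrm{COP}(\mathbb R^n)_{\mathrm{inv}})$.
   Context: All functions are real valued. $C_0(\mathbb R^n)$: continuous functions vanishing at infinity; $C_c^\infty(\mathbb R^n)$: smooth compactly supported functions; $\mathcal S(\mathbb R^n)$: Schwartz functions. Inclusions are as linear subspaces. $\widehat f(x)=\int_{\mathbb R^n}f(y)e^{-2\pi i x^{\mathsf T}y}\,dy$. $\Delta_n$ is the maximal center density of packings of balls of radius $1/2$: $$\Delta_n=\sup\Bigl\{\limsup_{T\to\infty}\frac{|P\cap[-T/2,T/2]^n|}{T^n}:P\subseteq\mathbb R^n,\ \|x-y\|\ge1\text{ for all distinct }x,y\in P\Bigr\}.$$ For functions $f,g$ on $\mathbb R^n$, $(f\star g)(x)=\int f(y)g(x+y)\,dy$ and $f*g$ is the usual convolution. $\mathrm P(\mathbb R^n)$ is the cone of functions of positive type: (continuous) $f\in L^\infty(\mathbb R^n)$ with $\int(g\star g)f\,dx\ge0$ for all $g\in L^1(\mathbb R^n)$. $$\mathrm{COP}(\mathbb R^n)_{\mathrm{inv}}=\{\rho\in L^1(\mathbb R^n):\langle\phi*\rho,\phi\rangle\ge0\text{ for all }\phi\in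 L^2(\mathbb R^n),\ \phi\ge0\},\qquad\langle f,g\rangle=\int fg\,dx.$$ For a convex cone $\mathcal C\subseteq L^1(\mathbb R^n)$ and a space $X$ as in the claim, $\vartheta^X_{\mathrm{SP}}(\mathcal C)$ is the infimum of $f(0)+g(0)$ over all $f\in\mathrm P(\mathbb R^n)\cap X$ and $g\in\mathcal C\cap X$ with $\widehat f(0)=1$ and $f(x)+g(x)\le0$ for all $\|x\|\ge1$. *)

(* Defs.v *)
From HB Require Import structures.
From mathcomp Require Import all_boot all_order all_algebra.
From mathcomp Require Import all_classical all_reals all_analysis.
From mathcomp Require Import complex.

Set Implicit Arguments.
Unset Strict Implicit.
Unset Printing Implicit Defensive.

Import Order.TTheory GRing.Theory Num.Theory.
Import numFieldNormedType.Exports.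

Local Open Scope classical_set_scope.
Local Open Scope ring_scope.
Local Open Scope complex_scope.

Definition rV_display : measure_display.
Proof. exact: default_measure_display. Qed.

Section measurable_rV.
Context {R : realType}.
Variable n : nat.

Let coord (i : 'I_n) (x : 'rV[R]_n) : measurableTypeR R := x ord0 i.

Let rV_set0 : g_sigma_preimage coord set0.
Proof. exact: sigma_algebra0. Qed.

Let rV_setC A : g_sigma_preimage coord A -> g_sigma_preimage coord (~` A).
Proof. exact: sigma_algebraC. Qed.

Let rV_bigcup (F : (set 'rV[R]_n)^nat) :
  (forall i, g_sigma_preimage coord (F i)) ->
  g_sigma_preimage coord (\bigcup_i F i).
Proof. exact: sigma_algebra_bigcup. Qed.

(* The product sigma-algebra on R^n, which is also its Borel sigma-algebra. *)
HB.instance Definition _ := @isMeasurable.Build rV_display 'rV[R]_n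
  (g_sigma_preimage coord) rV_set0 rV_setC rV_bigcup.

Lemma measurable_coord (i : 'I_n) :
  measurable_fun [set: 'rV[R]_n] (fun x => x ord0 i).
Proof.
move=> _ Y mY; rewrite setTI; apply: sub_sigma_algebra => /=.
rewrite -bigcup_seq/=; exists i => /=; first by rewrite mem_index_enum.
by exists Y => //; rewrite setTI.
Qed.

Lemma measurable_fun_rV d (T : measurableType d) (f : T -> 'rV[R]_n) :
  (forall i, measurable_fun [set: T] (fun t => f t ord0 i)) ->
  measurable_fun [set: T] f.
Proof.
move=> mf.
have : g_sigma_preimage (fun i => coord i \o f) `<=` measurable.
  apply: smallest_sub; first exact: sigma_algebra_measurable.
  rewrite -bigcup_seq => A [i _ [B mB <-]]; exact: mf.
rewrite g_sigma_preimage_comp => prefS _ A mA.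
by apply: prefS; exists A.
Qed.

End measurable_rV.

Lemma sigma_finiteX d1 d2 (T1 : measurableType d1) (T2 : measurableType d2)
    (R : realType) (m1 : {sigma_finite_measure set T1 -> \bar R})
    (m2 : {sigma_finite_measure set T2 -> \bar R}) :
  sigma_finite setT (m1 \x m2)%E.
Proof.
have /sigma_finiteP[F [TF ndF Foo]] := sigma_finiteT m1.
have /sigma_finiteP[G [TG ndG Goo]] := sigma_finiteT m2.
exists (fun n => F n `*` G n).
  rewrite -setXTT TF TG predeqE => -[x y]; split.
    move=> [/= [n _ Fnx] [k _ Gky]]; exists (maxn n k) => //; split.
    - by move: x Fnx; exact/subsetPset/ndF/leq_maxl.
    - by move: y Gky; exact/subsetPset/ndG/leq_maxr.
  by move=> [n _ []/= ? ?]; split; exists n.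
move=> k; have [? ?] := Foo k; have [? ?] := Goo k.
split; first exact: measurableX.
by rewrite product_measure1E// lte_mul_pinfty// ge0_fin_numE.
Qed.

Section cons_rV.
Context {R : realType} {n : nat}.

Definition cons_rV (p : measurableTypeR R * 'rV[R]_n) : 'rV[R]_n.+1 :=
  row_mx (const_mx p.1 : 'rV_1) p.2.

Definition uncons_rV (x : 'rV[R]_n.+1) : measurableTypeR R * 'rV[R]_n :=
  (x ord0 ord0, rsubmx (x : 'rV_(1 + n))).

Lemma uncons_rVK (p : measurableTypeR R * 'rV[R]_n) :
  uncons_rV (cons_rV p) = p.
Proof.
case: p => a x; rewrite /uncons_rV /cons_rV row_mxKr; congr pair.
rewrite mxE; case: split_ordP => j; first by rewrite mxE.
by move=> /(congr1 val).
Qed.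

Lemma measurable_cons_rV : measurable_fun [set: _] cons_rV.
Proof.
apply: measurable_fun_rV => i; rewrite /cons_rV.
have [j ij|j ij] := split_ordP (i : 'I_(1 + n)).
  rewrite (_ : (fun t => _) = fst); first exact: measurable_fst.
  by apply/funext => t; rewrite ij (@row_mxEl _ 1 1 n) mxE.
rewrite (_ : (fun t => _) = (fun x : 'rV[R]_n => x ord0 j) \o snd); last first.
  by apply/funext => t; rewrite ij (@row_mxEr _ 1 1 n).
by apply: measurableT_comp; [exact: measurable_coord|exact: measurable_snd].
Qed.

Lemma measurable_uncons_rV : measurable_fun [set: _] uncons_rV.
Proof.
apply: measurable_fun_pair => /=; first exact: measurable_coord.
apply: measurable_fun_rV => i.
rewrite (_ : (fun t => _) = fun x : 'rV[R]_n.+1 => x ord0 (rshift 1 i)).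
  exact: measurable_coord.
by apply/funext => x; rewrite /= !mxE.
Qed.

End cons_rV.

(* Lebesgue measure on R^n, as the n-fold product of the one on R. *)
Fixpoint lebesgue_rV {R : realType} (n : nat) : set 'rV[R]_n -> \bar R :=
  match n with
  | 0 => dirac (0 : 'rV[R]_0)
  | m.+1 => pushforward (lebesgue_measure \x @lebesgue_rV R m)%E cons_rV
  end.
Arguments lebesgue_rV {R} n _ : simpl never.

Section lebesgue_rV_measure.
Context {R : realType}.
Variable n : nat.

Let lebesgue_rV_sfinite : [/\ @lebesgue_rV R n set0 = 0%E,
  forall A : set 'rV[R]_n, (0 <= lebesgue_rV n A)%E,
  semi_sigma_additive (@lebesgue_rV R n) &
  sigma_finite setT (@lebesgue_rV R n)].
Proof.
elim: n => [|k [m0 mge0 madd mfin]].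
  pose d0 : {sigma_finite_measure set 'rV[R]_0 -> \bar R} :=
    dirac (0 : 'rV[R]_0).
  split.
  - exact: (measure0 d0).
  - exact: (measure_ge0 d0).
  - exact: (@measure_semi_sigma_additive _ _ _ d0).
  - exact: (sigma_finiteT d0).
pose mu : {measure set 'rV[R]_k -> \bar R} :=
  HB.pack (lebesgue_rV k) (isMeasure.Build _ _ _ _ m0 mge0 madd).
pose nu : {sigma_finite_measure set 'rV[R]_k -> \bar R} :=
  HB.pack (lebesgue_rV k) (Measure.class mu)
    (Measure_isSigmaFinite.Build _ _ _ mu mfin).
pose pi : {measure set (measurableTypeR R * 'rV[R]_k)%type -> \bar R} :=
  (lebesgue_measure \x nu)%E.
have piE A : lebesgue_rV k.+1 A = pi (cons_rV @^-1` A) by [].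
have mpre A : measurable A -> measurable ((@cons_rV R k) @^-1` A).
  by move=> mA; rewrite -[X in measurable X]setTI; exact: measurable_cons_rV.
split.
- by rewrite piE preimage_set0 measure0.
- by move=> A; rewrite piE measure_ge0.
- move=> F mF tF mUF; rewrite piE preimage_bigcup.
  apply: measure_semi_sigma_additive => [i||].
  + exact: mpre.
  + apply/trivIsetP => i j _ _ ij; rewrite -preimage_setI.
    by move/trivIsetP : tF => /(_ _ _ _ _ ij) ->//; rewrite preimage_set0.
  + by rewrite -preimage_bigcup; exact: mpre.
- have [F FT mF] := sigma_finiteX (@lebesgue_measure R) nu.
  exists (fun i => uncons_rV @^-1` F i).
    by rewrite -preimage_bigcup -FT preimage_setT.
  move=> i; split.
    rewrite -[X in measurable X]setTI.
    by apply: measurable_uncons_rV => //; case: (mF i).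
  rewrite piE (_ : _ @^-1` _ = F i); first by case: (mF i).
  by apply/funext => p; rewrite /preimage/= uncons_rVK.
Qed.

Let lebesgue_rV0 : lebesgue_rV n (set0 : set 'rV[R]_n) = 0%E.
Proof. by case: lebesgue_rV_sfinite. Qed.

Let lebesgue_rV_ge0 (A : set 'rV[R]_n) : (0 <= lebesgue_rV n A)%E.
Proof. by case: lebesgue_rV_sfinite. Qed.

Let lebesgue_rV_sigma_additive : semi_sigma_additive (@lebesgue_rV R n).
Proof. by case: lebesgue_rV_sfinite. Qed.

HB.instance Definition _ := isMeasure.Build _ _ _ (@lebesgue_rV R n)
  lebesgue_rV0 lebesgue_rV_ge0 lebesgue_rV_sigma_additive.

Let lebesgue_rV_sigma_finite : sigma_finite setT (@lebesgue_rV R n).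
Proof. by case: lebesgue_rV_sfinite. Qed.

HB.instance Definition _ := Measure_isSigmaFinite.Build _ _ _
  (@lebesgue_rV R n) lebesgue_rV_sigma_finite.

End lebesgue_rV_measure.

Lemma lebesgue_rVS (R : realType) n (A : set 'rV[R]_n.+1) :
  lebesgue_rV n.+1 A = (lebesgue_measure \x lebesgue_rV n)%E (cons_rV @^-1` A).
Proof. by []. Qed.

Lemma lebesgue_rV_cons (R : realType) n (A : set (measurableTypeR R))
    (B : set 'rV[R]_n) : measurable A -> measurable B ->
  lebesgue_rV n.+1 (cons_rV @` (A `*` B)) =
  (lebesgue_measure A * lebesgue_rV n B)%E.
Proof.
move=> mA mB; rewrite lebesgue_rVS (_ : cons_rV @^-1` _ = A `*` B).
  by rewrite product_measure1E.
apply/seteqP; split=> [p [q qAB /(congr1 uncons_rV)]|p ABp]; last by exists p.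
by rewrite !uncons_rVK => <-.
Qed.

Section function_spaces.
Context {R : realType}.
Variable n : nat.
Local Notation V := 'rV[R]_n.
Local Notation mu := (@lebesgue_rV R n).
Implicit Types (f g : V -> R) (x y : V).

Definition dot x y : R := \sum_i x ord0 i * y ord0 i.

(* The library norm `|x| on row vectors is the sup norm. *)
Definition enorm x : R := Num.sqrt (dot x x).

(* The iterated partial derivative along the coordinate directions in s. *)
Definition partial (s : seq 'I_n) f : V -> R :=
  foldr (fun i g => 'D_(delta_mx ord0 i) g) f s.

Definition smooth f : Prop := forall s : seq 'I_n,
  continuous (partial s f) /\
  forall i x, derivable (partial s f) x (delta_mx ord0 i).

Definition Cc_infty : set (V -> R) :=
  [set f | smooth f /\ compact (closure [set x | f x != 0])].

Definition Czero : set (V -> R) :=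
  [set f | continuous f /\ forall e : R, 0 < e ->
    exists2 K : set V, compact K & forall x, ~ K x -> `|f x| < e].

Definition Schwartz : set (V -> R) :=
  [set f | smooth f /\ forall (a : 'I_n -> nat) (s : seq 'I_n),
    exists M : R, forall x,
      `|(\prod_i x ord0 i ^+ a i) * partial s f x| <= M].

(* The elements of L^p are represented by Borel functions, not identified
   almost everywhere. *)
Definition L1 : set (V -> R) := [set f | f \in Lfun mu 1%E].
Definition L2 : set (V -> R) := [set f | f \in Lfun mu 2%:R%:E].
Definition Linfty : set (V -> R) := [set f | f \in Lfun mu +oo%E].

Definition inner f g : R := \int[mu]_x (f x * g x).

Definition star f g : V -> R := fun x => \int[mu]_y (f y * g (x + y)).

Definition convolution f g : V -> R := fun x => \int[mu]_y (f y * g (x - y)).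

(* e^{-2 pi i t} = cos (2 pi t) - i sin (2 pi t), integrated componentwise. *)
Definition fourier f : V -> R[i] := fun x =>
  (\int[mu]_y (f y * cos (2 * pi * dot x y))) -i*
  (\int[mu]_y (f y * sin (2 * pi * dot x y))).

Definition pos_type : set (V -> R) :=
  [set f | [/\ continuous f, Linfty f &
    forall g, L1 g -> 0 <= \int[mu]_x (star g g x * f x)]].

Definition COP_inv : set (V -> R) :=
  [set rho | L1 rho /\ forall phi, L2 phi ->
    {ae mu, forall x, 0 <= phi x} ->
    0 <= inner (convolution phi rho) phi].

Definition theta_SP (X C : set (V -> R)) : \bar R :=
  ereal_inf [set t : \bar R | exists f g,
    [/\ (pos_type `&` X) f, (C `&` X) g, fourier f 0 = 1,
        forall x, 1 <= enorm x -> f x + g x <= 0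
      & t = (f 0 + g 0)%:E]].

Definition cube (T : R) : set V :=
  [set x | forall i, - (T / 2) <= x ord0 i <= T / 2].

Definition upper_point_density (P : set V) : \bar R :=
  limf_esup (fun T : R => (counting (P `&` cube T) * ((T ^+ n)^-1)%:E)%E)
    (+oo : set_system R).

Definition Delta : \bar R :=
  ereal_sup [set upper_point_density P | P in
    [set P : set V | forall x y, P x -> P y -> x <> y -> 1 <= enorm (x - y)]].

End function_spaces.

Arguments Cc_infty R n : clear implicits.
Arguments Czero R n : clear implicits.
Arguments Schwartz R n : clear implicits.
Arguments L1 R n : clear implicits.
Arguments L2 R n : clear implicits.
Arguments Linfty R n : clear implicits.
Arguments pos_type R n : clear implicits.
Arguments COP_inv R n : clear implicits.
Arguments Delta R n : clear implicits.

(* Main.v *)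
(* Delta_n <= theta: for a packing of N balls in a cube of side T, let psi be the
   sum of N normalised indicators of tiny cubes at the centres and q = 1_Q for a
   slightly larger cube Q. Testing f (of positive type) against psi - c q and g
   (copositive) against psi >= 0 and adding, f + g <= 0 away from the diagonal
   leaves 2 c N (1 - e) <= N (f(0) + g(0)) + c^2 (1 + 2 e) |Q|; take c = N / |Q|.

   theta <= Delta_n: let f = h * h~ with h an almost flat bump of integral 1 on a
   cube of side T, and g = (m eta - 1) f, where eta is a smooth cutoff equal to 1
   on {|x|^2 <= r} (r < 1) and to 0 on {|x| >= 1}, and m bounds the number of
   points of the cube at mutual squared distances > r. Then f + g = m eta f
   vanishes on {|x| >= 1}, and f(0) + g(0) = m f(0) is about m / T^n, which
   periodised packings bound by about Delta_n. Copositivity of g is a continuous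
   Motzkin-Straus inequality, applied after writing f(x - y) as the integral over
   z of h(x + z) h(y + z), which localises the test function to cubes. *)
Require Import Defs.
From HB Require Import structures.
From mathcomp Require Import all_boot all_order all_algebra.
From mathcomp Require Import all_classical all_reals all_analysis.
From mathcomp Require Import measurable_realfun ess_sup_inf.
From mathcomp Require Import ring lra complex.

Set Implicit Arguments.
Unset Strict Implicit.
Unset Printing Implicit Defensive.

Import Order.TTheory GRing.Theory Num.Theory.
Import numFieldNormedType.Exports.

Local Open Scope classical_set_scope.
Local Open Scope ring_scope.

(** * Lebesgue measure on R^n *)

(** The cone COP is tested on nonnegative functions, positive type on functions of any sign: this is
    why [c q] is subtracted in the test of f alone. The value c = N / |Q| maximises 2 c N - c^2 |Q|.
    Test functions are genuine functions, so the centres carry small boxes instead of point masses,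
    and the continuity of f and g pays for the difference. In the other direction g has to be tested
    on nonnegative L^2 functions of unbounded support, whereas a finite m exists only for points in
    a bounded set; an autocorrelation f reconciles the two, and the same formula shows that f is of
    positive type. The gap between r and 1 comes from the continuity of eta. It is paid for by a
    dilation with factor slightly above 1, which turns separation above sqrt r into unit separation.
    Flatness matters because f(0) is the integral of h^2: among functions of integral 1 on a cube of
    side T this is at least T^-n by Cauchy-Schwarz, and a flat bump almost attains it. The lower
    inclusion for X admits this pair; the upper one makes every competitor bounded, continuous and
    integrable, as the packing test requires. *)

Section measure_preserving.
Local Open Scope ereal_scope.
Context d (T : measurableType d) {R : realType}.
Variables (mu : {measure set T -> \bar R}) (phi : T -> T).
Hypothesis mphi : measurable_fun setT phi.
Hypothesis pphi : forall A, measurable A -> mu (phi @^-1` A) = mu A.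

Lemma ge0_integral_preserving (f : T -> \bar R) : measurable_fun setT f ->
  (forall x, 0 <= f x) -> \int[mu]_x f (phi x) = \int[mu]_x f x.
Proof.
move=> mf f0; transitivity (\int[pushforward mu phi]_x f x).
  by rewrite ge0_integral_pushforward.
by apply: eq_measure_integral => A mA _; exact: pphi.
Qed.

Lemma integral_preserving (f : T -> \bar R) : measurable_fun setT f ->
  \int[mu]_x f (phi x) = \int[mu]_x f x.
Proof.
move=> mf; rewrite integralE [RHS]integralE; congr (_ - _).
  rewrite -(ge0_integral_preserving (f := f^\+))//; last exact: measurable_funepos.
  by apply: eq_integral => x _; rewrite (funepos_comp f phi).
rewrite -(ge0_integral_preserving (f := f^\-))//; last exact: measurable_funeneg.
by apply: eq_integral => x _; rewrite (funeneg_comp f phi).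
Qed.

End measure_preserving.

Section lebesgue_line.
Context {R : realType}.
Local Notation leb := (@lebesgue_measure R).

Lemma lebesgue_measure_translate (a : R) (A : set (measurableTypeR R)) :
  measurable A -> leb ((fun x => a + x) @^-1` A) = leb A.
Proof.
move=> mA; have mf : measurable_fun setT (fun x : measurableTypeR R => a + x : measurableTypeR R).
  by apply: measurable_funD.
rewrite -[LHS]/(pushforward leb (fun x : measurableTypeR R => a + x : measurableTypeR R) A).
apply/esym/lebesgue_measure_unique => //= _ [[b c]] _ <-.
rewrite /pushforward.
have -> : (fun x => a + x) @^-1` `]b, c] = `]b - a, c - a]%classic.
  by apply/seteqP; split => x /=; rewrite !in_itv/= ltrBlDl lerBrDl.
rewrite !lebesgue_measure_itv/= !lte_fin ltrD2r; case: ifP => // _.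
by rewrite -!EFinD; congr EFin; lra.
Qed.

End lebesgue_line.

Section lebesgue_rV_maps.
Context {R : realType}.

Definition coordmap n (t : 'I_n -> R -> R) (x : 'rV[R]_n) : 'rV[R]_n :=
  \row_i t i (x ord0 i).

Lemma measurable_coordmap n (t : 'I_n -> measurableTypeR R -> measurableTypeR R) :
  (forall i, measurable_fun setT (t i)) ->
  measurable_fun setT (coordmap t).
Proof.
move=> mt; apply: measurable_fun_rV => i.
rewrite (_ : (fun _ => _) = t i \o (fun x : 'rV[R]_n => x ord0 i)).
  exact: (measurableT_comp (mt i) (measurable_coord i)).
by apply/funext => x /=; rewrite mxE.
Qed.

(** Translations and the reflection act coordinate by coordinate, so both invariances come from this
    one induction on [n]: the induction hypothesis moves the sections, [t ord0] moves the outer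
    integral. *)
Lemma lebesgue_rV_coordmap n (t : 'I_n -> measurableTypeR R -> measurableTypeR R) :
  (forall i, measurable_fun setT (t i)) ->
  (forall i A, measurable A ->
     lebesgue_measure (t i @^-1` A) = lebesgue_measure A :> \bar R) ->
  forall A, measurable A -> lebesgue_rV n (coordmap t @^-1` A) = lebesgue_rV n A.
Proof.
elim: n t => [|n IH] t mt pt A mA.
  congr (lebesgue_rV 0 _); apply/seteqP; split => x /=;
  by rewrite (thinmx0 x) (thinmx0 (coordmap _ _)).
rewrite !lebesgue_rVS.
pose t' (i : 'I_n) := t (rshift 1 i).
have consE p : coordmap t (cons_rV p) = cons_rV (t ord0 p.1, coordmap t' p.2).
  apply/rowP => i; rewrite !mxE.
  case: split_ordP => j -> /=; rewrite !mxE //.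
  by congr (t _ _); apply/val_inj; rewrite (ord1 j).
pose B := cons_rV @^-1` A.
have mB : measurable B.
  by rewrite /B -[X in measurable X]setTI; exact: measurable_cons_rV.
have -> : cons_rV @^-1` (coordmap t @^-1` A) =
   (fun p => (t ord0 p.1, coordmap t' p.2)) @^-1` B.
  by apply/seteqP; split => p; rewrite /B/= consE.
rewrite /product_measure1/=.
rewrite -/B.
under eq_integral => x _.
  rewrite (_ : xsection _ x = coordmap t' @^-1` (xsection B (t ord0 x))); last first.
    by apply/seteqP; split => y; rewrite /xsection/= !inE.
  rewrite IH; [|by move=> i; exact: mt|by move=> i; exact: pt
    |exact: measurable_xsection].
  over.
pose G := fun x => lebesgue_rV n (xsection B x).
have mG : measurable_fun setT G by exact: measurable_fun_xsection.
exact: (ge0_integral_preserving (mt ord0) (pt ord0) mG).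
Qed.

Lemma lebesgue_rV_translate n (a : 'rV[R]_n) (A : set 'rV[R]_n) :
  measurable A -> lebesgue_rV n ((fun x => a + x) @^-1` A) = lebesgue_rV n A.
Proof.
move=> mA.
rewrite (_ : (fun x => a + x) = coordmap (fun i x => a ord0 i + x)); last first.
  by apply/funext => x; apply/rowP => i; rewrite !mxE.
apply: lebesgue_rV_coordmap => //.
  by move=> i; exact: measurable_funD.
by move=> i B mB; exact: lebesgue_measure_translate.
Qed.

Lemma lebesgue_rV_opp n (A : set 'rV[R]_n) :
  measurable A -> lebesgue_rV n (-%R @^-1` A) = lebesgue_rV n A.
Proof.
move=> mA.
rewrite (_ : -%R = coordmap (fun i x => - x)); last first.
  by apply/funext => x; apply/rowP => i; rewrite !mxE.
apply: lebesgue_rV_coordmap => //.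
  by move=> i; apply: measurable_funN.
by move=> i B mB; exact: lebesgue_measureN.
Qed.

Lemma measurable_addl n (a : 'rV[R]_n) : measurable_fun setT (fun x => a + x).
Proof.
rewrite (_ : (fun x => a + x) = coordmap (fun i x => a ord0 i + x)); last first.
  by apply/funext => x; apply/rowP => i; rewrite !mxE.
by apply: measurable_coordmap => i; exact: measurable_funD.
Qed.

Lemma measurable_oppV n : measurable_fun setT (-%R : 'rV[R]_n -> _).
Proof.
rewrite (_ : -%R = coordmap (fun i x => - x)); last first.
  by apply/funext => x; apply/rowP => i; rewrite !mxE.
by apply: measurable_coordmap => i; exact: measurable_funN.
Qed.

Lemma measurable_addV d (T : measurableType d) n (f g : T -> 'rV[R]_n) :
  measurable_fun setT f -> measurable_fun setT g ->
  measurable_fun setT (fun x => f x + g x).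
Proof.
move=> mf mg; apply: measurable_fun_rV => i.
rewrite (_ : (fun _ => _) = ((fun x => f x ord0 i) \+ (fun x => g x ord0 i))).
  exact: (measurable_funD (measurableT_comp (measurable_coord i) mf)
    (measurableT_comp (measurable_coord i) mg)).
by apply/funext => x; rewrite mxE.
Qed.

Local Open Scope ereal_scope.

Lemma integral_rV_translate n (a : 'rV[R]_n) (f : 'rV[R]_n -> \bar R) :
  measurable_fun setT f ->
  \int[lebesgue_rV n]_x f (a + x)%R = \int[lebesgue_rV n]_x f x.
Proof.
apply: integral_preserving; first exact: measurable_addl.
exact: lebesgue_rV_translate.
Qed.

Lemma integral_rV_opp n (f : 'rV[R]_n -> \bar R) :
  measurable_fun setT f ->
  \int[lebesgue_rV n]_x f (- x)%R = \int[lebesgue_rV n]_x f x.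
Proof.
apply: integral_preserving; first exact: measurable_oppV.
exact: lebesgue_rV_opp.
Qed.

Lemma ge0_integral_rVS n (f : 'rV[R]_n.+1 -> \bar R) : measurable_fun setT f ->
  (forall x, 0 <= f x) ->
  \int[lebesgue_rV n.+1]_x f x =
  \int[lebesgue_measure]_t \int[lebesgue_rV n]_x f (cons_rV (t, x)).
Proof.
move=> mf f0.
rewrite -(fubini_tonelli1 (fun p => f (cons_rV p)))//; last first.
  apply: measurableT_comp => //; exact: measurable_cons_rV.
rewrite -[RHS](@ge0_integral_pushforward _ _ _ _ _ (@cons_rV R n) _ _ setT)//.
exact: measurable_cons_rV.
Qed.

Lemma ge0_integral_rV_prod n (u : 'I_n -> measurableTypeR R -> R) :
  (forall i, measurable_fun setT (u i)) -> (forall i t, (0 <= u i t)%R) ->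
  \int[lebesgue_rV n]_x (\prod_i u i (x ord0 i))%:E =
  \prod_i \int[lebesgue_measure]_t (u i t)%:E.
Proof.
elim: n u => [|n IH] u mu u0.
  rewrite big_ord0 (eq_integral (cst 1)); last by move=> x _; rewrite big_ord0.
  by rewrite integral_cst//= mul1e /lebesgue_rV /dirac indicT.
have mprod k (v : 'I_k -> measurableTypeR R -> R) : (forall i, measurable_fun setT (v i)) ->
    measurable_fun setT (fun x : 'rV[R]_k => \prod_i v i (x ord0 i))%R.
  move=> mv; apply: measurable_prod => i _.
  exact: (measurableT_comp (mv i) (measurable_coord i)).
rewrite ge0_integral_rVS; last 2 first.
- by apply/measurable_EFinP; exact: mprod.
- by move=> x; rewrite lee_fin; apply: prodr_ge0 => i _; exact: u0.
rewrite big_ord_recl -IH; [|by move=> i; exact: mu|by move=> i; exact: u0].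
set C := (X in _ = _ * X).
have C0 : 0 <= C.
  by apply: integral_ge0 => x _; rewrite lee_fin; apply: prodr_ge0 => i _; exact: u0.
rewrite -ge0_integralZr//; last 2 first.
- exact/measurable_EFinP.
- by move=> t _; rewrite lee_fin.
apply: eq_integral => t _; rewrite -ge0_integralZl//; last 3 first.
- by apply/measurable_EFinP; apply: (mprod _ (fun i => u (lift ord0 i))) => i; exact: mu.
- by move=> x _; rewrite lee_fin; apply: prodr_ge0 => i _; exact: u0.
- by rewrite lee_fin.
apply: eq_integral => x _; rewrite -EFinM big_ord_recl; congr ((_ * _)%R)%:E.
  congr (u _ _); rewrite /cons_rV mxE.
  by case: split_ordP => j; rewrite ?mxE// => /(congr1 val).
apply: eq_bigr => i _; congr (u _ _).
rewrite /cons_rV (_ : lift ord0 i = rshift 1 i); last exact/val_inj.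
by rewrite (@row_mxEr _ 1 1 n).
Qed.

End lebesgue_rV_maps.

(** * Borel measurability, Euclidean norm and cubes in R^n *)

Section rV_basic.
Context {R : realType}.

Lemma continuous_coord n (i : 'I_n) : continuous (fun x : 'rV[R]_n => x ord0 i).
Proof. by move=> x; exact: coord_continuous. Qed.

Lemma cvg_rV (T : Type) (F : set_system T) (FF : Filter F) n
    (f : T -> 'rV[R]_n) (l : 'rV[R]_n) :
  (forall i, (fun t => f t ord0 i) @ F --> l ord0 i) -> f @ F --> l.
Proof.
move=> fl; apply/cvgrPdist_lt => e e0.
have : \forall t \near F, forall i, `|l ord0 i - f t ord0 i| < e.
  by apply: filter_forall => i; move/cvgrPdist_lt : (fl i); exact.
apply: filterS => t Ht.
rewrite /Num.norm/= mx_normrE; apply: bigmax_lt => // -[a b] _/=.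
by rewrite (ord1 a) !mxE.
Qed.

(** The sigma-algebra is generated by the coordinates, so open sets are not measurable by
    definition. Rounding the coordinates down to the grid of mesh 1/(k+1) gives functions with
    countably many values on measurable cells, and by continuity they converge pointwise to [f]. *)
Lemma continuous_measurable_rV n (f : 'rV[R]_n -> R) :
  continuous f -> measurable_fun setT f.
Proof.
move=> cf.
pose q k (m : 'rV[int]_n) : 'rV[R]_n := \row_i ((m ord0 i)%:~R / k.+1%:R).
pose r k (x : 'rV[R]_n) : 'rV[int]_n := \row_i Num.floor (x ord0 i * k.+1%:R).
apply: (@measurable_fun_cvg _ _ _ setT (fun k x => f (q k (r k x)))) => //.
  move=> k _ Y mY; rewrite setTI.
  rewrite (_ : _ @^-1` Y = \bigcup_(m : 'rV[int]_n)
     (if f (q k m) \in Y then r k @^-1` [set m] else set0)); last first.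
    apply/seteqP; split=> [x /= Yx|x [m _]].
      by exists (r k x) => //; rewrite mem_set.
    by case: ifPn => //; rewrite inE => Yq /= ->.
  apply: countable_bigcupT_measurable => [|m]; first exact: countableP.
  case: ifPn => // _.
  rewrite (_ : _ @^-1` _ = \bigcap_(i : 'I_n) [set x : 'rV[R]_n |
     (m ord0 i)%:~R <= x ord0 i * k.+1%:R < (m ord0 i + 1)%:~R]); last first.
    apply/seteqP; split=> [x /= <- i _|x /= xm].
      by rewrite /= mxE floor_itv.
    by apply/rowP => i; rewrite mxE; apply: floor_def; exact: xm.
  apply: fin_bigcap_measurable => [|i _]; first exact: finite_finset.
  have mi : measurable_fun setT (fun x : 'rV[R]_n => x ord0 i * k.+1%:R).
    by apply: measurable_funM => //; exact: measurable_coord.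
  rewrite -[X in measurable X]setTI.
  have -> : [set x : 'rV[R]_n |
     (m ord0 i)%:~R <= x ord0 i * k.+1%:R < (m ord0 i + 1)%:~R] =
     (fun x : 'rV[R]_n => x ord0 i * k.+1%:R) @^-1` `[(m ord0 i)%:~R, (m ord0 i + 1)%:~R[%classic.
    by apply/seteqP; split => x /=; rewrite in_itv.
  exact: mi.
move=> x _; apply: (@cvg_comp _ _ _ (fun k => q k (r k x)) f); last exact: cf.
apply: cvg_rV => i; apply/cvgrPdist_lt => e e0.
near=> k; rewrite !mxE.
have k0 : 0 < k.+1%:R :> R by [].
have /andP[h1 h2] := floor_itv (x ord0 i * k.+1%:R).
rewrite ger0_norm; last by rewrite subr_ge0 ler_pdivrMr.
rewrite ltrBlDr -ltrBlDl -(ltr_pM2r k0) mulrBl.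
rewrite intrD1 in h2.
have he : 1 <= e * k.+1%:R.
  near: k.
  have := (near_infty_natSinv_lt (PosNum e0)); apply: filterS => k /= hk.
  by rewrite -ler_pdivrMr// div1r ltW.
by rewrite divfK ?gt_eqF//; lra.
Unshelve. all: end_near. Qed.

Lemma coord_le_enorm n (x : 'rV[R]_n) i : `|x ord0 i| <= enorm x.
Proof.
rewrite /enorm -sqrtr_sqr ler_wsqrtr// /dot (bigD1 i)//= expr2 lerDl.
by apply: sumr_ge0 => j _; rewrite -expr2 sqr_ge0.
Qed.

Lemma dot_ge0 n (x : 'rV[R]_n) : 0 <= dot x x.
Proof. by apply: sumr_ge0 => j _; rewrite -expr2 sqr_ge0. Qed.

Lemma enorm_ge1 n (x : 'rV[R]_n) : (1 <= enorm x) = (1 <= dot x x).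
Proof.
by rewrite /enorm -{1}[1]sqrtr1 ler_psqrt ?nnegrE ?dot_ge0.
Qed.

Lemma measurable_cube n (L : R) : measurable (cube L : set 'rV[R]_n).
Proof.
rewrite (_ : cube L = \bigcap_(i : 'I_n) [set x : 'rV[R]_n | - (L / 2) <= x ord0 i <= L / 2]).
  apply: fin_bigcap_measurable => [|i _]; first exact: finite_finset.
  rewrite -[X in measurable X]setTI.
  have -> : [set x : 'rV[R]_n | - (L / 2) <= x ord0 i <= L / 2] =
      (fun x : 'rV[R]_n => x ord0 i) @^-1` `[- (L / 2), L / 2]%classic.
    by apply/seteqP; split => x /=; rewrite in_itv.
  exact: measurable_coord.
by apply/seteqP; split => x /= h i; [move=> _|]; exact: h.
Qed.

Lemma indic_cube n (L : R) (x : 'rV[R]_n) :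
  \1_(cube L) x = \prod_i \1_(`[- (L / 2), L / 2]%classic) (x ord0 i) :> R.
Proof.
rewrite indicE; case: (boolP (x \in cube L)) => /= [/set_mem xL|xL].
  rewrite big1// => i _; rewrite indicE mem_set//=.
  by rewrite in_itv/= xL.
apply/esym/eqP; rewrite prodf_seq_eq0; apply/hasP.
have /existsNP[i /negP xi] : ~ cube L x by move=> h; move: xL; rewrite mem_set.
exists i; first by rewrite mem_index_enum.
by rewrite /= indicE memNset//= in_itv/=; exact/negP.
Qed.

Lemma lebesgue_rV_cube n (L : R) : 0 <= L ->
  lebesgue_rV n (cube L) = (L ^+ n)%:E.
Proof.
move=> L0; rewrite -[LHS]mul1e -[LHS](integral_cst (lebesgue_rV n)); last exact: measurable_cube.
transitivity (\int[lebesgue_rV n]_x (\1_(cube L) x : R)%:E)%E.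
  by rewrite integral_indic ?setIT ?integral_cst ?mul1e//; exact: measurable_cube.
under eq_integral do rewrite indic_cube.
rewrite (ge0_integral_rV_prod (u := fun=> \1_(`[- (L / 2), L / 2]%classic)))//.
transitivity (\prod_(i < n) L%:E)%E.
  apply: eq_bigr => i _; rewrite integral_indic// setIT.
  have /= -> := lebesgue_measure_itv `[- (L / 2), L / 2].
  rewrite lte_fin; case: ifPn => [_|].
    by rewrite -EFinB; congr EFin; lra.
  by rewrite -leNgt => h; congr EFin; lra.
by rewrite prodEFin prodr_const card_ord.
Qed.

Lemma cube_compact n (L : R) : compact (cube L : set 'rV[R]_n).
Proof.
rewrite (_ : cube L = [set x : 'rV[R]_n | forall i, `[- (L / 2), L / 2]%classic (x ord0 i)]).
  by apply: (@rV_compact R n (fun=> `[- (L / 2), L / 2]%classic)) => i; exact: segment_compact.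
by apply/seteqP; split => x /= h i; move: (h i); rewrite in_itv.
Qed.

Lemma cube_norm n (L : R) (x : 'rV[R]_n) :
  cube L x <-> forall i, `|x ord0 i| <= L / 2.
Proof. by split=> h i; move: (h i); rewrite ler_norml. Qed.

Lemma cubeS n (L M : R) : L <= M -> cube L `<=` (cube M : set 'rV[R]_n).
Proof.
by move=> LM x /cube_norm h; apply/cube_norm => i; have := h i; lra.
Qed.

Lemma cubeD n (L M : R) (x y : 'rV[R]_n) :
  cube L x -> cube M y -> cube (L + M) (x + y).
Proof.
move=> /cube_norm hx /cube_norm hy; apply/cube_norm => i; rewrite mxE.
by rewrite (le_trans (ler_normD _ _))//; have := hx i; have := hy i; lra.
Qed.

Lemma cubeN n (L : R) (x : 'rV[R]_n) : cube L x -> cube L (- x).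
Proof. by move=> /cube_norm hx; apply/cube_norm => i; rewrite mxE normrN. Qed.

End rV_basic.

(** * Smooth functions and the kernel h * h~ *)

Section flat_functions.
Context {R : realType}.

(** Each monomial is dominated by one term of the exponential series. With u = 1/t this gives the
    decay of [flat] at 0. *)
Lemma poly_expR_bound (q : {poly R}) :
  exists2 M, 0 <= M & forall u : R, 0 <= u -> `|q.[u]| * expR (- u) <= M.
Proof.
exists (\sum_(i < size q) `|q`_i| * i.+1`!%:R).
  by apply: sumr_ge0 => i _; apply: mulr_ge0.
move=> u u0; rewrite horner_coef.
rewrite (le_trans (ler_wpM2r (expR_ge0 _) (ler_norm_sum _ _ _)))//.
rewrite mulr_suml; apply: ler_sum => i _.
rewrite normrM -mulrA ler_wpM2l// expRN ler_pdivrMr ?expR_gt0//.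
rewrite ger0_norm ?exprn_ge0//.
case: (val i) => [|k].
  rewrite expr0 mul1r (le_trans _ (expR_ge1Dx u))//; lra.
have h := expR_ge1Dxn k u0.
have f0 : 0 < k.+1`!%:R :> R by rewrite ltr0n fact_gt0.
have : u ^+ k.+1 / k.+1`!%:R <= expR u by lra.
rewrite ler_pdivrMr// mulrC => /le_trans; apply.
rewrite ler_wpM2r ?expR_ge0// ler_nat factS.
by rewrite leq_pmull.
Qed.

(** The classical e^{-1/t} extended by 0, with a polynomial in 1/t as a parameter so that the family
    is stable under differentiation. *)
Definition flat (p : {poly R}) (t : R) : R :=
  if 0 < t then p.[t^-1] * expR (- t^-1) else 0.

(* (p(1/t) e^{-1/t})' = (p - p')(1/t) t^{-2} e^{-1/t}. *)
Lemma is_derive_flat p t :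
  is_derive t (1 : R) (flat p) (flat ('X^2 * (p - p^`())) t).
Proof.
have [t0|t0|->] := ltgtP t 0.
- apply: (@near_eq_is_derive _ _ _ (cst 0)).
    near=> s; rewrite /flat ifF//; apply/negbTE; rewrite -leNgt ltW//.
    by near: s; apply: lt_nbhsl.
  by rewrite /flat ltNge (ltW t0)/=; exact: is_derive_cst.
- apply: (@near_eq_is_derive _ _ _ (fun s : R => p.[s^-1] * expR (- s^-1))).
    near=> s; rewrite /flat ifT//.
    by near: s; apply: lt_nbhsr.
  rewrite /flat t0.
  have t0' : t != 0 by rewrite gt_eqF.
  have dV : is_derive t (1 : R) (fun s : R => s^-1) (- t^-2 *: 1).
    by apply: is_deriveV => //; exact: is_derive_id.
  have d1 : is_derive t (1 : R) (horner p \o (fun s : R => s^-1)) (p^`().[t^-1] * (- t^-2 *: 1)).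
    exact: is_derive1_comp.
  have d2 : is_derive t (1 : R) (expR \o (- (fun s : R => s^-1))) (expR (- t^-1) * - (- t^-2 *: 1)).
    exact: is_derive1_comp.
  apply: (@is_derive_eq _ _ _ _ _ _ _ _ (is_deriveM d1 d2)).
  rewrite /= !hornerE /GRing.scale/= -exprVn; ring.
- rewrite /flat ltxx.
  (* For h > 0 the difference quotient at 0 is p(1/h) e^{-1/h} / h. The two extra powers of 1/h in
     this bound make it at most M h. *)
  have [M M0 HM] := poly_expR_bound ('X^2 * p).
  have : h^-1 *: ((flat p \o shift 0) (h *: 1) - flat p 0) @[h --> 0^'] --> (0:R).
    apply/cvgrPdist_le => e e0; near=> h.
    rewrite sub0r normrN /= /GRing.scale/= mulr1 addr0 {2}/flat ltxx subr0.
    rewrite /flat; case: ifPn => h0; last by rewrite mulr0 normr0 ltW.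
    have := HM h^-1; rewrite invr_ge0 (ltW h0) => /(_ isT).
    rewrite !hornerE => HM'.
    rewrite normrM normrM (ger0_norm (expR_ge0 _)) gtr0_norm ?invr_gt0//.
    rewrite -mulrA ler_pdivrMl//.
    move: HM'; rewrite normrM (ger0_norm (exprn_ge0 _ _)); last first.
      by rewrite invr_ge0 ltW.
    set X := `|_| * expR _; rewrite -mulrA -/X exprVn ler_pdivrMl ?exprn_gt0// => /le_trans; apply.
    rewrite expr2 -mulrA ler_pM2l//.
    have : h * (M + 1) <= e.
      rewrite -ler_pdivlMr; last by lra.
      apply: le_trans (ler_norm _) _; rewrite ltW//.
      near: h; apply: dnbhs0_lt; rewrite divr_gt0//; lra.
    by rewrite mulrDr mulr1; apply: le_trans; rewrite lerDl ltW.
  move=> H; apply: DeriveDef; first by apply/cvg_ex; exists 0.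
  by rewrite /derive; apply/cvg_lim.
Unshelve. all: end_near. Qed.

End flat_functions.

Section smooth_class.
Context {R : realType}.

(** Restriction to a line reduces the chain rule for directional derivatives to the one-variable
    rule, see [is_derive_comp1]. *)
Lemma is_derive_line (V : normedModType R) (f : V -> R) (x v : V) (df : R) :
  is_derive x v f df <-> is_derive (0 : R) 1 (fun h : R => f (h *: v + x)) df.
Proof.
suff E : (fun h : R => h^-1 *: ((f \o shift x) (h *: v) - f x)) =
  (fun h : R => h^-1 *: (((fun k : R => f (k *: v + x)) \o shift 0) (h *: 1) - f (0 *: v + x))).
  split=> -[H1 H2]; (split; [by move: H1; rewrite /derivable E|by move: H2; rewrite /derive E]).
by apply/funext => h /=; rewrite addr0 scale0r add0r [h *: 1]mulr1.
Qed.

Lemma is_derive_comp1 (V : normedModType R) (phi : R -> R) (f : V -> R) (x v : V) (a b : R) :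
  is_derive (f x) 1 phi a -> is_derive x v f b -> is_derive x v (fun y => phi (f y)) (a * b).
Proof.
move=> dphi /is_derive_line df; apply/is_derive_line.
apply: (@is_derive1_comp _ phi (fun h => f (h *: v + x))) => //.
by rewrite scale0r add0r.
Qed.

(* Contains everything used below and is closed under directional derivatives
   (sm_derive), so its members are smooth; in sm_comp the family phi lists the
   successive derivatives of the outer function. *)
Inductive sm (V : normedModType R) : (V -> R) -> Prop :=
| sm_cst c : sm (fun=> c)
| sm_lin (l : V -> R) : continuous l -> linear l -> sm l
| sm_add f g : sm f -> sm g -> sm (fun x => f x + g x)
| sm_mul f g : sm f -> sm g -> sm (fun x => f x * g x)
| sm_inv f : sm f -> (forall x, f x != 0) -> sm (fun x => (f x)^-1)
| sm_comp (phi : nat -> R -> R) k f :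
    (forall j t, is_derive t (1 : R) (phi j) (phi j.+1 t)) -> sm f ->
    sm (fun x => phi k (f x)).

Lemma sm_continuous (V : normedModType R) (f : V -> R) : sm f -> continuous f.
Proof.
elim => {f} [c|l cl _|f g _ cf _ cg|f g _ cf _ cg|f _ cf f0|phi k f dphi _ cf] x.
- exact: cvg_cst.
- exact: cl.
- exact: cvgD (cf x) (cg x).
- exact: cvgM (cf x) (cg x).
- exact: cvgV (f0 x) (cf x).
- apply: (@cvg_comp _ _ _ f (phi k)); first exact: cf.
  have [/derivable1_diffP/differentiable_continuous H _] := dphi k (f x).
  exact: H.
Qed.

Lemma sm_derive (V : normedModType R) (f : V -> R) (v : V) : sm f ->
  exists2 g, sm g & forall x, is_derive x v f (g x).
Proof.
elim => {f} [c|l cl ll|f g sf [f' sf' df] sg [g' sg' dg]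
    |f g sf [f' sf' df] sg [g' sg' dg]|f sf [f' sf' df] f0|phi k f dphi sf [f' sf' df]].
- by exists (fun=> 0); [exact: sm_cst|move=> x; exact: is_derive_cst].
- exists (fun=> l v); first exact: sm_cst.
  have l0 : l 0 = 0.
    by have := ll (-1) 0 0; rewrite scaler0 addr0 [(-1) *: _]mulN1r => {1}->; rewrite addNr.
  move=> x; suff : h^-1 *: ((l \o shift x) (h *: v) - l x) @[h --> 0^'] --> (l v:R).
    move=> H; split; first by apply/cvg_ex; exists (l v).
    by apply/cvg_lim.
  apply: cvg_near_cst; near=> h => /=.
  rewrite ll addrK [_ *: (_ *: _)]mulrA mulVf ?mul1r//.
  near: h; exact: nbhs_dnbhs_neq.
- exists (fun x => f' x + g' x); first exact: sm_add.
  by move=> x; exact: is_deriveD (df x) (dg x).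
- exists (fun x => f x * g' x + g x * f' x).
    by apply: sm_add; apply: sm_mul.
  by move=> x; exact: is_deriveM (df x) (dg x).
- exists (fun x => (-1 * ((f x)^-1 * (f x)^-1)) * f' x).
    apply: sm_mul => //; apply: sm_mul; first exact: sm_cst.
    by apply: sm_mul; apply: sm_inv.
  move=> x; apply: (@is_derive_comp1 V (fun t => t^-1) f) => //.
  apply: is_derive_eq; first by apply: is_deriveV (f0 x) _; exact: is_derive_id.
  by rewrite /GRing.scale/= -exprVn expr2 mulr1 mulN1r.
- exists (fun x => phi k.+1 (f x) * f' x); first by apply: sm_mul => //; exact: sm_comp.
  move=> x; exact: is_derive_comp1.
Unshelve. all: end_near. Qed.

Lemma sm_ext (V : normedModType R) (f g : V -> R) : f =1 g -> sm f -> sm g.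
Proof. by move=> /funext ->. Qed.

Lemma sm_smooth n (f : 'rV[R]_n -> R) : sm f -> smooth f.
Proof.
move=> sf s; have sp : sm (partial s f).
  elim: s => [//|i s IH] /=.
  have [g sg dg] := sm_derive (delta_mx ord0 i) IH.
  by apply: sm_ext sg => x; rewrite derive_val.
split; first exact: sm_continuous.
by move=> i x; have [g _ dg] := sm_derive (delta_mx ord0 i) sp; case: (dg x).
Qed.

(** Produces the sequence of derivatives that [sm_comp] asks for, so that a one-variable member of
    [sm] can serve as an outer function. *)
Lemma sm_seq (f : R -> R) : sm f -> exists2 phi : nat -> R -> R, phi 0%N = f &
  forall j t, is_derive t (1 : R) (phi j) (phi j.+1 t).
Proof.
move=> sf; pose phi := fun j => iter j (fun g : R -> R => 'D_1 g) f.
exists phi => //.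
have sp j : sm (phi j).
  elim: j => [//|j IH] /=.
  have [g sg dg] := sm_derive (1:R) IH.
  by apply: sm_ext sg => x; rewrite -(@derive_val _ _ _ _ _ _ _ (dg x)).
move=> j t; have [g _ dg] := sm_derive (1 : R) (sp j).
by have [H _] := dg t; split.
Qed.

Lemma sm_prod (V : normedModType R) n (F : 'I_n -> V -> R) :
  (forall i, sm (F i)) -> sm (fun x => \prod_i F i x).
Proof.
elim: n F => [|n IH] F sF.
  by apply: sm_ext (sm_cst _ 1) => x; rewrite big_ord0.
apply: sm_ext (sm_mul (sF ord0) (IH (fun i => F (lift ord0 i)) _)) => [x|i]; last exact: sF.
by rewrite big_ord_recl.
Qed.

Lemma sm_sum (V : normedModType R) n (F : 'I_n -> V -> R) :
  (forall i, sm (F i)) -> sm (fun x => \sum_i F i x).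
Proof.
elim: n F => [|n IH] F sF.
  by apply: sm_ext (sm_cst _ 0) => x; rewrite big_ord0.
apply: sm_ext (sm_add (sF ord0) (IH (fun i => F (lift ord0 i)) _)) => [x|i]; last exact: sF.
by rewrite big_ord_recl.
Qed.

Lemma sm_coord n (i : 'I_n) : sm (fun x : 'rV[R]_n => x ord0 i).
Proof.
apply: sm_lin; first exact: continuous_coord.
by move=> a x y; rewrite !mxE.
Qed.

Lemma sm_flat (V : normedModType R) (f : V -> R) : sm f -> sm (fun x => flat 1 (f x)).
Proof.
move=> sf; pose phi (j : nat) : R -> R :=
  flat (iter j (fun p : {poly R} => 'X^2 * (p - p^`())) 1).
by apply: (@sm_comp _ phi 0 f) => // j t; exact: is_derive_flat.
Qed.

(** The usual smooth step, descending from 1 at [a] to 0 at [b]; for a < b the two summands of the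
    denominator never vanish together. *)
Definition cutoff (a b t : R) : R := flat 1 (b - t) / (flat 1 (b - t) + flat 1 (t - a)).

Lemma flat1_ge0 (t : R) : 0 <= flat 1 t.
Proof. by rewrite /flat; case: ifP => // _; rewrite hornerE mul1r expR_ge0. Qed.

Lemma flat1_gt0 (t : R) : 0 < t -> 0 < flat 1 t.
Proof. by rewrite /flat => ->; rewrite hornerE mul1r expR_gt0. Qed.

Lemma flat1_eq0 (t : R) : t <= 0 -> flat 1 t = 0.
Proof. by rewrite /flat ltNge => ->. Qed.

Lemma cutoff_den_gt0 (a b t : R) : a < b -> 0 < flat 1 (b - t) + flat 1 (t - a).
Proof.
move=> ab; have [tb|bt] := ltP t b.
  by rewrite ltr_wpDr ?flat1_ge0// flat1_gt0// subr_gt0.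
by rewrite ltr_wpDl ?flat1_ge0// flat1_gt0// subr_gt0 (lt_le_trans ab).
Qed.

Lemma cutoff_ge0 (a b t : R) : 0 <= cutoff a b t.
Proof. by rewrite divr_ge0 ?addr_ge0 ?flat1_ge0. Qed.

Lemma cutoff_le1 (a b t : R) : a < b -> cutoff a b t <= 1.
Proof.
by move=> ab; rewrite ler_pdivrMr ?cutoff_den_gt0// mul1r lerDl flat1_ge0.
Qed.

Lemma cutoff_eq1 (a b t : R) : a < b -> t <= a -> cutoff a b t = 1.
Proof.
move=> ab ta; rewrite /cutoff (flat1_eq0 (t := t - a)) ?subr_le0// addr0 divff//.
by rewrite gt_eqF// flat1_gt0// subr_gt0 (le_lt_trans ta).
Qed.

Lemma cutoff_eq0 (a b t : R) : b <= t -> cutoff a b t = 0.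
Proof. by move=> bt; rewrite /cutoff flat1_eq0 ?mul0r// subr_le0. Qed.

Lemma sm_cutoff (V : normedModType R) (f : V -> R) (a b : R) : a < b ->
  sm f -> sm (fun x => cutoff a b (f x)).
Proof.
move=> ab sf.
have s1 : sm (fun x => flat 1 (b - f x)).
  apply: sm_flat; apply: sm_add; first exact: sm_cst.
  by apply: sm_ext (sm_mul (sm_cst _ (-1)) sf) => x; rewrite mulN1r.
apply: sm_mul => //; apply: sm_inv; last by move=> x; rewrite gt_eqF// cutoff_den_gt0.
apply: sm_add => //; apply: sm_flat; apply: sm_add => //; exact: sm_cst.
Qed.

End smooth_class.

Section integrable_support.
Context d (T : measurableType d) {R : realType} (mu : {measure set T -> \bar R}).

Lemma integrable_bounded_support (A : set T) (f : T -> R) (M : R) :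
  measurable A -> (mu A < +oo)%E -> measurable_fun setT f ->
  (forall x, `|f x| <= M) -> (forall x, ~ A x -> f x = 0) ->
  mu.-integrable setT (EFin \o f).
Proof.
move=> mA Aoo mf fM f0.
have -> : EFin \o f = (EFin \o f) \_ A.
  apply/funext => x; rewrite patchE; case: ifPn => //.
  by rewrite notin_setE => /f0 /= ->.
apply/(integrable_mkcond _ mA).
apply: measurable_bounded_integrable => //; first exact: measurable_funTS.
exists M; split; first exact: num_real.
by move=> x Mx y _ /=; rewrite (le_trans (fM y))// ltW.
Qed.

End integrable_support.

(** * Flat bumps and their autocorrelations *)

Section bump.
Context {R : realType}.
Local Notation leb := (@lebesgue_measure R).

Lemma continuous_bounded_itv (f : R -> R) (a b : R) : continuous f ->
  exists2 M, 0 <= M & forall x, a <= x <= b -> `|f x| <= M.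
Proof.
move=> cf.
have [|M [_ HM]] := @compact_bounded R R (f @` `[a, b]%classic).
  apply: continuous_compact; last exact: segment_compact.
  exact: continuous_subspaceT.
exists (`|M| + 1); first by rewrite addr_ge0.
move=> x xab; apply: (HM (`|M| + 1)); first by rewrite (le_lt_trans (ler_norm _))// ltrDl.
by exists x => //=; rewrite in_itv.
Qed.

Lemma continuous_support_integrable (f : R -> R) (L : R) : continuous f ->
  (forall t, L <= `|t| -> f t = 0) -> leb.-integrable setT (EFin \o f).
Proof.
move=> cf f0.
have [M M0 HM] := continuous_bounded_itv (- `|L|) `|L| cf.
apply: (@integrable_bounded_support _ _ _ leb `[- `|L|, `|L|]%classic _ M) => //.
- by rewrite [X in (X < _)%E]lebesgue_measure_itv/=; case: ifP => // _; rewrite ltry.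
- exact: continuous_measurable_fun.
- move=> x; have [h|h] := leP `|x| `|L|; first by apply: HM; rewrite -ler_norml.
  by rewrite f0 ?normr0// ltW// (le_lt_trans (ler_norm _) h).
- move=> x /=; rewrite in_itv/= -ler_norml => /negP; rewrite -ltNge => h.
  by rewrite f0// ltW// (le_lt_trans (ler_norm _) h).
Qed.

(** Normalise a cutoff q of t^2 that is 1 for |t| <= T/2 - 1 and 0 for |t| >= T/2. Its integral I is
    at least T - 2, and q <= 1 gives a squared integral of at most I / I^2 = 1 / I. *)
Lemma exists_bump (T : R) : 2 < T -> exists k : R -> R,
  [/\ sm k, forall t, 0 <= k t, forall t, T / 2 <= `|t| -> k t = 0,
      (\int[leb]_t (k t)%:E = 1)%E &
      (\int[leb]_t (k t * k t)%:E <= ((T - 2)^-1)%:E)%E].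
Proof.
move=> T2; pose a := (T / 2 - 1) ^+ 2; pose b := (T / 2) ^+ 2.
have ab : a < b by rewrite /a /b; nra.
pose q t := cutoff a b (t * t).
have sq : sm q.
  apply: sm_cutoff => //; have sid : sm (fun t : R => t).
    by apply: sm_lin => // x; exact: cvg_id.
  exact: sm_mul.
have q0 t : 0 <= q t by exact: cutoff_ge0.
have q1 t : q t <= 1 by exact: cutoff_le1.
have qs t : T / 2 <= `|t| -> q t = 0.
  move=> Tt; apply: cutoff_eq0; rewrite -expr2 -real_normK ?num_real// /b.
  rewrite ler_pXn2r// nnegrE; lra.
have cq : continuous q by exact: sm_continuous.
have iq : leb.-integrable setT (EFin \o q) by exact: continuous_support_integrable qs.
pose I := \int[leb]_t q t.
have IE : (\int[leb]_t (q t)%:E = I%:E)%E by rewrite fineK//; exact: integrable_fin_num.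
have mq : measurable_fun setT q by exact: continuous_measurable_fun.
have IT : T - 2 <= I.
  rewrite -lee_fin -IE.
  have -> : (T - 2)%:E = (\int[leb]_t (\1_(`[- (T / 2 - 1), T / 2 - 1]%classic) t)%:E)%E.
    rewrite integral_indic// setIT.
    have /= -> := lebesgue_measure_itv `[- (T / 2 - 1), T / 2 - 1].
    rewrite lte_fin ifT; last by lra.
    by rewrite -EFinB; congr EFin; lra.
  apply: ge0_le_integral => //.
  - by apply/measurable_EFinP.
  - by apply/measurable_EFinP.
  - move=> x _; rewrite lee_fin indicE; case: (boolP (_ \in _)) => // /set_mem /=.
    rewrite in_itv/= => hx; rewrite /q cutoff_eq1// /a.
    nra.
have I0 : 0 < I by lra.
exists (fun t => I^-1 * q t); split.
- by apply: sm_mul => //; exact: sm_cst.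
- by move=> t; rewrite mulr_ge0// invr_ge0 ltW.
- by move=> t /qs ->; rewrite mulr0.
- under eq_integral do rewrite EFinM.
  rewrite ge0_integralZl//; last 3 first.
  + by apply/measurable_EFinP.
  + by move=> x _; rewrite lee_fin.
  + by rewrite lee_fin invr_ge0 ltW.
  by rewrite IE -EFinM mulVf// gt_eqF.
- apply: (@le_trans _ _ (\int[leb]_t ((I^-1 * I^-1)%:E * (q t)%:E))%E).
    apply: ge0_le_integral => //.
    + by move=> x _; rewrite lee_fin mulr_ge0// mulr_ge0// invr_ge0 ltW.
    + by apply/measurable_EFinP; apply: measurable_funM; apply: measurable_funM.
    + by apply/measurable_EFinP; apply: measurable_funM.
    + move=> x _; rewrite -EFinM lee_fin mulrACA ler_wpM2l//.
        by rewrite mulr_ge0// invr_ge0 ltW.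
      by rewrite ler_piMl.
  rewrite ge0_integralZl//; last 3 first.
  + by apply/measurable_EFinP.
  + by move=> x _; rewrite lee_fin.
  + by rewrite lee_fin mulr_ge0// invr_ge0 ltW.
  rewrite IE -EFinM lee_fin -mulrA mulVf ?gt_eqF// mulr1 lef_pV2// posrE; lra.
Qed.

(** The two arguments are kept apart because only the second factor is differentiated: the
    derivatives of [autocorr k k] are [autocorr k] of the derivatives of [k]. *)
Definition autocorr (k k' : R -> R) (t : R) : R := \int[leb]_y (k y * k' (t + y)).

Lemma sm_autocorr (k : R -> R) (L : R) : sm k -> (forall t, 0 <= k t) ->
  (forall t, L <= `|t| -> k t = 0) -> sm (autocorr k k).
Proof.
move=> sk k0 ks; have [psi psi0 dpsi] := sm_seq sk.
have ck : continuous k by exact: sm_continuous.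
have cpsi j : continuous (psi j).
  move=> t; have [/derivable1_diffP/differentiable_continuous H _] := dpsi j t; exact: H.
suff dF j t : is_derive t (1 : R) (autocorr k (psi j)) (autocorr k (psi j.+1) t).
  have := @sm_comp R R (fun j => autocorr k (psi j)) 0 id dF; rewrite psi0; apply.
  by apply: sm_lin => // x; exact: cvg_id.
pose L' := `|L|.
have ks' y : L' < `|y| -> k y = 0.
  by move=> h; apply: ks; rewrite ltW// (le_lt_trans _ h)// ler_norm.
(* Domination for differentiating under the integral: for |x - t| < 1 and |y| <= L' the point x + y
   stays in this interval, and outside |y| <= L' the factor k y vanishes. *)
have [M M0 HM] := continuous_bounded_itv (t - 1 - L') (t + 1 + L') (cpsi j.+1).
pose f x y := k y * psi j (x + y).
have cf x : continuous (f x).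
  move=> y; apply: cvgM; first exact: ck.
  apply: (@cvg_comp _ _ _ (fun y => x + y) (psi j)); last exact: cpsi.
  by apply: cvgD; [exact: cvg_cst|exact: cvg_id].
have df x y : is_derive x (1 : R) (f^~ y) (k y * psi j.+1 (x + y)).
  have d1 : is_derive x (1 : R) (fun x => psi j (x + y)) (psi j.+1 (x + y)).
    have d2 : is_derive x (1 : R) (fun x => x + y) 1 by exact: is_derive_shift.
    have := @is_derive1_comp _ (psi j) (fun x => x + y) x _ _ (dpsi j (x + y)) d2.
    by rewrite mulr1.
  exact: (is_deriveZ (k y) d1).
have intf x : `]t - 1, t + 1[%classic x -> leb.-integrable setT (EFin \o f x).
  move=> _; apply: (@continuous_support_integrable _ L) => // y /ks.
  by rewrite /f => ->; rewrite mul0r.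
have intG : leb.-integrable setT (EFin \o (fun y => k y * M)).
  apply: (@continuous_support_integrable _ L) => [y|y /ks ->]; last by rewrite mul0r.
  by apply: cvgM; [exact: ck|exact: cvg_cst].
have G0 y : 0 <= k y * M by rewrite mulr_ge0.
have tI : `]t - 1, t + 1[%classic t by rewrite /= in_itv/=; lra.
have df1 x y : `]t - 1, t + 1[%classic x -> setT y -> derivable (f^~ y) x 1.
  by move=> _ _; case: (df x y).
have Gub x y : `]t - 1, t + 1[%classic x -> setT y ->
    `|partial1of2 f x y| <= k y * M.
  move=> /=; rewrite in_itv/= => /andP[x1 x2] _.
  rewrite partial1of2E derive_val normrM (ger0_norm (k0 y)).
  have [h|h] := ltP L' `|y|; first by rewrite ks'// !mul0r.
  rewrite ler_wpM2l// HM//; move: h; rewrite ler_norml => /andP[h1 h2].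
  by apply/andP; split; lra.
have H1 := derivable_under_integral measurableT tI intf df1 G0 intG Gub.
have H2 := differentiation_under_integral measurableT tI intf df1 G0 intG Gub.
split; first exact: H1.
rewrite -derive1E [LHS]H2; apply: eq_Rintegral => y _.
by rewrite partial1of2E derive_val.
Qed.

End bump.

Section kernel.
Context {R : realType}.
Variable n : nat.
Local Notation V := 'rV[R]_n.
Local Notation mu := (@lebesgue_rV R n).
Local Notation leb := (@lebesgue_measure R).

(** Both functions are products over the coordinates, [h] of bumps and [f] of their
    autocorrelations, so every claim reduces to the line by [ge0_integral_rV_prod]. The integral of
    [f] is the square of that of [h], by Tonelli. *)
Lemma exists_kernel (T : R) : 2 < T -> exists h f : V -> R,
  [/\ measurable_fun setT h, forall x, 0 <= h x,
      (exists B, forall x, h x <= B) & forall x, h x != 0 -> cube T x] /\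
  [/\ sm f, forall x, (\int[mu]_y (h y * h (x + y))%:E = (f x)%:E)%E,
      (\int[mu]_x (f x)%:E = 1)%E, f 0 <= ((T - 2)^-1) ^+ n
    & forall x, f x != 0 -> cube (T + T) x].
Proof.
move=> T2; have [k [sk k0 ks k1 kk]] := exists_bump T2.
have ck : continuous k by exact: sm_continuous.
have mk : measurable_fun (setT : set (measurableTypeR R)) k.
  exact: continuous_measurable_fun.
pose h (x : V) := \prod_i k (x ord0 i).
have mh : measurable_fun setT h.
  apply: measurable_prod => i _.
  exact: (measurableT_comp mk (measurable_coord i)).
have h0 x : 0 <= h x by apply: prodr_ge0.
have ih : (\int[mu]_x (h x)%:E = 1)%E.
  by rewrite (ge0_integral_rV_prod (u := fun=> k))// k1 big1.
have cF t : continuous (fun y => k y * k (t + y)).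
  move=> y; apply: cvgM; first exact: ck.
  apply: (@cvg_comp _ _ _ (fun y => t + y) k); last exact: ck.
  by apply: cvgD; [exact: cvg_cst|exact: cvg_id].
have FE t : (\int[leb]_y (k y * k (t + y))%:E = (autocorr k k t)%:E)%E.
  rewrite fineK//; apply: integrable_fin_num => //.
  by apply: (@continuous_support_integrable _ _ (T / 2)) => // y /ks ->; rewrite mul0r.
have F0 t : 0 <= autocorr k k t.
  by rewrite -lee_fin -FE integral_ge0// => y _; rewrite lee_fin mulr_ge0.
pose f (x : V) := \prod_i autocorr k k (x ord0 i).
have fE x : (\int[mu]_y (h y * h (x + y))%:E = (f x)%:E)%E.
  under eq_integral => y _.
    rewrite /h -big_split/=; under eq_bigr do rewrite mxE.
    over.
  rewrite (ge0_integral_rV_prod (u := fun i t => k t * k (x ord0 i + t)))//.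
  - by under eq_bigr do rewrite FE; rewrite prodEFin.
  - by move=> i; exact: (@continuous_measurable_fun R _ (cF _)).
  - by move=> i t; rewrite mulr_ge0.
exists h, f; split; split => //.
- have [M M0 HM] := continuous_bounded_itv (- (T / 2)) (T / 2) ck.
  exists (M ^+ n) => x; rewrite -[X in M ^+ X]card_ord -prodr_const.
  apply: ler_prod => i _; rewrite k0/=.
  have [hx|hx] := leP (T / 2) `|x ord0 i|; first by rewrite ks.
  by rewrite (le_trans (ler_norm _))// HM// -ler_norml ltW.
- move=> x /prodf_neq0 hx; apply/cube_norm => i.
  by rewrite leNgt; apply/negP => /ltW /ks E; have := hx i isT; rewrite E eqxx.
- apply: sm_prod => i.
  have [phi phi0 dphi] := sm_seq (sm_autocorr sk k0 ks).
  by have := sm_comp 0 dphi (sm_coord i); rewrite phi0.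
- under eq_integral do rewrite -fE.
  have mhh : measurable_fun setT (fun z : V * V => (h z.2 * h (z.1 + z.2))%:E).
    apply/measurable_EFinP; apply: measurable_funM.
      exact: (measurableT_comp mh measurable_snd).
    apply: (measurableT_comp mh); apply: measurable_addV.
      exact: measurable_fst.
    exact: measurable_snd.
  rewrite (fubini_tonelli (fun z : V * V => (h z.2 * h (z.1 + z.2))%:E))//; last first.
    by move=> z; rewrite lee_fin mulr_ge0.
  rewrite -[RHS]ih; apply: eq_integral => y _ /=.
  under eq_integral do rewrite EFinM addrC.
  rewrite ge0_integralZl//; last 3 first.
  + by apply/measurable_EFinP; exact: (measurableT_comp mh (measurable_addl y)).
  + by move=> x _; rewrite lee_fin.
  + by rewrite lee_fin.
  by rewrite (integral_rV_translate y (f := EFin \o h)) ?ih ?mule1//; apply/measurable_EFinP.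
- rewrite /f -[X in _ ^+ X]card_ord -prodr_const; apply: ler_prod => i _.
  rewrite F0/= -lee_fin -FE; under eq_integral do rewrite mxE add0r.
  exact: kk.
- move=> x /prodf_neq0 fx; apply/cube_norm => i.
  rewrite leNgt; apply/negP => hx; have := fx i isT; move/eqP; apply.
  have : ((autocorr k k (x ord0 i))%:E = 0)%E; last by move=> [].
  (* When the i-th coordinate exceeds T in absolute value, y and its translate by this coordinate
     cannot both lie within T/2 of 0. *)
  rewrite -FE; apply: integral0_eq => y _; congr EFin.
  have [hy|hy] := leP (T / 2) `|y|; first by rewrite ks// mul0r.
  rewrite [X in _ * X]ks ?mulr0//.
  have := ler_normB (x ord0 i + y) y; rewrite addrK => hxy; lra.
Qed.

End kernel.

(** * The continuous Motzkin-Straus inequality *)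

Section Rfubini.
Context d1 d2 (T1 : measurableType d1) (T2 : measurableType d2) {R : realType}.
Variables (m1 : {sigma_finite_measure set T1 -> \bar R})
  (m2 : {sigma_finite_measure set T2 -> \bar R}).
Implicit Types F : T1 * T2 -> R.

Lemma Rintegral12 F : (m1 \x m2)%E.-integrable setT (EFin \o F) ->
  \int[m1]_x \int[m2]_y F (x, y) = \int[(m1 \x m2)%E]_z F z.
Proof.
move=> iF; congr fine; rewrite -(integral12_prod_meas1 iF).
have mF := measurable_fubini_F iF.
apply: ae_eq_integral => //.
  by apply/measurable_EFinP; apply: measurableT_comp.
apply: filterS (ae_integrable1 iF) => x /= ix _.
by rewrite fineK//; exact: integrable_fin_num.
Qed.

Lemma Rintegral21 F : (m1 \x m2)%E.-integrable setT (EFin \o F) ->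
  \int[m2]_y \int[m1]_x F (x, y) = \int[(m1 \x m2)%E]_z F z.
Proof.
move=> iF; congr fine; rewrite -(integral21_prod_meas1 iF).
have mF := measurable_fubini_G iF.
apply: ae_eq_integral => //.
  by apply/measurable_EFinP; apply: measurableT_comp.
apply: filterS (ae_integrable2 iF) => x /= ix _.
by rewrite fineK//; exact: integrable_fin_num.
Qed.

Lemma measurable_Rintegral2 F : measurable_fun setT F ->
  measurable_fun setT (fun x => \int[m2]_y F (x, y)).
Proof.
move=> mF; apply: (@measurableT_comp _ _ _ _ _ _ fine) => //.
rewrite (_ : (fun x => _) = (fun x => \int[m2]_y (EFin \o F)^\+ (x, y) -
    \int[m2]_y (EFin \o F)^\- (x, y))%E); last first.
  apply/funext => x; rewrite integralE; congr (_ - _)%E.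
    by apply: eq_integral => y _; rewrite !funeposE.
  by apply: eq_integral => y _; rewrite !funenegE.
have mEF : measurable_fun setT (EFin \o F) by apply/measurable_EFinP.
apply: emeasurable_funB.
  apply: (@measurable_fun_fubini_tonelli_F _ _ _ _ _ m2 ((EFin \o F)^\+)%E).
    exact: measurable_funepos.
  by move=> z; exact: funepos_ge0.
apply: (@measurable_fun_fubini_tonelli_F _ _ _ _ _ m2 ((EFin \o F)^\-)%E).
  exact: measurable_funeneg.
by move=> z; exact: funeneg_ge0.
Qed.

(** Only the product is assumed integrable. Where b x <> 0 almost every section of [a] is
    integrable; where b x = 0 the inner integral may diverge, but its real value is then multiplied
    by 0. *)
Lemma Rintegral12Mr (a : T1 * T2 -> R) (b : T1 -> R) :
  measurable_fun setT a -> measurable_fun setT b ->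
  (m1 \x m2)%E.-integrable setT (EFin \o (fun z => a z * b z.1)) ->
  \int[m1]_x ((\int[m2]_y a (x, y)) * b x) = \int[(m1 \x m2)%E]_z (a z * b z.1).
Proof.
move=> ma mb iab; rewrite -(Rintegral12 iab)/=.
congr fine; apply: ae_eq_integral => //.
- by apply/measurable_EFinP; apply: measurable_funM => //; exact: measurable_Rintegral2.
- apply/measurable_EFinP; apply: (@measurable_Rintegral2 (fun z => a z * b z.1)).
  by apply: measurable_funM => //; exact: (measurableT_comp mb measurable_fst).
apply: filterS (ae_integrable1 iab) => x /= ix _; congr EFin.
have [->|b0] := eqVneq (b x) 0.
  rewrite mulr0 (_ : (fun y => _) = cst 0) ?Rintegral_cst ?mul0r//.
  by apply/funext => y; rewrite mulr0.
rewrite RintegralZr//.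
have -> : EFin \o (fun y => a (x, y)) = (fun y => (b x)^-1%:E * (a (x, y) * b x)%:E)%E.
  by apply/funext => y; rewrite /= -EFinM mulrC mulfK.
exact: integrableZl.
Qed.

Lemma integrable_prod (a : T1 -> R) (b : T2 -> R) :
  m1.-integrable setT (EFin \o a) -> m2.-integrable setT (EFin \o b) ->
  (m1 \x m2)%E.-integrable setT (EFin \o (fun z => a z.1 * b z.2)).
Proof.
move=> ia ib.
have ma : measurable_fun setT a by apply/measurable_EFinP; exact: measurable_int ia.
have mb : measurable_fun setT b by apply/measurable_EFinP; exact: measurable_int ib.
apply/integrable12ltyP.
  apply/measurable_EFinP; apply: measurable_funM.
    exact: (measurableT_comp ma measurable_fst).
  exact: (measurableT_comp mb measurable_snd).
move/integrableP: ia => [_ ia]; move/integrableP: ib => [_ ib].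
rewrite (eq_integral (fun x => `|a x|%:E * \int[m2]_y `|b y|%:E)%E).
  rewrite ge0_integralZr//; last 2 first.
  - by apply/measurable_EFinP; apply: measurableT_comp.
  - exact: integral_ge0.
  apply: lte_mul_pinfty => //; first exact: integral_ge0.
  by rewrite ge0_fin_numE// integral_ge0.
move=> x _; rewrite -ge0_integralZl//.
- by apply: eq_integral => y _ /=; rewrite normrM.
- by apply/measurable_EFinP; apply: measurableT_comp.
Qed.

End Rfubini.

Section greedy.
Context d (T : measurableType d) {R : realType} (mu : {measure set T -> \bar R}).
Variables (N : T -> set T) (phi w : T -> R) (s e : R).
Hypotheses (mN : forall x, measurable (N x)) (mphi : measurable_fun setT phi)
  (mw : measurable_fun setT w) (phi0 : forall x, 0 <= phi x)
  (s0 : 0 < s) (sw : forall x, s <= w x) (e0 : 0 < e)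
  (Nw : forall x, (\int[mu]_(y in N x) (phi y)%:E <= (w x)%:E)%E).

(* Induction on m: remove from A the set N x for a point x nearly minimising w;
   this costs at most 1 + e, and later points lie outside N x. *)
Lemma greedy_bound (m : nat) (A : set T) : measurable A ->
  (forall t : seq T, (forall x, x \in t -> A x) ->
     pairwise (fun x y => `[< ~ N x y >]) t -> (size t <= m)%N) ->
  (\int[mu]_(x in A) (phi x / w x)%:E <= (m%:R * (1 + e))%:E)%E.
Proof.
have w0 x : 0 < w x by exact: lt_le_trans (sw x).
have mq : measurable_fun setT (fun x => (phi x / w x)%:E).
  apply/measurable_EFinP; apply: measurable_funM => //.
  rewrite (_ : (fun x => _) = (@powR R ^~ (-1)) \o w).
    exact: (measurableT_comp (measurable_powR (-1)) mw).
  by apply/funext => x /=; rewrite powR_inv1// ltW.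
have q0 x : (0 <= (phi x / w x)%:E)%E by rewrite lee_fin divr_ge0// ltW.
elim: m A => [|m IH] A mA HA.
  suff -> : A = set0 by rewrite integral_set0 mul0r.
  apply/seteqP; split=> // x Ax.
  have := HA [:: x]; rewrite /= => /(_ _ isT); apply: contraPP => _.
  by move=> H; have : (1 <= 0)%N by apply: H => y; rewrite inE => /eqP ->.
have [->|/set0P[a Aa]] := eqVneq A set0.
  by rewrite integral_set0 lee_fin mulr_ge0// addr_ge0// ltW.
have IA y : A y -> inf (w @` A) <= w y.
  by move=> Ay; apply: ge_inf; [exists s => _ [z _ <-]|exists y].
pose I := inf (w @` A).
have hI : has_inf (w @` A).
  split; first by exists (w a), a.
  by exists s => _ [x _ <-].
have sI : s <= I by apply: lb_le_inf; [exists (w a), a|move=> _ [x _ <-]].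
(* The infimum I need not be attained; the lower bound s makes it positive, which leaves room for
   the relative slack e * I. *)
have [_ [x Ax <-] wx] : exists2 r, (w @` A) r & r < I + e * I.
  by apply: inf_adherent => //; rewrite mulr_gt0// (lt_le_trans s0).
have wxy y : A y -> w x <= (1 + e) * w y.
  move=> Ay; rewrite (le_trans (ltW wx))// mulrDl mul1r lerD ?IA//.
  by rewrite ler_wpM2l ?IA// ltW.
have mAN : measurable (A `&` N x) by exact: measurableI.
have mAD : measurable (A `\` N x) by exact: measurableD.
rewrite -{1}(setUIDK A (N x)) ge0_integral_setU//=; last 2 first.
- exact: measurable_funTS.
- by rewrite disj_set2E; apply/eqP/seteqP; split => // y [[_ ?] [_ ?]].
rewrite mulrSr mulrDl mul1r [(_ + (1 + e))%R]addrC EFinD; apply: leeD.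
  (* On the removed piece 1 / w y <= (1 + e) / w x, while phi has mass at most w x on N x: the cost
     is at most 1 + e. *)
  apply: (@le_trans _ _ (\int[mu]_(y in A `&` N x) (((1 + e) / w x)%:E * (phi y)%:E)))%E.
    apply: ge0_le_integral => //.
    - by apply: measurable_funTS.
    - by apply: measurable_funTS; apply/measurable_EFinP; apply: measurable_funM.
    - move=> y [Ay _]; rewrite -EFinM lee_fin mulrC ler_wpM2r//.
      by rewrite ler_pdivlMr// mulrC ler_pdivrMr// wxy.
  rewrite ge0_integralZl//; last 3 first.
  - by apply: measurable_funTS; apply/measurable_EFinP.
  - by move=> y _; rewrite lee_fin.
  - by rewrite lee_fin divr_ge0// ?addr_ge0 ?ltW.
  apply: (@le_trans _ _ (((1 + e) / w x)%:E * (w x)%:E))%E; last first.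
    by rewrite -EFinM lee_fin divfK// gt_eqF.
  rewrite lee_wpmul2l//; first by rewrite lee_fin divr_ge0// ?addr_ge0 ?ltW.
  apply: le_trans (Nw x); apply: ge0_subset_integral => //.
  - by apply: measurable_funTS; apply/measurable_EFinP.
  - by move=> y _; rewrite lee_fin.
apply: IH => // t At pt.
have := HA (x :: t) => /=; rewrite ltnS; apply.
  move=> y; rewrite inE => /orP[/eqP -> //|/At []//].
rewrite pt andbT; apply/allP => y /At [_ Ny]; exact/asboolP.
Qed.

End greedy.

Lemma integrable_mulr_bounded d (T : measurableType d) (R : realType)
    (mu : {measure set T -> \bar R}) (f g : T -> R) (M : R) :
  mu.-integrable setT (EFin \o f) -> measurable_fun setT g ->
  (forall x, `|g x| <= M) -> mu.-integrable setT (EFin \o (fun x => f x * g x)).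
Proof.
move=> intf mg gM.
have mf : measurable_fun setT f by apply/measurable_EFinP; exact: measurable_int intf.
apply: (le_integrable measurableT _ _ (integrableZl measurableT M intf)).
  by apply/measurable_EFinP; apply: measurable_funM.
move=> x _ /=; rewrite lee_fin !normrM mulrC ler_wpM2r//.
by rewrite (le_trans (gM x))// ler_norm.
Qed.

Section integrable_EFin.
Context d (T : measurableType d) (R : realType) (mu : {measure set T -> \bar R}).
Implicit Types f g : T -> R.

Lemma integrable_addr f g : mu.-integrable setT (EFin \o f) ->
  mu.-integrable setT (EFin \o g) -> mu.-integrable setT (EFin \o (fun x => f x + g x)).
Proof. by move=> intf intg; exact: (integrableD measurableT intf intg). Qed.

Lemma integrable_subr f g : mu.-integrable setT (EFin \o f) ->
  mu.-integrable setT (EFin \o g) -> mu.-integrable setT (EFin \o (fun x => f x - g x)).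
Proof. by move=> intf intg; exact: (integrableB measurableT intf intg). Qed.

Lemma integrable_scaler f (k : R) : mu.-integrable setT (EFin \o f) ->
  mu.-integrable setT (EFin \o (fun x => k * f x)).
Proof. by move=> intf; exact: (integrableZl measurableT k intf). Qed.

End integrable_EFin.

(** A discriminant argument: once e and s are sent to 0, the quadratic l^2 m - 2 a l + Q is
    nonnegative for every l > 0. Take l = a / m, or l large when m = 0. *)
Lemma quadratic_bound (R : realType) (a Q m : R) : 0 <= a -> 0 <= Q -> 0 <= m ->
  (forall l e s : R, 0 < l -> 0 < e -> 0 < s ->
     2 * a * l <= l ^+ 2 * (m * (1 + e)) + Q + s * a) -> a ^+ 2 <= m * Q.
Proof.
move=> a0 Q0 m0 H.
have H' l : 0 < l -> 2 * a * l <= l ^+ 2 * m + Q.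
  move=> l0; apply/ler_addgt0Pr => e e0.
  pose D := l ^+ 2 * m + a + 1.
  have D0 : 0 < D by rewrite /D ltr_wpDl// addr_ge0// mulr_ge0// exprn_ge0// ltW.
  have := H l (e / D) (e / D) l0 (divr_gt0 e0 D0) (divr_gt0 e0 D0).
  move=> /le_trans; apply.
  have : e / D * (l ^+ 2 * m + a) <= e.
    by rewrite mulrAC ler_pdivrMr// ler_wpM2l ?(ltW e0)// /D lerDl.
  lra.
have [->|a1] := eqVneq a 0; first by rewrite expr0n/= mulr_ge0.
have {}a0 : 0 < a by rewrite lt0r a1.
have [mE|m1] := eqVneq m 0.
  have := H' ((Q + 1) / (2 * a)).
  rewrite divr_gt0 ?mulr_gt0 ?ltr_wpDl// => /(_ isT).
  rewrite mE mulr0 add0r mulrC divfK; last by rewrite gt_eqF// mulr_gt0.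
  lra.
have {}m0 : 0 < m by rewrite lt0r m1.
have := H' (a / m) (divr_gt0 a0 m0).
have -> : 2 * a * (a / m) = 2 * (a ^+ 2 / m) by field.
have -> : (a / m) ^+ 2 * m = a ^+ 2 / m by field.
move=> h; have : a ^+ 2 / m <= Q by lra.
by rewrite ler_pdivrMr// mulrC.
Qed.

Section motzkin_straus.
Context disp (T : measurableType disp) {R : realType}.
Variable mu : {sigma_finite_measure set T -> \bar R}.

(* With d(x) the integral of phi(y) K(x, y), greedy_bound for the weight d + s
   gives (int phi / (d + s)) <= m (1 + e); conclude by Cauchy-Schwarz, as the
   double integral is (int phi d). *)
Lemma motzkin_straus (N : T -> set T) (K : T * T -> R) (phi : T -> R) (A : set T) (m : nat) :
  (forall x, measurable (N x)) -> measurable_fun setT K ->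
  (forall z, 0 <= K z <= 1) -> (forall x y, N x y -> K (x, y) = 1) ->
  mu.-integrable setT (EFin \o phi) -> (forall x, 0 <= phi x) ->
  measurable A -> (forall x, ~ A x -> phi x = 0) ->
  (forall t : seq T, (forall x, x \in t -> A x) ->
     pairwise (fun x y => `[< ~ N x y >]) t -> (size t <= m)%N) ->
  (\int[mu]_x phi x) ^+ 2 <=
  m%:R * \int[(mu \x mu)%E]_z (phi z.1 * phi z.2 * K z).
Proof.
move=> mN mK K01 KN iphi phi0 mA Aphi Am.
have mphi : measurable_fun setT phi by apply/measurable_EFinP; exact: measurable_int iphi.
have K1 z : `|K z| <= 1 by have /andP[? ?] := K01 z; rewrite ger0_norm.
have iQ : (mu \x mu)%E.-integrable setT (EFin \o (fun z => phi z.1 * phi z.2 * K z)).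
  exact: (integrable_mulr_bounded (integrable_prod iphi iphi) mK K1).
pose d x := \int[mu]_y (phi y * K (x, y)).
have iKphi x : mu.-integrable setT (EFin \o (fun y => phi y * K (x, y))).
  apply: (integrable_mulr_bounded iphi (M := 1)) => //.
  exact: (measurable_fun_pair2 x mK).
have mKphi : measurable_fun setT (fun z : T * T => phi z.2 * K z).
  by apply: measurable_funM => //; exact: (measurableT_comp mphi measurable_snd).
have md : measurable_fun setT d.
  exact: (measurable_Rintegral2 mu mKphi).
have K0 z : 0 <= K z by case/andP : (K01 z).
have d0 x : 0 <= d x by apply: Rintegral_ge0 => y _; rewrite mulr_ge0.
pose Q := \int[(mu \x mu)%E]_z (phi z.1 * phi z.2 * K z).
have iQ' : (mu \x mu)%E.-integrable setT (EFin \o (fun z => (phi z.2 * K z) * phi z.1)).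
  by apply: eq_integrable iQ => // z _ /=; congr EFin; ring.
have QE : Q = \int[mu]_x (d x * phi x).
  rewrite (Rintegral12Mr mKphi mphi iQ'); apply: eq_Rintegral => z _; ring.
have dE x : (d x)%:E = (\int[mu]_y (phi y * K (x, y))%:E)%E.
  by rewrite fineK//; apply: integrable_fin_num => //; exact: iKphi.
have idphi : mu.-integrable setT (EFin \o (fun x => d x * phi x)).
  have mdphi : measurable_fun setT (fun x => d x * phi x) by exact: measurable_funM.
  have := integrable_fubini_F iQ'; apply: le_integrable => //.
    by apply/measurable_EFinP.
  move=> x _ /=; rewrite /fubini_F /=.
  under eq_integral do rewrite EFinM.
  rewrite ge0_integralZr//; last 3 first.
  - by apply/measurable_EFinP; exact: (measurable_fun_pair2 x mKphi).
  - by move=> y _; rewrite lee_fin mulr_ge0.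
  - by rewrite lee_fin.
  by rewrite -dE -EFinM.
apply: quadratic_bound => //.
- exact: Rintegral_ge0.
- by apply: Rintegral_ge0 => z _; rewrite !mulr_ge0.
move=> l e s l0 e0 s0.
(* The integral d may vanish; adding s keeps 1 / w bounded, and [quadratic_bound] removes s
   again. *)
pose w x := d x + s.
have mw : measurable_fun setT w by exact: measurable_funD.
have w0 x : 0 < w x by rewrite ltr_wpDl.
have sw x : s <= w x by rewrite lerDr.
have Nw x : (\int[mu]_(y in N x) (phi y)%:E <= (w x)%:E)%E.
  rewrite /w EFinD dE; apply: (@le_trans _ _ (\int[mu]_y (phi y * K (x, y))%:E)%E); last first.
    by rewrite leeDl// lee_fin ltW.
  apply: (@le_trans _ _ (\int[mu]_(y in N x) (phi y * K (x, y))%:E)%E).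
    rewrite le_eqVlt; apply/orP; left; apply/eqP; apply: eq_integral => y /set_mem Ny.
    by rewrite KN// mulr1.
  apply: ge0_subset_integral => //.
  - by apply: measurable_int (iKphi x).
  - by move=> y _; rewrite lee_fin mulr_ge0.
have := greedy_bound mN mphi mw phi0 s0 sw e0 Nw mA Am.
rewrite integral_mkcond.
have -> : ((fun x => (phi x / w x)%:E) \_ A = (fun x => (phi x / w x)%:E))%E.
  apply/funext => x; rewrite patchE; case: ifPn => //.
  by rewrite notin_setE => /Aphi ->; rewrite mul0r.
move=> G.
have mq : measurable_fun setT (fun x => (w x)^-1).
  rewrite (_ : (fun x => _) = (@powR R ^~ (-1)) \o w).
    exact: (measurableT_comp (measurable_powR (-1)) mw).
  by apply/funext => x /=; rewrite powR_inv1// ltW.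
have iq : mu.-integrable setT (EFin \o (fun x => phi x / w x)).
  apply: (integrable_mulr_bounded iphi (M := s^-1)) => // x.
  by rewrite ger0_norm ?invr_ge0 ?(ltW (w0 x))// lef_pV2 ?posrE.
have {}G : \int[mu]_x (phi x / w x) <= m%:R * (1 + e).
  by rewrite -lee_fin fineK//; exact: integrable_fin_num.
have iw : mu.-integrable setT (EFin \o (fun x => d x * phi x + s * phi x)).
  by apply: integrable_addr => //; exact: integrable_scaler.
have E1 : \int[mu]_x (d x * phi x + s * phi x) = Q + s * \int[mu]_x phi x.
  rewrite RintegralD//; last exact: integrable_scaler.
  by rewrite RintegralZl// -QE.
(* Cauchy-Schwarz in additive form: 2 l <= l^2 / w + w pointwise, integrated against phi. *)
have E2 : 2 * l * \int[mu]_x phi x <=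
    \int[mu]_x (l ^+ 2 * (phi x / w x) + (d x * phi x + s * phi x)).
  rewrite -RintegralZl//; apply: le_Rintegral => //.
  - exact: integrable_scaler.
  - by apply: integrable_addr => //; exact: integrable_scaler.
  move=> x _; have -> : d x * phi x + s * phi x = phi x * w x by rewrite /w; ring.
  have := sqr_ge0 (l - w x); have := w0 x; have := phi0 x.
  set p := phi x; set v := w x => p0 v0 h.
  have -> : l ^+ 2 * (p / v) + p * v = p * ((l ^+ 2 + v ^+ 2) / v) by field; rewrite gt_eqF.
  rewrite [leLHS]mulrC ler_wpM2l// ler_pdivlMr//; nra.
rewrite RintegralD// in E2; last exact: integrable_scaler.
rewrite RintegralZl// E1 in E2.
have : l ^+ 2 * \int[mu]_x (phi x / w x) <= l ^+ 2 * (m%:R * (1 + e)).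
  by rewrite ler_wpM2l// exprn_ge0// ltW.
rewrite -/Q; lra.
Qed.

End motzkin_straus.

(** * The upper bound theta <= Delta *)

Section Lfun_facts.
Context d (T : measurableType d) {R : realType} (mu : {measure set T -> \bar R}).

Lemma Lfun1P (f : T -> R) :
  f \in Lfun mu 1%E <-> mu.-integrable setT (EFin \o f).
Proof.
split.
  move=> /andP[mf]; rewrite !inE in mf * => /=; rewrite /finite_norm Lnorm1 => foo.
  by apply/integrableP; split => //; apply/measurable_EFinP.
move=> intf; have /integrableP[mf foo] := intf.
apply/andP; split; rewrite inE/=; first exact/measurable_EFinP.
by rewrite /finite_norm Lnorm1.
Qed.

Lemma Lfun2P (f : T -> R) :
  f \in Lfun mu 2%:R%:E <-> measurable_fun setT f /\
    mu.-integrable setT (EFin \o (fun x => f x ^+ 2)).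
Proof.
have E : (forall x, (`|(f x)%:E| `^ 2%:R)%E = `|(f x ^+ 2)%:E|)%E.
  by move=> x; rewrite /= powR_mulrn// normrX.
have N2 : ('N[mu]_(2%:R%:E)[EFin \o f] `^ 2%:R = \int[mu]_x `|(f x ^+ 2)%:E|)%E.
  by rewrite poweR_Lnorm//; apply: eq_integral => x _; exact: E.
split.
  move=> /andP[mf]; rewrite !inE in mf * => /=; rewrite /finite_norm => foo.
  split=> //; apply/integrableP; split.
    by apply/measurable_EFinP; apply: measurable_funX.
  by rewrite -N2 poweR_lty.
move=> [mf /integrableP[_ foo]].
apply/andP; split; rewrite inE//=.
rewrite /finite_norm ltey; apply/eqP => h; move: foo; rewrite -N2 h.
by rewrite poweRyr ?ltxx// pnatr_eq0.
Qed.

Lemma Lfuny_bounded (f : T -> R) (M : R) :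
  measurable_fun setT f -> (forall x, `|f x| <= M) -> f \in Lfun mu +oo%E.
Proof.
move=> mf fM; apply/andP; split; rewrite inE//= /finite_norm unlock /Lnorm.
case: ifPn => // _; apply: (@le_lt_trans _ _ M%:E); last exact: ltry.
by apply/ess_supP/nearW => x /=; rewrite lee_fin.
Qed.

End Lfun_facts.

Section exchange.
Context d1 d2 (T1 : measurableType d1) (T2 : measurableType d2) {R : realType}.
Variables (m1 : {sigma_finite_measure set T1 -> \bar R})
  (m2 : {sigma_finite_measure set T2 -> \bar R}).

Lemma Rintegral_exchange (F : T1 * T2 -> R) (g k : T1 -> R) :
  measurable_fun setT F -> m1.-integrable setT (EFin \o g) ->
  (forall w, (\int[m2]_z `|F (w, z)|%:E <= (g w)%:E)%E) ->
  (forall w, \int[m2]_z F (w, z) = k w) ->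
  \int[m1]_w k w = \int[m2]_z \int[m1]_w F (w, z).
Proof.
move=> mF ig Fg Fk.
have mEF : measurable_fun setT (EFin \o F) by apply/measurable_EFinP.
have iF : (m1 \x m2)%E.-integrable setT (EFin \o F).
  apply/(integrable12ltyP m1 m2 mEF); have /integrableP[mg] := ig; apply: le_lt_trans.
  apply: ge0_le_integral => //.
  - by move=> w _; apply: integral_ge0.
  - apply: (@measurable_fun_fubini_tonelli_F _ _ _ _ _ m2 (abse \o (EFin \o F)))%E.
      exact: measurableT_comp.
    by move=> z /=.
  - exact: measurableT_comp.
  - by move=> w _ /=; apply: le_trans (Fg w) _; rewrite lee_fin ler_norm.
rewrite (Rintegral21 iF) -(Rintegral12 iF); apply: eq_Rintegral => w _.
by rewrite Fk.
Qed.

End exchange.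

Section window.
Context d (T : measurableType d) {R : realType}.
Variable mu : {sigma_finite_measure set T -> \bar R}.
Variables (H S C : T * T -> R) (phi : T -> R) (M : R).
Hypotheses (mH : measurable_fun setT H) (H0 : forall x, 0 <= H x)
  (HS : forall x y, (\int[mu]_z (H (x, z) * H (y, z))%:E = (S (x, y))%:E)%E)
  (mC : measurable_fun setT C) (CM : forall x, `|C x| <= M)
  (mphi : measurable_fun setT phi)
  (ik : (mu \x mu)%E.-integrable setT (EFin \o (fun w => phi w.1 * phi w.2 * S w))).

(** By [HS] the kernel S is a Gram kernel, and the identity is Fubini. As H is nonnegative,
    integrating the absolute value over z gives |phi phi C S|, which [ik] and the bound on C make
    integrable. *)
Lemma Rintegral_window :
  \int[(mu \x mu)%E]_w (phi w.1 * phi w.2 * (C w * S w)) =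
  \int[mu]_z \int[(mu \x mu)%E]_w
    ((phi w.1 * H (w.1, z)) * (phi w.2 * H (w.2, z)) * C w).
Proof.
pose G (p : T * T * T) : R :=
  (phi p.1.1 * H (p.1.1, p.2)) * (phi p.1.2 * H (p.1.2, p.2)) * C p.1.
have S0 w : 0 <= S w.
  case: w => x y; rewrite -lee_fin -HS; apply: integral_ge0 => z _.
  by rewrite lee_fin mulr_ge0.
have m11 : measurable_fun setT (fun p : T * T * T => p.1.1).
  exact: (measurableT_comp measurable_fst measurable_fst).
have m12 : measurable_fun setT (fun p : T * T * T => p.1.2).
  exact: (measurableT_comp measurable_snd measurable_fst).
have mG : measurable_fun setT G.
  apply: measurable_funM; last exact: (measurableT_comp mC measurable_fst).
  apply: measurable_funM; apply: measurable_funM.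
  - exact: (measurableT_comp mphi m11).
  - exact: (measurableT_comp mH (measurable_fun_pair m11 measurable_snd)).
  - exact: (measurableT_comp mphi m12).
  - exact: (measurableT_comp mH (measurable_fun_pair m12 measurable_snd)).
have mHH x y : measurable_fun setT (fun z => H (x, z) * H (y, z)).
  by apply: measurable_funM; exact: (measurable_fun_pair2 _ mH).
have iHH x y : mu.-integrable setT (EFin \o (fun z => H (x, z) * H (y, z))).
  apply/integrableP; split; first by apply/measurable_EFinP.
  under eq_integral do rewrite /= ger0_norm ?mulr_ge0//.
  by rewrite HS ltry.
have ik' : (mu \x mu)%E.-integrable setT
    (EFin \o (fun w => phi w.1 * phi w.2 * (C w * S w))).
  have := integrable_mulr_bounded ik mC CM.
  by apply: eq_integrable => // w _ /=; congr EFin; ring.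
pose m2 : {measure set (T * T)%type -> \bar R} := (mu \x mu)%E.
pose nu : {sigma_finite_measure set (T * T)%type -> \bar R} :=
  HB.pack (mu \x mu)%E (Measure.class m2)
    (Measure_isSigmaFinite.Build _ _ _ m2 (sigma_finiteX mu mu)).
apply: (@Rintegral_exchange _ _ _ _ _ nu mu _ _ _ mG (integrable_norm ik')) => -[x y] /=.
  rewrite (eq_integral (fun z => `|phi x * phi y * C (x, y)|%:E *
      (H (x, z) * H (y, z))%:E)%E); last first.
    move=> z _; rewrite -EFinM /G/=; congr EFin.
    rewrite !normrM (ger0_norm (H0 (x, z))) (ger0_norm (H0 (y, z))); ring.
  rewrite ge0_integralZl//; last 2 first.
  - by apply/measurable_EFinP.
  - by move=> z _; rewrite lee_fin mulr_ge0.
  by rewrite HS -EFinM -[X in _ * X]ger0_norm// -normrM mulrA.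
rewrite mulrA -[X in _ = _ * X]/(fine (S (x, y))%:E) -HS -RintegralZl//.
by apply: eq_Rintegral => z _; rewrite /G/=; ring.
Qed.

End window.

(** * Quadratic forms of convolution kernels *)

Section pairings.
Context {R : realType}.
Variable n : nat.
Local Notation V := 'rV[R]_n.
Local Notation mu := (@lebesgue_rV R n).
Local Notation mu2 := (mu \x mu)%E.
Implicit Types (F f h c phi psi : V -> R).

(** Common form of both tests: [inner_convolution] identifies its integral with the pairing in
    [COP_inv], [integral_star] with the one in [pos_type]. *)
Definition kint (phi F : V -> R) (z : V * V) : R := phi z.1 * phi z.2 * F (z.1 - z.2).

Lemma measurable_subV : measurable_fun setT (fun z : V * V => z.1 - z.2).
Proof.
apply: measurable_addV; first exact: measurable_fst.
have := measurableT_comp (@measurable_oppV R n) (@measurable_snd _ _ V V).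
exact.
Qed.

Lemma measurable_kint phi F : measurable_fun setT phi -> measurable_fun setT F ->
  measurable_fun setT (kint phi F).
Proof.
move=> mphi mF; apply: measurable_funM.
  apply: measurable_funM; first exact: (measurableT_comp mphi measurable_fst).
  exact: (measurableT_comp mphi measurable_snd).
exact: (measurableT_comp mF measurable_subV).
Qed.

Lemma integrable_kint phi F M : mu.-integrable setT (EFin \o phi) ->
  measurable_fun setT F -> (forall x, `|F x| <= M) ->
  mu2.-integrable setT (EFin \o kint phi F).
Proof.
move=> iphi mF FM.
apply: (integrable_mulr_bounded (M := M) (integrable_prod iphi iphi)) => //.
exact: (measurableT_comp mF measurable_subV).
Qed.

(** Integrability is asked of the form and not of phi, so that phi may be merely in L^2. *)
Lemma inner_convolution phi F : measurable_fun setT phi -> measurable_fun setT F ->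
  mu2.-integrable setT (EFin \o kint phi F) ->
  inner (convolution phi F) phi = \int[mu2]_z kint phi F z.
Proof.
move=> mphi mF ik; rewrite /inner /convolution.
have ma : measurable_fun setT (fun z : V * V => phi z.2 * F (z.1 - z.2)).
  apply: measurable_funM; first exact: (measurableT_comp mphi measurable_snd).
  exact: (measurableT_comp mF measurable_subV).
rewrite (Rintegral12Mr (m2 := mu) ma mphi).
  by apply: eq_Rintegral => z _; rewrite /kint; ring.
by apply: eq_integrable ik => // z _; rewrite /kint/=; congr EFin; ring.
Qed.

(** The shear (x, y) -> (y + x, y) carries one integrand to the other. It is applied section by
    section, as a translation in x for fixed y, once for integrability and once for the value. *)
Lemma integral_star phi F M : mu.-integrable setT (EFin \o phi) ->
  measurable_fun setT F -> (forall x, `|F x| <= M) ->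
  \int[mu]_x (star phi phi x * F x) = \int[mu2]_z kint phi F z.
Proof.
move=> iphi mF FM.
have ik := integrable_kint iphi mF FM.
have mphi : measurable_fun setT phi by apply/measurable_EFinP; exact: measurable_int iphi.
have mk := measurable_kint mphi mF.
have madd : measurable_fun setT (fun z : V * V => z.1 + z.2).
  by apply: measurable_addV; [exact: measurable_fst|exact: measurable_snd].
pose a (z : V * V) := phi z.2 * phi (z.1 + z.2).
have ma : measurable_fun setT a.
  apply: measurable_funM; first exact: (measurableT_comp mphi measurable_snd).
  exact: (measurableT_comp mphi madd).
have maF : measurable_fun setT (fun z => a z * F z.1).
  by apply: measurable_funM => //; exact: (measurableT_comp mF measurable_fst).
have aE x y : a (x, y) * F x = kint phi F (y + x, y).
  by rewrite /a /kint/= [y + x]addrC addrK; ring.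
have iaF : mu2.-integrable setT (EFin \o (fun z => a z * F z.1)).
  apply/integrable21ltyP; first by apply/measurable_EFinP.
  have /integrable21ltyP := ik; move=> /(_ _)/wrap[]; first by apply/measurable_EFinP.
  apply: le_lt_trans; rewrite le_eqVlt; apply/orP; left; apply/eqP.
  apply: eq_integral => y _.
  rewrite -(integral_rV_translate y (f := fun x => `|(kint phi F (x, y))%:E|%E)).
    by apply: eq_integral => x _; rewrite /= aE.
  apply: measurableT_comp => //; apply/measurable_EFinP.
  exact: (measurable_fun_pair1 y mk).
rewrite -(Rintegral21 ik) /star.
rewrite (Rintegral12Mr (m2 := mu) ma mF iaF) -(Rintegral21 iaF).
apply: eq_Rintegral => y _; congr fine.
rewrite -(integral_rV_translate y (f := fun x => (kint phi F (x, y))%:E)).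
  by apply: eq_integral => x _; rewrite /= -aE.
by apply/measurable_EFinP; exact: (measurable_fun_pair1 y mk).
Qed.

Section autocorrelation.
Variables (h f c phi : V -> R) (B M : R).
Hypotheses (mh : measurable_fun setT h) (h0 : forall x, 0 <= h x)
  (hB : forall x, h x <= B) (mf : measurable_fun setT f)
  (fE : forall x, (\int[mu]_y (h y * h (x + y))%:E = (f x)%:E)%E)
  (mc : measurable_fun setT c) (cM : forall x, `|c x| <= M)
  (mphi : measurable_fun setT phi)
  (ik : mu2.-integrable setT (EFin \o kint phi f)).

Let f0 x : 0 <= f x.
Proof.
by rewrite -lee_fin -fE; apply: integral_ge0 => y _; rewrite lee_fin mulr_ge0.
Qed.

Definition window (z x : V) : R := phi x * h (x + z).

Let mcsub : measurable_fun setT (fun w : V * V => c (w.1 - w.2)).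
Proof. exact: (measurableT_comp mc measurable_subV). Qed.

Lemma kint_window :
  \int[mu2]_w kint phi (fun x => c x * f x) w =
  \int[mu]_z \int[mu2]_w kint (window z) c w.
Proof.
pose H (w : V * V) := h (w.1 + w.2).
have mH : measurable_fun setT H.
  apply: (measurableT_comp mh); apply: measurable_addV; first exact: measurable_fst.
  exact: measurable_snd.
have HS x y : (\int[mu]_z (H (x, z) * H (y, z))%:E = (f (x - y))%:E)%E.
  rewrite -fE -(integral_rV_translate y (f := fun t => (h t * h (x - y + t))%:E)).
    by apply: eq_integral => t _; rewrite addrA subrK mulrC.
  apply/measurable_EFinP; apply: measurable_funM => //.
  exact: (measurableT_comp mh (measurable_addl _)).
have H0 w : 0 <= H w by exact: h0.
have := @Rintegral_window _ _ _ mu H (fun w => f (w.1 - w.2)) (fun w => c (w.1 - w.2))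
  phi M mH H0 HS mcsub (fun w => cM _) mphi ik.
exact.
Qed.

(** Used twice: c = 1 yields positive type of [f], c = m eta - 1 yields copositivity of c f. *)
Lemma kint_window_ge0 : (forall z, 0 <= \int[mu2]_w kint (window z) c w) ->
  0 <= \int[mu2]_w kint phi (fun x => c x * f x) w.
Proof. by move=> H; rewrite kint_window Rintegral_ge0. Qed.

End autocorrelation.

End pairings.

(** If N is the exceptional set, N x T and T x N are null even for infinite mu, since 0 times +oo is
    0. *)
Lemma ae_both d (T : measurableType d) (R : realType) (U : Type)
    (mu : {sigma_finite_measure set T -> \bar R}) (phi psi : T -> U) :
  {ae mu, forall x, phi x = psi x} ->
  {ae (mu \x mu)%E, forall z, phi z.1 = psi z.1 /\ phi z.2 = psi z.2}.
Proof.
move=> [N [mN N0 HN]].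
have m1 : measurable (N `*` [set: T]) by exact: measurableX.
have m2 : measurable ([set: T] `*` N) by exact: measurableX.
exists ((N `*` setT) `|` (setT `*` N)); split.
- exact: measurableU.
- apply/eqP; rewrite eq_le measure_ge0 andbT.
  have := @measureU2 _ _ _ (mu \x mu)%E _ _ m1 m2.
  have e1 : (mu \x mu)%E (N `*` [set: T]) = 0%E.
    by rewrite -(mul0e (mu setT)) -N0; exact: product_measure1E.
  have e2 : (mu \x mu)%E ([set: T] `*` N) = 0%E.
    by rewrite -(mule0 (mu setT)) -N0; exact: product_measure1E.
  by rewrite /= e1 e2 adde0.
- move=> z /= Hz; apply: contrapT => /not_orP[h1 h2]; apply: Hz; split.
    by apply: contrapT => /HN h; apply: h1; split.
  by apply: contrapT => /HN h; apply: h2; split.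
Qed.

(** * The feasible pair built from the autocorrelation *)

Section dual.
Context {R : realType}.
Variable n : nat.
Local Notation V := 'rV[R]_n.
Local Notation mu := (@lebesgue_rV R n).
Local Notation mu2 := (mu \x mu)%E.

Lemma lebesgue_rV_cube_lty (L : R) : (mu (cube L) < +oo)%E.
Proof.
apply: (@le_lt_trans _ _ (mu (cube `|L|))); last by rewrite lebesgue_rV_cube// ltry.
apply: le_measure; rewrite ?inE; [exact: measurable_cube..|].
by apply: cubeS; exact: ler_norm.
Qed.

Lemma sm_dot : sm (fun x : V => dot x x).
Proof. by apply: sm_sum => i; apply: sm_mul; exact: sm_coord. Qed.

Lemma Cc_infty_cube (f : V -> R) (L : R) : smooth f ->
  (forall x, f x != 0 -> cube L x) -> Cc_infty R n f.
Proof.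
move=> sf fL; split=> //.
apply: (@subclosed_compact _ _ (cube L)); first exact: closed_closure.
  exact: cube_compact.
rewrite [X in _ `<=` X](closure_id _).1.
  by apply: closureS => x /fL.
apply: compact_closed; last exact: cube_compact.
exact: norm_hausdorff.
Qed.

Lemma continuous_cube_bounded (f : V -> R) (L : R) : continuous f ->
  (forall x, f x != 0 -> cube L x) -> exists M, forall x, `|f x| <= M.
Proof.
move=> cf fL.
have [|M [_ HM]] := @compact_bounded R R (f @` cube L).
  apply: continuous_compact; last exact: cube_compact.
  exact: continuous_subspaceT.
exists (`|M| + 1) => x.
have [->|fx] := eqVneq (f x) 0; first by rewrite normr0 addr_ge0.
apply: (HM (`|M| + 1)); first by rewrite (le_lt_trans (ler_norm _))// ltrDl.
by exists x => //; exact: fL.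
Qed.

Lemma continuous_cube_integrable (f : V -> R) (L : R) : continuous f ->
  (forall x, f x != 0 -> cube L x) -> mu.-integrable setT (EFin \o f).
Proof.
move=> cf fL; have [M HM] := continuous_cube_bounded cf fL.
apply: (@integrable_bounded_support _ _ _ mu (cube `|L|) _ M) => //.
- exact: measurable_cube.
- exact: lebesgue_rV_cube_lty.
- exact: continuous_measurable_rV.
- move=> x xL; apply/eqP; apply: contra_notT xL => /fL; apply: cubeS; exact: ler_norm.
Qed.

Lemma kint_ae (phi psi F : V -> R) : measurable_fun setT phi ->
  measurable_fun setT psi -> measurable_fun setT F ->
  {ae mu, forall x, phi x = psi x} ->
  {ae mu2, forall z, kint phi F z = kint psi F z}.
Proof.
move=> mphi mpsi mF /ae_both; apply: filterS => z [h1 h2].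
by rewrite /kint h1 h2.
Qed.

Section kernel_functions.
Variables (h f : V -> R) (B T : R).
Hypotheses (mh : measurable_fun setT h) (h0 : forall x, 0 <= h x)
  (hB : forall x, h x <= B) (hT : forall x, h x != 0 -> cube T x)
  (sf : sm f) (fE : forall x, (\int[mu]_y (h y * h (x + y))%:E = (f x)%:E)%E)
  (f1 : (\int[mu]_x (f x)%:E = 1)%E) (fT : forall x, f x != 0 -> cube (T + T) x).

Let cf : continuous f. Proof. exact: sm_continuous. Qed.
Let mf : measurable_fun setT f. Proof. exact: continuous_measurable_rV. Qed.
Let f0 x : 0 <= f x.
Proof.
by rewrite -lee_fin -fE; apply: integral_ge0 => y _; rewrite lee_fin mulr_ge0.
Qed.

Let hnorm x : `|h x| <= B. Proof. by rewrite ger0_norm. Qed.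
Let mhz z : measurable_fun setT (fun x : V => h (x + z)).
Proof.
rewrite (_ : (fun x => _) = h \o (fun x => z + x)).
  exact: (measurableT_comp mh (measurable_addl z)).
by apply/funext => x /=; rewrite addrC.
Qed.

(** For c = 1 each window contributes the square of the integral of g h(. + z). *)
Lemma pos_type_kernel : pos_type R n f.
Proof.
have [M HM] := continuous_cube_bounded cf fT.
split=> //; first exact: Lfuny_bounded HM.
move=> g /Lfun1P ig.
have mg : measurable_fun setT g by apply/measurable_EFinP; exact: measurable_int ig.
rewrite (integral_star ig mf HM).
have ik := integrable_kint ig mf HM.
have mc : measurable_fun setT (fun _ : V => 1 : R) by exact: measurable_cst.
have := kint_window_ge0 mh h0 fE mc (M := 1) (fun _ => _) mg ik.
rewrite (_ : (fun x => 1 * f x) = f); last by apply/funext => x; rewrite mul1r.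
apply => [|z]; first by rewrite normr1.
have iw : mu.-integrable setT (EFin \o window h g z).
  by apply: (integrable_mulr_bounded ig (M := B)) => // x.
have -> : \int[mu2]_w kint (window h g z) (fun=> 1) w = (\int[mu]_x window h g z x) ^+ 2.
  transitivity (\int[mu2]_w (window h g z w.1 * window h g z w.2)).
    by apply: eq_Rintegral => w _; rewrite /kint mulr1.
  rewrite -(Rintegral12 (integrable_prod iw iw))/= expr2 -RintegralZr//.
  by apply: eq_Rintegral => x _; rewrite -RintegralZl.
exact: sqr_ge0.
Qed.

(** Young's inequality in disguise: |phi(x) phi(y)| <= phi(x)^2 + phi(y)^2, and f(x - y) has
    integral 1 in either variable. A phi in L^2 need not be integrable, so [integrable_kint] does
    not apply. *)
Lemma integrable_kint_L2 (phi : V -> R) : measurable_fun setT phi ->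
  mu.-integrable setT (EFin \o (fun x => phi x ^+ 2)) ->
  mu2.-integrable setT (EFin \o kint phi f).
Proof.
move=> mphi iphi.
have mp1 : measurable_fun setT (fun z : V * V => phi z.1 ^+ 2 * f (z.1 - z.2)).
  apply: measurable_funM; last exact: (measurableT_comp mf (@measurable_subV R n)).
  apply: measurable_funX; exact: (measurableT_comp mphi measurable_fst).
have mp2 : measurable_fun setT (fun z : V * V => phi z.2 ^+ 2 * f (z.1 - z.2)).
  apply: measurable_funM; last exact: (measurableT_comp mf (@measurable_subV R n)).
  apply: measurable_funX; exact: (measurableT_comp mphi measurable_snd).
have mEf : measurable_fun setT (EFin \o f) by apply/measurable_EFinP.
have mfa (x : V) : measurable_fun setT (fun y : V => (f (x + y))%:E).
  exact: (measurableT_comp mEf (measurable_addl x)).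
have F1 (x : V) : (\int[mu]_y (f (x - y))%:E = 1)%E.
  rewrite (integral_rV_opp (f := fun y => (f (x + y))%:E))//.
  by rewrite (integral_rV_translate x (f := EFin \o f)).
have F2 (y : V) : (\int[mu]_x (f (x - y))%:E = 1)%E.
  under eq_integral do rewrite addrC.
  by rewrite (integral_rV_translate (- y) (f := EFin \o f)).
have i1 : mu2.-integrable setT (EFin \o (fun z : V * V => phi z.1 ^+ 2 * f (z.1 - z.2))).
  apply/integrable12ltyP; first by apply/measurable_EFinP.
  have /integrableP[_] := iphi; apply: le_lt_trans.
  rewrite le_eqVlt; apply/orP; left; apply/eqP; apply: eq_integral => x _ /=.
  under eq_integral do rewrite normrM (ger0_norm (f0 _)) EFinM.
  rewrite ge0_integralZl//; last 2 first.
  - apply: (measurableT_comp (mfa x)); exact: measurable_oppV.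
  - by move=> y _; rewrite lee_fin.
  by rewrite F1 mule1.
have i2 : mu2.-integrable setT (EFin \o (fun z : V * V => phi z.2 ^+ 2 * f (z.1 - z.2))).
  apply/integrable21ltyP; first by apply/measurable_EFinP.
  have /integrableP[_] := iphi; apply: le_lt_trans.
  rewrite le_eqVlt; apply/orP; left; apply/eqP; apply: eq_integral => y _ /=.
  under eq_integral do rewrite normrM (ger0_norm (f0 _)) EFinM.
  rewrite ge0_integralZl//; last 2 first.
  - have := mfa (- y); apply: eq_measurable_fun => x _; by rewrite addrC.
  - by move=> x _; rewrite lee_fin.
  by rewrite F2 mule1.
apply: (le_integrable measurableT _ _ (integrable_addr i1 i2)).
  by apply/measurable_EFinP; exact: measurable_kint.
move=> z _ /=; rewrite lee_fin -mulrDl normrM [X in _ <= X]normrM ler_wpM2r//.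
rewrite [X in _ <= X]ger0_norm ?addr_ge0 ?sqr_ge0// normrM.
rewrite -(real_normK (num_real (phi z.1))) -(real_normK (num_real (phi z.2))).
have := normr_ge0 (phi z.1); have := normr_ge0 (phi z.2); nra.
Qed.

(** A windowed test function w lives in a translate of the cube, where at most m points are pairwise
    far apart. Motzkin-Straus with kernel eta bounds the square of the integral of w by m times the
    form of eta, which is nonnegativity of the form of m eta - 1. *)
Lemma COP_kernel (r : R) (m : nat) : 0 < r -> r < 1 ->
  (forall t : seq V, (forall x, x \in t -> cube T x) ->
     pairwise (fun x y => r < dot (x - y) (x - y)) t -> (size t <= m)%N) ->
  COP_inv R n (fun x => (m%:R * cutoff r 1 (dot x x) - 1) * f x).
Proof.
move=> r0 r1 Hm.
pose eta (x : V) := cutoff r 1 (dot x x).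
have seta : sm eta by apply: sm_cutoff => //; exact: sm_dot.
have meta : measurable_fun setT eta by apply: continuous_measurable_rV; exact: sm_continuous.
pose c (x : V) := m%:R * eta x - 1.
have sc : sm c.
  by apply: sm_add; [apply: sm_mul => //; exact: sm_cst|exact: sm_cst].
have cc : continuous c by exact: sm_continuous.
have mc : measurable_fun setT c by exact: continuous_measurable_rV.
have eta0 x : 0 <= eta x by exact: cutoff_ge0.
have eta1 x : eta x <= 1 by exact: cutoff_le1.
have cM x : `|c x| <= m%:R + 1.
  have : m%:R * eta x <= m%:R by rewrite ler_piMr.
  have : 0 <= m%:R * eta x by rewrite mulr_ge0.
  by rewrite /c ler_norml; set u := _ * eta x => ? ?; apply/andP; split; lra.
have ccf : continuous (fun x => c x * f x) by apply: sm_continuous; exact: sm_mul.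
have cfT x : c x * f x != 0 -> cube (T + T) x.
  by rewrite mulf_eq0 negb_or => /andP[_ /fT].
split; first by apply/Lfun1P; exact: continuous_cube_integrable cfT.
move=> phi /Lfun2P[mphi iphi] phi0.
have mcf : measurable_fun setT (fun x => c x * f x) by exact: measurable_funM.
have ikc (p : V -> R) : mu2.-integrable setT (EFin \o kint p f) ->
    mu2.-integrable setT (EFin \o kint p (fun x => c x * f x)).
  move=> ip.
  have mcs : measurable_fun setT (fun w : V * V => c (w.1 - w.2)).
    exact: (measurableT_comp mc (@measurable_subV R n)).
  have := integrable_mulr_bounded ip mcs (fun w => cM _).
  by apply: eq_integrable => // w _; rewrite /kint /=; congr EFin; ring.
rewrite inner_convolution//; last by apply: ikc; exact: integrable_kint_L2.
(* phi is nonnegative only almost everywhere, whereas [motzkin_straus] needs it at every point. *)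
pose psi x := Num.max (phi x) 0.
have mpsi : measurable_fun setT psi by exact: measurable_maxr.
have psi0 x : 0 <= psi x by rewrite le_max lexx orbT.
have pp : {ae mu, forall x, phi x = psi x}.
  by apply: filterS phi0 => x px; rewrite /psi max_l.
have -> : \int[mu2]_z kint phi (fun x => c x * f x) z =
          \int[mu2]_z kint psi (fun x => c x * f x) z.
  congr fine; apply: ae_eq_integral => //.
  - by apply/measurable_EFinP; exact: measurable_kint.
  - by apply/measurable_EFinP; exact: measurable_kint.
  - by apply: filterS (kint_ae mphi mpsi mcf pp) => z + _ => ->.
have ipsi : mu.-integrable setT (EFin \o (fun x => psi x ^+ 2)).
  apply: (le_integrable measurableT _ _ iphi).
    by apply/measurable_EFinP; exact: measurable_funX.
  move=> x _ /=; rewrite lee_fin !normrX; apply: lerXn2r => //; rewrite ?nnegrE//.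
  by rewrite /psi /Num.max; case: ifPn => // _; rewrite normr0.
have ikp := integrable_kint_L2 mpsi ipsi.
apply: (kint_window_ge0 mh h0 fE mc cM mpsi ikp) => z.
pose A := [set x : V | cube T (z + x)].
have mA : measurable A.
  by rewrite -[X in measurable X]setTI; apply: measurable_addl => //; exact: measurable_cube.
have Aoo : (mu A < +oo)%E.
  rewrite (_ : mu A = mu (cube T)); last by apply: lebesgue_rV_translate; exact: measurable_cube.
  exact: lebesgue_rV_cube_lty.
have hA (x : V) : ~ A x -> h (x + z) = 0.
  move=> Ax; apply/eqP; apply: contra_notT Ax => /hT; by rewrite /A/= addrC.
have ihz2 : mu.-integrable setT (EFin \o (fun x => h (x + z) ^+ 2)).
  apply: (@integrable_bounded_support _ _ _ mu A _ (B ^+ 2)) => //.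
  - exact: measurable_funX.
  - by move=> x; rewrite normrX lerXn2r// nnegrE// (le_trans (h0 0))// hB.
  - by move=> x /hA ->; rewrite expr0n.
(* A product of two square integrable functions; the cut-off by h is what makes the test function
   integrable. *)
have iw : mu.-integrable setT (EFin \o window h psi z).
  apply: (le_integrable measurableT _ _ (integrable_addr ipsi ihz2)).
    by apply/measurable_EFinP; exact: measurable_funM.
  move=> x _ /=; rewrite lee_fin /window normrM [X in _ <= X]ger0_norm ?addr_ge0 ?sqr_ge0//.
  rewrite !ger0_norm//.
  have := psi0 x; have := h0 (x + z); nra.
have w0 x : 0 <= window h psi z x by rewrite mulr_ge0.
pose K (w : V * V) := eta (w.1 - w.2).
have mK : measurable_fun setT K by exact: (measurableT_comp meta (@measurable_subV R n)).
(* The closed set where eta = 1; lying outside it is exactly the strict separation counted by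
   [Hm]. *)
pose N (x : V) := [set y : V | dot (x - y) (x - y) <= r].
have mN (x : V) : measurable (N x).
  have md : measurable_fun setT (fun y : V => dot (x - y) (x - y)).
    have mdot : measurable_fun setT (fun y : V => dot y y).
      by apply: continuous_measurable_rV; apply: sm_continuous; exact: sm_dot.
    apply: (measurableT_comp mdot); apply: (measurableT_comp (measurable_addl x)).
    exact: measurable_oppV.
  rewrite -[X in measurable X]setTI.
  rewrite (_ : N x = (fun y : V => dot (x - y) (x - y)) @^-1` `]-oo, r]%classic).
    exact: md.
  by apply/seteqP; split => y; rewrite /N/= in_itv.
have MS := @motzkin_straus _ _ _ mu N K (window h psi z) A m mN mK.
have {MS} : (\int[mu]_x window h psi z x) ^+ 2 <=
    m%:R * \int[mu2]_w (window h psi z w.1 * window h psi z w.2 * K w).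
  apply: MS => //.
  - by move=> w; rewrite /K eta0 eta1.
  - by move=> x y Nxy; rewrite /K /eta/= cutoff_eq1.
  - by move=> x /hA; rewrite /window => ->; rewrite mulr0.
  - move=> t tA pt; rewrite -(size_map (fun x => z + x)); apply: Hm.
      by move=> _ /mapP[x /tA Ax ->].
    rewrite pairwise_map; apply: sub_pairwise pt => x y /asboolP/negP.
    by rewrite -ltNge/= opprD addrACA subrr add0r.
move=> MS.
have iwK : mu2.-integrable setT (EFin \o kint (window h psi z) eta).
  by apply: (integrable_kint (M := 1) iw) => // x; rewrite ger0_norm.
have iw2 := integrable_prod iw iw.
have -> : \int[mu2]_w kint (window h psi z) c w =
   \int[mu2]_w (m%:R * kint (window h psi z) eta w -
                window h psi z w.1 * window h psi z w.2).
  by apply: eq_Rintegral => w _; rewrite /kint /c; ring.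
rewrite RintegralB//; last exact: integrable_scaler.
rewrite RintegralZl//.
have -> : \int[mu2]_w (window h psi z w.1 * window h psi z w.2) =
  (\int[mu]_x window h psi z x) ^+ 2.
  rewrite -(Rintegral12 iw2)/= expr2 -RintegralZr//.
  by apply: eq_Rintegral => x _; rewrite -RintegralZl.
by rewrite subr_ge0.
Qed.

End kernel_functions.

Lemma theta_le (X : set (V -> R)) (T r : R) (m : nat) : Cc_infty R n `<=` X ->
  2 < T -> 0 < r -> r < 1 ->
  (forall t : seq V, (forall x, x \in t -> cube T x) ->
     pairwise (fun x y => r < dot (x - y) (x - y)) t -> (size t <= m)%N) ->
  (theta_SP X (COP_inv R n) <= (m%:R * ((T - 2)^-1) ^+ n)%:E)%E.
Proof.
move=> CX T2 r0 r1 Hm.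
have [h [f [[mh h0 [B hB] hT] [sf fE f1 f0T fT]]]] := @exists_kernel R n T T2.
pose g (x : V) := (m%:R * cutoff r 1 (dot x x) - 1) * f x.
have sg : sm g.
  apply: sm_mul => //; apply: sm_add; last exact: sm_cst.
  by apply: sm_mul; [exact: sm_cst|apply: sm_cutoff => //; exact: sm_dot].
have fgE x : f x + g x = m%:R * cutoff r 1 (dot x x) * f x by rewrite /g; ring.
have f0 x : 0 <= f x.
  by rewrite -lee_fin -fE; apply: integral_ge0 => y _; rewrite lee_fin mulr_ge0.
apply: ge_ereal_inf; exists (f 0 + g 0)%:E.
  exists f, g; split => //.
  - split; first exact: (pos_type_kernel mh h0 hB sf fE fT).
    by apply: CX; apply: Cc_infty_cube fT; exact: sm_smooth.
  - split; first exact: (COP_kernel mh h0 hB hT sf fE f1 fT).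
    apply: CX; apply: (@Cc_infty_cube _ (T + T)); first exact: sm_smooth.
    by move=> x; rewrite mulf_eq0 negb_or => /andP[_ /fT].
  - rewrite /fourier.
    have d0 y : dot (0 : V) y = 0 by rewrite /dot big1// => i _; rewrite mxE mul0r.
    have -> : \int[mu]_y (f y * cos (2 * pi * dot 0 y)) = 1.
      under eq_Rintegral do rewrite d0 mulr0 cos0 mulr1.
      by rewrite /Rintegral f1.
    have -> : \int[mu]_y (f y * sin (2 * pi * dot 0 y)) = 0.
      under eq_Rintegral do rewrite d0 mulr0 sin0 mulr0.
      by rewrite Rintegral_cst// mul0r.
    by rewrite oppr0.
  - by move=> x x1; rewrite fgE cutoff_eq0 ?mulr0 ?mul0r// -enorm_ge1.
rewrite lee_fin fgE cutoff_eq1//; last by rewrite /dot big1 ?ltW// => i _; rewrite mxE mul0r.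
by rewrite mulr1 ler_wpM2l.
Qed.

End dual.

(** * Counting points and periodising packings *)

Section counting.
Context {T : choiceType} {R : realType}.

Lemma counting_ge (A : set T) (s : seq T) : uniq s ->
  (forall x, x \in s -> A x) -> ((size s)%:R%:E <= @counting T R A)%E.
Proof.
move=> us sA; rewrite /counting; case: ifPn => [/asboolP fA|_]; last by rewrite leey.
rewrite lee_fin ler_nat.
apply: uniq_leq_size => // x xs.
by rewrite in_fset_set// inE; exact: sA.
Qed.

(** The bound on finite sequences also rules out an infinite [A], on which [counting] is +oo. *)
Lemma counting_le (A : set T) (M : R) :
  (forall s : seq T, uniq s -> (forall x, x \in s -> A x) -> (size s)%:R <= M) ->
  (@counting T R A <= M%:E)%E.
Proof.
move=> H; rewrite /counting; case: ifPn => [/asboolP fA|/asboolP iA].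
  rewrite lee_fin; apply: H; first exact: finmap.fset_uniq.
  by move=> x xA; have := fset_setK fA => <-.
exfalso; have [B BA] := infinite_set_fset (Num.truncn M).+1 iA.
have : (size (finmap.enum_fset B))%:R <= M.
  by apply: H => [|x xB]; [exact: finmap.fset_uniq|exact: BA].
move=> BM nB; have : (Num.truncn M).+1%:R <= M.
  by apply: le_trans BM; rewrite ler_nat.
by rewrite leNgt truncnS_gt.
Qed.

End counting.

(** The factor l > 1 absorbs the losses of scale in both inequalities at a cost of e. *)
Lemma exists_scale (R : realType) (D : R) (n : nat) (e : R) : 0 < e ->
  exists2 l : R, 1 < l & D * l ^+ n <= D + e.
Proof.
move=> e0; have : (fun x : R => D * x ^+ n) x @[x --> (1 : R)] --> D * 1 ^+ n.
  by apply: cvgM; [exact: cvg_cst|exact: exprn_continuous].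
move/cvgrPdist_lt/(_ _ e0)/nbhs_ballP => [d /= d0 Hd].
exists (1 + d / 2); first by rewrite ltrDl divr_gt0.
have : `|D * 1 ^+ n - D * (1 + d / 2) ^+ n| < e.
  apply: Hd; rewrite /ball/= opprD addNKr normrN ger0_norm ?divr_ge0 ?ltW//.
  by rewrite ltr_pdivrMr// ltr_pMr// ltr1n.
by rewrite expr1n mulr1 => /ltr_normlP[]; lra.
Qed.

Section packing.
Context {R : realType}.
Variable n : nat.
Local Notation V := 'rV[R]_n.

Lemma enormN (x : V) : enorm (- x) = enorm x.
Proof.
by rewrite /enorm /dot; congr Num.sqrt; apply: eq_bigr => i _; rewrite !mxE mulrNN.
Qed.

Lemma enorm0 : enorm (0 : V) = 0.
Proof. by rewrite /enorm /dot big1 ?sqrtr0// => i _; rewrite mxE mul0r. Qed.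

Lemma packing_seq (t : seq V) : pairwise (fun x y => 1 <= enorm (x - y)) t ->
  uniq t /\ forall x y, x \in t -> y \in t -> x <> y -> 1 <= enorm (x - y).
Proof.
move=> pt; split.
  elim: t pt => //= x t IH /andP[xt /IH ->]; rewrite andbT.
  by apply/negP => /(allP xt); rewrite subrr enorm0 ler10.
move=> x y; elim: t pt => //= z t IH /andP[zt /IH{}IH].
rewrite !inE => /orP[/eqP ->|xt] /orP[/eqP ->|yt] //.
- by move=> _; exact: (allP zt).
- by move=> _; rewrite -enormN opprB; exact: (allP zt).
- exact: IH.
Qed.

(* Repeat the configuration t with period L + 1. *)
Lemma Delta_ge (t : seq V) (L : R) : 0 <= L -> (forall x, x \in t -> cube L x) ->
  pairwise (fun x y => 1 <= enorm (x - y)) t ->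
  (((size t)%:R / (L + 1) ^+ n)%:E <= Delta R n)%E.
Proof.
move=> L0 tL /packing_seq[ut pt].
have L1 : 0 < L + 1 by rewrite ltr_wpDl.
pose per (x : V) (z : 'rV[int]_n) : V := x + (L + 1) *: map_mx intr z.
pose P := [set p | exists2 x, x \in t & exists z, p = per x z].
(* Period L + 1 leaves a gap of 1 between copies of the cube: in a coordinate where z and w differ
   the lattice part is at least L + 1, and the points inside the cube change it by at most L. *)
have far x y z w : x \in t -> y \in t -> z != w -> 1 <= enorm (per x z - per y w).
  move=> xt yt zw.
  have [i zwi] : exists i, z ord0 i != w ord0 i.
    apply/existsP; apply: contraNT zw; rewrite negb_exists => /forallP h.
    by apply/eqP/rowP => i; have := h i; rewrite negbK => /eqP.
  apply: le_trans (coord_le_enorm _ i); rewrite /per !mxE.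
  have /cube_norm/(_ i) hx := tL _ xt; have /cube_norm/(_ i) hy := tL _ yt.
  have hz : 1 <= `|(z ord0 i)%:~R - (w ord0 i)%:~R : R|.
    rewrite -intrB -intr_norm (_ : 1 = 1%:~R)// ler_int.
    by rewrite -gtz0_ge1 normr_gt0 subr_eq0.
  set u := x ord0 i in hx *; set v := y ord0 i in hy *.
  set a := (z ord0 i)%:~R in hz *; set b := (w ord0 i)%:~R in hz *.
  have -> : u + (L + 1) * a - (v + (L + 1) * b) = (L + 1) * (a - b) - (v - u) by ring.
  have h1 : `|v - u| <= L by rewrite (le_trans (ler_normB _ _))//; lra.
  have h2 : L + 1 <= `|(L + 1) * (a - b)|.
    by rewrite normrM (gtr0_norm L1) ler_peMr// ltW.
  have := lerB_dist ((L + 1) * (a - b)) (v - u); lra.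
have packP : forall p q, P p -> P q -> p <> q -> 1 <= enorm (p - q).
  move=> p q [x xt [z ->]] [y yt [w ->]] pq.
  have [zw|zw] := eqVneq z w; last exact: far.
  have -> : per x z - per y w = x - y by rewrite /per zw opprD addrACA subrr addr0.
  by apply: pt => // xy; apply: pq; rewrite xy zw.
apply: (@le_trans _ _ (upper_point_density P)); last first.
  by apply: ereal_sup_ubound; exists P.
rewrite /upper_point_density limf_esupE.
apply: le_ereal_inf_tmp => _ [A [M [_ MA]] <-].
(* One large T in each neighbourhood of +oo suffices. This cube holds (2k + 1)^n full periods, so
   its ratio is at least that of [t] with no boundary loss. *)
pose k := (Num.truncn `|M|).+1.
pose T := (L + 1) * (2 * k%:R + 1).
have k0 : 0 <= k%:R :> R by [].
have MT : M < T.
  apply: (@lt_le_trans _ _ k%:R); first by rewrite (le_lt_trans (ler_norm _))// truncnS_gt.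
  by rewrite /T; nra.
have T0 : 0 < T by rewrite mulr_gt0//; lra.
apply: (@le_trans _ _ (counting (P `&` cube T) * ((T ^+ n)^-1)%:E)%E); last first.
  by apply: ereal_sup_ubound; exists T => //; exact: MA.
pose zs := [seq (\row_i ((g i : nat)%:Z - k%:Z) : 'rV[int]_n) |
  g : {ffun 'I_n -> 'I_(2 * k).+1}].
have uzs : uniq zs.
  rewrite map_inj_uniq ?enum_uniq// => g1 g2 /rowP h; apply/ffunP => i.
  by have := h i; rewrite !mxE => /addIr [] /val_inj.
pose s := [seq per x z | x <- t, z <- zs].
have per_inj : {in [seq (x, z) | x <- t, z <- zs] &, injective (uncurry per)}.
  move=> [x z] [y w] /allpairsP[[x1 z1] [/= xt _ [-> ->]]]
    /allpairsP[[y1 w1] [/= yt _ [-> ->]]] /= e.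
  have [zw|zw] := eqVneq z1 w1; last first.
    by have := far _ _ _ _ xt yt zw; rewrite e subrr enorm0 ler10.
  by move: e; rewrite /per zw => /addIr ->.
have us : uniq s by exact: allpairs_uniq.
have sP p : p \in s -> (P `&` cube T) p.
  move=> /allpairsP[[x z] [/= xt /mapP[g _ ->] ->]]; split; first by exists x => //; eexists.
  apply/cube_norm => i; rewrite /per !mxE.
  have /cube_norm/(_ i) hx := tL _ xt.
  have hg : `|((g i : nat)%:Z - k%:Z)%:~R : R| <= k%:R.
    rewrite intrB !pmulrn ler_norml; have := ltn_ord (g i); rewrite ltnS => hgi.
    have : (g i)%:R <= 2 * k%:R :> R by rewrite -natrM ler_nat.
    have : 0 <= (g i)%:R :> R by [].
    by rewrite -!pmulrn => ? ?; apply/andP; split; lra.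
  rewrite (le_trans (ler_normD _ _))// normrM (gtr0_norm L1) /T.
  nra.
have ss : size s = (size t * (2 * k).+1 ^ n)%N.
  by rewrite size_allpairs size_map -cardT card_ffun !card_ord.
have := @counting_ge _ R _ _ us sP.
rewrite ss => hc; apply: (@le_trans _ _ ((size t * (2 * k).+1 ^ n)%:R%:E * ((T ^+ n)^-1)%:E)%E).
  rewrite -EFinM lee_fin natrM natrX /T exprMn -natr1 natrM.
  rewrite invfM mulrACA divff ?mulr1// expf_neq0// gt_eqF//; lra.
by rewrite lee_wpmul2r// lee_fin invr_ge0 exprn_ge0// ltW.
Qed.

Lemma theta_le_Delta (X : set (V -> R)) : Cc_infty R n `<=` X ->
  (theta_SP X (COP_inv R n) <= Delta R n)%E.
Proof.
move=> CX.
(* The empty configuration gives nonnegativity, which excludes -oo in the case analysis below. *)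
have D0 : (0 <= Delta R n)%E.
  by have := @Delta_ge [::] 0 (lexx _); rewrite /= mul0r; exact.
case DE : (Delta R n) D0 => [D| |] D0; [|by rewrite leey|by []].
rewrite lee_fin in D0; apply/lee_addgt0Pr => e e0; rewrite -EFinD.
have [l l1 Dl] := exists_scale D n e0.
(* Dilation by s turns distances above 1/s = sqrt r into distances above 1 and cube T into cube (s
   T), repeated with period s T + 1. As s < l, a large T gives s T + 1 <= l (T - 2); the summand 3
   secures T > 2. *)
pose s := (1 + l) / 2; have s1 : 1 < s by rewrite /s; lra.
have sl : s < l by rewrite /s; lra.
have s0 : 0 < s by lra.
pose T := (1 + 2 * l) / (l - s) + 3.
have T3 : 3 <= T by rewrite lerDr divr_ge0//; lra.
have sT : s * T + 1 <= l * (T - 2).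
  have : (1 + 2 * l) <= T * (l - s).
    by rewrite -ler_pdivrMr ?subr_gt0// /T lerDl.
  lra.
pose r := s^-1 ^+ 2.
have r0 : 0 < r by rewrite exprn_gt0// invr_gt0.
have r1 : r < 1 by rewrite expr_lt1// ?invr_ge0 ?ltW// invf_lt1.
have sT0 : 0 <= s * T + 1 by rewrite addr_ge0// mulr_ge0//; lra.
(* The number of points that [Delta_ge] allows for a dilated configuration. *)
pose m := Num.truncn (D * (s * T + 1) ^+ n).
have mD : m%:R <= D * (s * T + 1) ^+ n by rewrite truncn_le ?mulr_ge0// ?exprn_ge0.
have Hm (t : seq V) : (forall x, x \in t -> cube T x) ->
    pairwise (fun x y => r < dot (x - y) (x - y)) t -> (size t <= m)%N.
  move=> tT pt.
  have h : (((size (map (fun x => s *: x) t))%:R / (s * T + 1) ^+ n)%:E <= Delta R n)%E.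
    apply: Delta_ge; first by rewrite mulr_ge0//; lra.
      move=> _ /mapP[x /tT /cube_norm xT ->]; apply/cube_norm => i.
      rewrite mxE normrM (gtr0_norm s0) -mulrA ler_wpM2l//; exact: ltW.
    rewrite pairwise_map; apply: sub_pairwise pt => x y /= hxy.
    rewrite enorm_ge1 -scalerBr.
    have -> : dot (s *: (x - y)) (s *: (x - y)) = s ^+ 2 * dot (x - y) (x - y).
      by rewrite /dot mulr_sumr; apply: eq_bigr => i _; rewrite [in LHS]mxE mulrACA expr2 !mxE.
    rewrite mulrC -ler_pdivrMr ?exprn_gt0// mul1r -exprVn; exact: ltW.
  move: h; rewrite DE lee_fin size_map ler_pdivrMr; last first.
    by rewrite exprn_gt0// ltr_wpDl// mulr_ge0//; lra.
  by move=> h; rewrite /m truncn_ge_nat// mulr_ge0// exprn_ge0.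
have T2 : 2 < T by lra.
apply: (le_trans (theta_le CX T2 r0 r1 Hm)); rewrite lee_fin.
apply: le_trans Dl; rewrite exprVn ler_pdivrMr; last by rewrite exprn_gt0//; lra.
apply: le_trans mD _; rewrite -[leRHS]mulrA -exprMn ler_wpM2l// lerXn2r ?nnegrE//.
by apply: le_trans sT.
Qed.

End packing.

(** * The lower bound Delta <= theta *)

Section Rintegral_sums.
Context d (T : measurableType d) {R : realType} (mu : {measure set T -> \bar R}).

Lemma integrable_sumr (I : Type) (s : seq I) (F : I -> T -> R) :
  (forall i, mu.-integrable setT (EFin \o F i)) ->
  mu.-integrable setT (EFin \o (fun x => \sum_(i <- s) F i x)).
Proof.
move=> iF; elim: s => [|i s IH].
  rewrite (_ : _ \o _ = cst 0%E); first exact: integrable0.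
  by apply/funext => x /=; rewrite big_nil.
have := integrable_addr (iF i) IH; apply: eq_integrable => // x _ /=.
by rewrite big_cons.
Qed.

Lemma Rintegral_sum (I : Type) (s : seq I) (F : I -> T -> R) :
  (forall i, mu.-integrable setT (EFin \o F i)) ->
  \int[mu]_x (\sum_(i <- s) F i x) = \sum_(i <- s) \int[mu]_x F i x.
Proof.
move=> iF; elim: s => [|i s IH].
  rewrite big_nil (_ : (fun x => _) = cst 0); first by rewrite Rintegral_cst// mul0r.
  by apply/funext => x; rewrite big_nil.
rewrite big_cons -IH -RintegralD//; last exact: integrable_sumr.
by apply: eq_Rintegral => x _; rewrite big_cons.
Qed.

End Rintegral_sums.

(** * Bilinear forms and averages over large cubes *)

Section product_pairing.
Context {R : realType}.
Variable n : nat.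
Local Notation V := 'rV[R]_n.
Local Notation mu := (@lebesgue_rV R n).
Local Notation mu2 := (mu \x mu)%E.

Lemma integrable_indic (A : set V) : measurable A -> (mu A < +oo)%E ->
  mu.-integrable setT (EFin \o (\1_A : V -> R)).
Proof.
move=> mA Aoo; apply: (@integrable_bounded_support _ _ _ mu A _ 1) => //.
- by move=> x; rewrite indicE; case: (_ \in _); rewrite ?normr1 ?normr0.
- by move=> x Ax; rewrite indicE memNset.
Qed.

Lemma measurable_translate (F : V -> R) (p : V) : measurable_fun setT F ->
  measurable_fun setT (fun x : V => F (x - p)).
Proof.
move=> mF; rewrite (_ : (fun x => _) = F \o (fun x => - p + x)).
  exact: (measurableT_comp mF (measurable_addl _)).
by apply/funext => x /=; rewrite addrC.
Qed.

Lemma Rintegral_translate (F : V -> R) (p : V) : measurable_fun setT F ->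
  \int[mu]_x F (x - p) = \int[mu]_x F x.
Proof.
move=> mF; congr fine; rewrite -(integral_rV_translate (- p) (f := EFin \o F)).
  by apply: eq_integral => x _; rewrite /= addrC.
by apply/measurable_EFinP.
Qed.

Lemma Rintegral_reflect (F : V -> R) (p : V) : measurable_fun setT F ->
  \int[mu]_x F (p - x) = \int[mu]_x F x.
Proof.
move=> mF; congr fine; rewrite -(integral_rV_translate p (f := EFin \o F)).
  rewrite -[RHS](integral_rV_opp (f := fun x => (F (p + x))%:E)).
    by apply: eq_integral => x _.
  by apply/measurable_EFinP; exact: (measurableT_comp mF (measurable_addl _)).
by apply/measurable_EFinP.
Qed.

Lemma integrable_translate (F : V -> R) (p : V) :
  mu.-integrable setT (EFin \o F) -> mu.-integrable setT (EFin \o (fun x => F (x - p))).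
Proof.
move=> /integrableP[mF iF].
have mF' : measurable_fun setT F by apply/measurable_EFinP.
apply/integrableP; split; first by apply/measurable_EFinP; exact: measurable_translate.
apply: le_lt_trans iF; rewrite le_eqVlt; apply/orP; left; apply/eqP.
rewrite -(integral_rV_translate (- p) (f := fun x => `|(F x)%:E|%E)).
  by apply: eq_integral => x _; rewrite /= addrC.
exact: measurableT_comp.
Qed.

Lemma integrable_reflect (F : V -> R) (p : V) :
  mu.-integrable setT (EFin \o F) -> mu.-integrable setT (EFin \o (fun x => F (p - x))).
Proof.
move=> iF; have /integrableP[mF ioo] := integrable_translate (- p) iF.
have mF' : measurable_fun setT (fun x : V => F (x - - p)) by apply/measurable_EFinP.
have E : (fun x => F (p - x)) = (fun x => F (x - - p)) \o (-%R : V -> V).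
  by apply/funext => x /=; rewrite opprK addrC.
apply/integrableP; split.
  by apply/measurable_EFinP; rewrite E; exact: (measurableT_comp mF' (@measurable_oppV R n)).
apply: le_lt_trans ioo; rewrite le_eqVlt; apply/orP; left; apply/eqP.
rewrite -[RHS](integral_rV_opp (f := fun x => `|(F (x - - p))%:E|%E)).
  by apply: eq_integral => x _; rewrite /= opprK addrC.
exact: measurableT_comp.
Qed.

(** The polarisation of [kint], needed to expand the form at psi - c q. *)
Definition kint2 (a b F : V -> R) (z : V * V) : R := a z.1 * b z.2 * F (z.1 - z.2).

Lemma integrable_kint2 (a b F : V -> R) (M : R) :
  mu.-integrable setT (EFin \o a) -> mu.-integrable setT (EFin \o b) ->
  measurable_fun setT F -> (forall x, `|F x| <= M) ->
  mu2.-integrable setT (EFin \o kint2 a b F).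
Proof.
move=> ia ib mF FM.
apply: (integrable_mulr_bounded (M := M) (integrable_prod ia ib)) => //.
exact: (measurableT_comp mF (@measurable_subV R n)).
Qed.

Lemma Rintegral_prod (a b : V -> R) :
  mu.-integrable setT (EFin \o a) -> mu.-integrable setT (EFin \o b) ->
  \int[mu2]_z (a z.1 * b z.2) = (\int[mu]_x a x) * (\int[mu]_x b x).
Proof.
move=> ia ib; rewrite -(Rintegral12 (integrable_prod ia ib))/= -RintegralZr//.
by apply: eq_Rintegral => x _; rewrite -RintegralZl.
Qed.

Section bounded_kernel.
Variables (F : V -> R) (M : R).
Hypotheses (mF : measurable_fun setT F) (FM : forall x, `|F x| <= M)
  (iF : mu.-integrable setT (EFin \o F)).

(** Substituting y = x - u exhibits an average of [b] around x with weight [F]; for [b] the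
    indicator of a large cube it is close to the integral of [F] when x is deep inside. *)
Lemma kint2_left (a b : V -> R) (B : R) :
  mu.-integrable setT (EFin \o a) -> mu.-integrable setT (EFin \o b) ->
  (forall x, `|b x| <= B) ->
  \int[mu2]_z kint2 a b F z = \int[mu]_x (a x * \int[mu]_u (b (x - u) * F u)).
Proof.
move=> ia ib bB.
have mb : measurable_fun setT b by apply/measurable_EFinP; exact: measurable_int ib.
rewrite -(Rintegral12 (integrable_kint2 ia ib mF FM)).
apply: eq_Rintegral => x _; rewrite /kint2/=.
under eq_Rintegral do rewrite -mulrA.
have ibF : mu.-integrable setT (EFin \o (fun u => F u * b (x - u))).
  apply: (integrable_mulr_bounded iF (M := B)) => //.
  have := measurable_translate x (measurableT_comp mb (@measurable_oppV R n)).
  by apply: eq_measurable_fun => u _; rewrite /= opprB.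
rewrite RintegralZl//; last first.
  have := integrable_reflect x ibF; apply: eq_integrable => // y _ /=.
  by rewrite opprB addrCA subrr addr0 mulrC.
congr (_ * _); rewrite -(Rintegral_reflect x (F := fun u => b (x - u) * F u)).
  by apply: eq_Rintegral => y _; rewrite opprB addrCA subrr addr0.
apply/measurable_EFinP; have /measurable_int := ibF.
by apply: eq_measurable_fun => u _ /=; rewrite mulrC.
Qed.

Lemma kint2_right (a b : V -> R) (B : R) :
  mu.-integrable setT (EFin \o a) -> mu.-integrable setT (EFin \o b) ->
  (forall x, `|b x| <= B) ->
  \int[mu2]_z kint2 b a F z = \int[mu]_x (a x * \int[mu]_u (b (u + x) * F u)).
Proof.
move=> ia ib bB.
have mb : measurable_fun setT b by apply/measurable_EFinP; exact: measurable_int ib.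
rewrite -(Rintegral21 (integrable_kint2 ib ia mF FM)).
apply: eq_Rintegral => x _; rewrite /kint2/=.
have ibF : mu.-integrable setT (EFin \o (fun u => F u * b (u + x))).
  apply: (integrable_mulr_bounded iF (M := B)) => //.
  by have := measurable_translate (- x) mb; apply: eq_measurable_fun => u _; rewrite opprK.
have mbF : measurable_fun setT (fun u : V => b (u + x) * F u).
  apply/measurable_EFinP; have /measurable_int := ibF.
  by apply: eq_measurable_fun => u _ /=; rewrite mulrC.
under eq_Rintegral do rewrite [b _ * a x]mulrC -mulrA.
rewrite RintegralZl//; last first.
  have := integrable_translate x ibF; apply: eq_integrable => // y _ /=.
  by rewrite subrK mulrC.
congr (_ * _); rewrite -(Rintegral_translate x mbF).
by apply: eq_Rintegral => y _; rewrite subrK.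
Qed.

End bounded_kernel.

(** The integrals of |f| over growing cubes converge to the full one. Arbitrary S is allowed because
    translated and reflected cubes take its place later. *)
Lemma integral_tail (f : V -> R) (e : R) : mu.-integrable setT (EFin \o f) -> 0 < e ->
  exists2 k : nat, (0 < k)%N & forall S : set V, measurable S -> cube k%:R `<=` S ->
    `|\int[mu]_x f x - \int[mu]_x (\1_S x * f x)| <= e.
Proof.
move=> intf e0.
have mf : measurable_fun setT f by apply/measurable_EFinP; exact: measurable_int intf.
have mEf : measurable_fun setT (fun x => `|(f x)%:E|%E).
  by apply: measurableT_comp => //; apply/measurable_EFinP.
have nd : nondecreasing_seq (fun k : nat => cube k%:R : set V).
  by move=> i j ij; apply/subsetPset/cubeS; rewrite ler_nat.
have := @ge0_nondecreasing_set_cvg_integral _ V R (fun k : nat => cube k%:R)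
  (fun x => `|(f x)%:E|%E) mu nd
  (fun=> measurable_cube _) (fun=> measurable_funTS mEf) (fun _ _ _ => abse_ge0 _).
have -> : \bigcup_k cube k%:R = [set: V].
  apply/seteqP; split => // x _; pose s := \sum_i `|x ord0 i|.
  exists (Num.truncn (2 * s)).+1 => //; apply/cube_norm => i.
  have : `|x ord0 i| <= s by rewrite /s (bigD1 i)//= lerDl sumr_ge0.
  have := truncnS_gt (2 * s); lra.
have /integrableP[_ foo] := intf.
have ffin : (\int[mu]_x `|(f x)%:E|)%E \is a fin_num by rewrite ge0_fin_numE// integral_ge0.
rewrite -(fineK ffin); move/fine_cvgP => [_ /cvgrPdist_le /(_ _ e0)[N _ HN]].
exists N.+1 => // S mS NS; have := HN N.+1 (leqnSn N); set k := N.+1 in NS *.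
rewrite -RintegralB//; last first.
  have := integrable_mulr_bounded intf (measurable_indic mS) (M := 1) _.
  move=> /(_ _)/wrap[]; first by move=> x; rewrite indicE; case: (_ \in _); rewrite ?normr1 ?normr0.
  by apply: eq_integrable => // x _; rewrite /= mulrC.
move=> H; apply: le_trans H.
have ia : mu.-integrable setT (EFin \o (fun x => `|f x|)) by exact: (integrable_norm intf).
have ik (A : set V) : measurable A -> mu.-integrable setT (EFin \o (fun x => `|f x| * \1_A x)).
  move=> mA; apply: (integrable_mulr_bounded ia (M := 1)); first exact: measurable_indic.
  by move=> x; rewrite indicE; case: (_ \in _); rewrite ?normr1 ?normr0.
have ikS : mu.-integrable setT (EFin \o (fun x => f x - \1_S x * f x)).
  apply: integrable_subr => //.
  have := integrable_mulr_bounded intf (measurable_indic mS) (M := 1) _.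
  move=> /(_ _)/wrap[]; first by move=> x; rewrite indicE; case: (_ \in _); rewrite ?normr1 ?normr0.
  by apply: eq_integrable => // x _; rewrite /= mulrC.
have mk : measurable (cube k%:R : set V) by exact: measurable_cube.
have E : fine (\int[mu]_(x in cube k%:R) `|(f x)%:E|)%E = \int[mu]_x (`|f x| * \1_(cube k%:R) x).
  rewrite integral_mkcond; congr fine; apply: eq_integral => x _.
  rewrite patchE indicE; case: ifPn => /=; last by rewrite mulr0.
  by rewrite mulr1.
rewrite /comp/= E; apply: (le_trans (le_normr_Rintegral _ ikS)) => //.
apply: le_trans (ler_norm _).
rewrite -[X in _ <= X - _]/(\int[mu]_x `|f x|) -RintegralB//; last exact: ik.
apply: le_Rintegral => //.
- exact: (integrable_norm ikS).
- by apply: integrable_subr => //; exact: ik.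
move=> x _; rewrite !indicE.
case: (boolP (x \in cube k%:R)) => [/set_mem/NS xS|_].
  by rewrite mem_set// mulr1 mul1r !subrr normr0.
rewrite mulr0 subr0; case: (x \in S); first by rewrite mul1r subrr normr0.
by rewrite mul0r subr0.
Qed.

End product_pairing.

Section kernel_averages.
Context {R : realType}.
Variable n : nat.
Local Notation V := 'rV[R]_n.
Local Notation mu := (@lebesgue_rV R n).
Local Notation mu2 := (mu \x mu)%E.
Variables (f : V -> R) (M L : R).
Hypotheses (mf : measurable_fun setT f) (fM : forall x, `|f x| <= M)
  (iF : mu.-integrable setT (EFin \o f)) (fL : \int[mu]_x `|f x| <= L).

Lemma integrable_indicM (A : set V) : measurable A ->
  mu.-integrable setT (EFin \o (fun u => \1_A u * f u)).
Proof.
move=> mA; have := integrable_mulr_bounded iF (measurable_indic mA) (M := 1) _.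
move=> /(_ _)/wrap[]; first by move=> x; rewrite indicE; case: (_ \in _); rewrite ?normr1 ?normr0.
by apply: eq_integrable => // x _; rewrite /= mulrC.
Qed.

Lemma indicM_le (A : set V) : measurable A -> `|\int[mu]_u (\1_A u * f u)| <= L.
Proof.
move=> mA; apply: le_trans fL.
apply: (le_trans (le_normr_Rintegral measurableT (integrable_indicM mA))).
apply: le_Rintegral => //.
- exact: (integrable_norm (integrable_indicM mA)).
- exact: (integrable_norm iF).
move=> x _; rewrite normrM indicE; case: (_ \in _); first by rewrite normr1 mul1r.
by rewrite normr0 mul0r.
Qed.

Section with_phi.
Variables (phi : V -> V -> V) (A : set V).
Hypotheses (mphi : measurable_fun setT (fun z : V * V => phi z.1 z.2)) (mA : measurable A).

Let mpre x : measurable (phi x @^-1` A).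
Proof.
rewrite -[X in measurable X]setTI.
exact: (measurable_fun_pair2 x mphi).
Qed.

Lemma average_le x : `|\int[mu]_u (\1_A (phi x u) * f u)| <= L.
Proof. exact: (indicM_le (mpre x)). Qed.

Lemma integrable_average (a : V -> R) : mu.-integrable setT (EFin \o a) ->
  mu.-integrable setT (EFin \o (fun x => a x * \int[mu]_u (\1_A (phi x u) * f u))).
Proof.
move=> ia; apply: (integrable_mulr_bounded ia (M := L)); last exact: average_le.
apply: (@measurable_Rintegral2 _ _ _ _ _ mu (fun z : V * V => \1_A (phi z.1 z.2) * f z.2)).
apply: measurable_funM; last exact: (measurableT_comp mf measurable_snd).
exact: (measurableT_comp (measurable_indic mA) mphi).
Qed.

(** [phi x u] will be x - u or u + x, one for each order of the arguments in [kint2]; the preimage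
    of A plays the role of S. *)
Lemma average_near (K : set V) (e : R) (x : V) :
  (forall S : set V, measurable S -> K `<=` S ->
    `|\int[mu]_x f x - \int[mu]_x (\1_S x * f x)| <= e) ->
  (forall u, K u -> A (phi x u)) -> `|\int[mu]_x f x - \int[mu]_u (\1_A (phi x u) * f u)| <= e.
Proof. by move=> H KA; exact: (H _ (mpre x)). Qed.

End with_phi.

End kernel_averages.

(** * Testing a packing against f and g *)

Section weak_duality.
Context {R : realType}.
Variable n : nat.
Local Notation V := 'rV[R]_n.
Local Notation mu := (@lebesgue_rV R n).
Local Notation mu2 := (mu \x mu)%E.

Section box.
Variable eps : R.
Hypothesis eps0 : 0 < eps.

(** A point mass spread into a bounded integrable function of integral 1. *)
Definition box (x : V) : R := (eps ^+ n)^-1 * \1_(cube eps) x.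

Lemma box_ge0 x : 0 <= box x.
Proof. by rewrite mulr_ge0// ?indicE// invr_ge0 exprn_ge0// ltW. Qed.

Lemma box_le x : box x <= (eps ^+ n)^-1.
Proof.
have h : 0 <= (eps ^+ n)^-1 by rewrite invr_ge0 exprn_ge0// ltW.
by rewrite /box indicE; case: (_ \in _); rewrite ?mulr1 ?mulr0.
Qed.

Lemma box_support x : box x != 0 -> cube eps x.
Proof.
rewrite /box indicE; case: (boolP (x \in _)) => [/set_mem//|_].
by rewrite mulr0 eqxx.
Qed.

Lemma Rintegral_indic_cube (L : R) : 0 <= L -> \int[mu]_x \1_(cube L) x = L ^+ n.
Proof.
move=> L0; rewrite /Rintegral integral_indic//; last exact: measurable_cube.
by rewrite setIT; have /(congr1 fine) := lebesgue_rV_cube n L0.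
Qed.

Lemma integrable_indic_cube (L : R) : mu.-integrable setT (EFin \o (\1_(cube L) : V -> R)).
Proof. by apply: integrable_indic; [exact: measurable_cube|exact: lebesgue_rV_cube_lty]. Qed.

Lemma integrable_box : mu.-integrable setT (EFin \o box).
Proof. apply: integrable_scaler; exact: integrable_indic_cube. Qed.

Lemma Rintegral_box : \int[mu]_x box x = 1.
Proof.
rewrite RintegralZl//; last exact: integrable_indic_cube.
by rewrite Rintegral_indic_cube ?ltW// mulVf// gt_eqF// exprn_gt0.
Qed.

End box.

Definition smear N (p : 'I_N -> V) (eps : R) (x : V) : R := \sum_i box eps (x - p i).

Section smear.
Variables (N : nat) (p : 'I_N -> V) (eps : R).
Hypothesis eps0 : 0 < eps.
Local Notation phi := (fun (i : 'I_N) (x : V) => box eps (x - p i)).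
Local Notation psi := (smear p eps).

Let iphi i : mu.-integrable setT (EFin \o phi i).
Proof. exact: (integrable_translate (p i) (integrable_box eps)). Qed.

Let mbox : measurable_fun setT (box eps).
Proof. by apply/measurable_EFinP; exact: measurable_int (integrable_box eps). Qed.

Lemma integrable_smear : mu.-integrable setT (EFin \o psi).
Proof. exact: (integrable_sumr _ iphi). Qed.

Lemma smear_ge0 x : 0 <= psi x.
Proof. by apply: sumr_ge0 => i _; exact: box_ge0. Qed.

Lemma smear_le x : psi x <= N%:R * (eps ^+ n)^-1.
Proof.
rewrite -[N in X in _ <= X]card_ord mulr_natl -sumr_const.
by apply: ler_sum => i _; exact: box_le.
Qed.

Let Iphi i : \int[mu]_x phi i x = 1.
Proof. by rewrite (Rintegral_translate (p i) mbox) Rintegral_box. Qed.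

Lemma Rintegral_smear : \int[mu]_x psi x = N%:R.
Proof.
rewrite /smear (Rintegral_sum _ iphi) (eq_bigr (fun=> 1)); last by move=> i _; exact: Iphi.
by rewrite sumr_const card_ord.
Qed.

Lemma smear_support (T : R) x : (forall i, cube T (p i)) -> psi x != 0 -> cube (T + eps) x.
Proof.
move=> pT px; have [i bi] : exists i, box eps (x - p i) != 0.
  apply/existsP; apply: contraNT px; rewrite negb_exists => /forallP h.
  by rewrite /smear big1// => i _; apply/eqP; have := h i; rewrite negbK.
by have := cubeD (pT i) (box_support bi); rewrite addrCA subrr addr0.
Qed.

(** A pair of boxes contributes an average of F over differences within cube (2 eps) of p i - p j,
    so the oscillation kappa is the only loss. *)
Lemma smear_kint_le (F : V -> R) (M kappa : R) : measurable_fun setT F ->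
  (forall x, `|F x| <= M) ->
  (forall i j u, cube (eps + eps) u -> F (p i - p j + u) <= F (p i - p j) + kappa) ->
  \int[mu2]_z kint psi F z <= \sum_i \sum_j (F (p i - p j) + kappa).
Proof.
move=> mF FM Fk.
have iprod i j := integrable_prod (iphi i) (iphi j).
pose G i (z : V * V) := \sum_j (F (p i - p j) + kappa) * (phi i z.1 * phi j z.2).
have iG i : mu2.-integrable setT (EFin \o G i).
  apply: (@integrable_sumr _ _ _ _ _ _ (fun j (z : V * V) =>
    (F (p i - p j) + kappa) * (phi i z.1 * phi j z.2))) => j.
  exact: integrable_scaler.
have -> : \sum_i \sum_j (F (p i - p j) + kappa) = \int[mu2]_z (\sum_i G i z).
  rewrite (Rintegral_sum _ iG); apply: eq_bigr => i _.
  rewrite /G (@Rintegral_sum _ _ _ _ _ _ (fun j (z : V * V) =>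
    (F (p i - p j) + kappa) * (phi i z.1 * phi j z.2))); last first.
    by move=> j; exact: integrable_scaler.
  apply: eq_bigr => j _; rewrite RintegralZl//.
  by rewrite (Rintegral_prod (iphi i) (iphi j)) !Iphi !mulr1.
apply: le_Rintegral => //.
- exact: (integrable_kint integrable_smear mF FM).
- exact: (integrable_sumr _ iG).
move=> z _; rewrite /kint /smear big_distrlr/= mulr_suml; apply: ler_sum => i _.
rewrite /G mulr_suml; apply: ler_sum => j _; rewrite mulrC.
have [->|b1] := eqVneq (box eps (z.1 - p i)) 0; first by rewrite !mul0r !mulr0.
have [->|b2] := eqVneq (box eps (z.2 - p j)) 0; first by rewrite !mulr0.
apply: ler_wpM2r; first by apply: mulr_ge0; exact: box_ge0.
have := Fk i j _ (cubeD (box_support b1) (cubeN (box_support b2))).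
have -> // : p i - p j + (z.1 - p i - (z.2 - p j)) = z.1 - z.2.
by apply/rowP => k; rewrite !mxE; ring.
Qed.

End smear.

(** There are finitely many differences p i - p j, so continuity at each of them gives a common
    [d]. *)
Lemma continuous_box_bound (F : V -> R) N (p : 'I_N -> V) (kappa : R) :
  continuous F -> 0 < kappa -> exists2 d : R, 0 < d & forall eps : R, eps <= d ->
  forall i j u, cube (eps + eps) u -> F (p i - p j + u) <= F (p i - p j) + kappa.
Proof.
move=> cF k0.
have H i j : \forall u \near (0 : V), `|F (p i - p j) - F (p i - p j + u)| < kappa.
  have : F (p i - p j + u) @[u --> (0 : V)] --> F (p i - p j).
    have h : p i - p j + u @[u --> (0 : V)] --> p i - p j + 0.
      exact: (@cvgD _ _ _ (nbhs (0 : V)) _ (fun=> p i - p j) id _ _ (cvg_cst _) cvg_id).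
    rewrite addr0 in h; exact: (cvg_comp _ _ h (cF _)).
  by move/cvgrPdist_lt/(_ _ k0).
have H2 : \forall u \near (0 : V), forall i j, `|F (p i - p j) - F (p i - p j + u)| < kappa.
  exact: (filter_forall _ (fun i => filter_forall _ (H i))).
have [d /= d0 Hd] := (nbhs_ballP (0 : V) _).1 H2; exists (d / 2); first by rewrite divr_gt0.
move=> eps epsd i j u /cube_norm ue.
have /(_ i j)/ltr_normlP[] : forall i j, `|F (p i - p j) - F (p i - p j + u)| < kappa.
  apply: Hd; split=> // a b; rewrite (ord1 a) /ball/= mxE sub0r normrN.
  apply: le_lt_trans (ue b) _; lra.
lra.
Qed.

Section main_inequality.
Variables (f g : V -> R) (M L e k : R).
Hypotheses (cf : continuous f) (cg : continuous g)
  (fM : forall x, `|f x| <= M) (gM : forall x, `|g x| <= M)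
  (intf : mu.-integrable setT (EFin \o f)) (fL : \int[mu]_x `|f x| <= L)
  (f1 : \int[mu]_x f x = 1)
  (fpos : forall a, mu.-integrable setT (EFin \o a) -> 0 <= \int[mu2]_z kint a f z)
  (gcop : forall a (B : R), mu.-integrable setT (EFin \o a) ->
     (forall x, 0 <= a x <= B) -> 0 <= \int[mu2]_z kint a g z)
  (fg : forall x, 1 <= enorm x -> f x + g x <= 0)
  (e0 : 0 < e)
  (tail : forall S : set V, measurable S -> cube k `<=` S ->
    `|\int[mu]_x f x - \int[mu]_x (\1_S x * f x)| <= e).

Let mf : measurable_fun setT f. Proof. exact: continuous_measurable_rV. Qed.
Let mg : measurable_fun setT g. Proof. exact: continuous_measurable_rV. Qed.

(** Off the diagonal [fg] makes the terms nonpositive up to 2 kappa; the N diagonal terms remain. *)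
Lemma packing_sum_le N (p : 'I_N -> V) (kappa : R) :
  (forall i j, i != j -> 1 <= enorm (p i - p j)) ->
  \sum_i \sum_j (f (p i - p j) + kappa) + \sum_i \sum_j (g (p i - p j) + kappa) <=
  N%:R * (f 0 + g 0) + 2 * N%:R ^+ 2 * kappa.
Proof.
move=> pp; rewrite -big_split/=.
have -> : N%:R * (f 0 + g 0) + 2 * N%:R ^+ 2 * kappa =
   \sum_(i < N) (f 0 + g 0 + N%:R * (2 * kappa)).
  by rewrite sumr_const card_ord -mulr_natl; ring.
apply: ler_sum => i _; rewrite -big_split/=.
apply: (@le_trans _ _ (\sum_(j < N) ((if j == i then f 0 + g 0 else 0) + 2 * kappa))).
  apply: ler_sum => j _; case: eqVneq => [->|ji].
    by rewrite subrr; lra.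
  have := fg (pp i j _); rewrite eq_sym ji => /(_ isT); lra.
rewrite big_split/= -big_mkcond/= big_pred1_eq sumr_const card_ord -[2 * kappa *+ _]mulr_natl.
by [].
Qed.

(* 0 <= B_f(psi - c q, psi - c q) + B_g(psi, psi) with psi the smeared packing and
   q the indicator of cube s; the terms B_f(psi, q) are N up to e by tail. *)
Lemma packing_quadratic N (p : 'I_N -> V) (T s c : R) :
  (forall i j, i != j -> 1 <= enorm (p i - p j)) -> (forall i, cube T (p i)) ->
  0 <= k -> 0 <= T -> T + k + 1 <= s -> 0 <= c ->
  2 * c * (1 - e) * N%:R <= N%:R * (f 0 + g 0) +
    c ^+ 2 * ((1 + e) * s ^+ n + L * (s ^+ n - (s - k) ^+ n)).
Proof.
move=> pp pT k0 T0 Ts c0; apply/ler_addgt0Pr => d d0.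
(* Makes the total error 2 N^2 kappa at most d; the 1 covers N = 0. *)
pose kappa := d / (2 * N%:R ^+ 2 + 1).
have D0 : 0 < 2 * N%:R ^+ 2 + 1 :> R by rewrite ltr_wpDl// mulr_ge0// exprn_ge0.
have kappa0 : 0 < kappa by rewrite divr_gt0.
have [d1 d10 Hd1] := continuous_box_bound p cf kappa0.
have [d2 d20 Hd2] := continuous_box_bound p cg kappa0.
pose eps := Num.min 1 (Num.min d1 d2).
have eps0 : 0 < eps by rewrite /eps !lt_min ltr01 d10.
have eps1 : eps <= 1 by rewrite /eps ge_min lexx.
have epsd1 : eps <= d1 by rewrite /eps !ge_min lexx orbT.
have epsd2 : eps <= d2 by rewrite /eps !ge_min lexx !orbT.
pose psi := smear p eps; have ipsi := integrable_smear p eps.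
have psi0 := smear_ge0 p eps0.
have mpsi : measurable_fun setT psi by apply/measurable_EFinP; exact: measurable_int ipsi.
have Uf := smear_kint_le eps0 mf fM (Hd1 _ epsd1).
have Ug := smear_kint_le eps0 mg gM (Hd2 _ epsd2).
have Ug0 : 0 <= \int[mu2]_z kint psi g z.
  by apply: (gcop ipsi (B := N%:R * (eps ^+ n)^-1)) => x; rewrite psi0 smear_le.
pose Q : set V := cube s; have mQ : measurable Q by exact: measurable_cube.
have s0 : 0 <= s by lra.
have sk : 0 <= s - k by lra.
pose q : V -> R := \1_Q.
have iq : mu.-integrable setT (EFin \o q) by exact: integrable_indic_cube.
have q1 x : `|q x| <= 1.
  by rewrite /q indicE; case: (_ \in _); rewrite ?normr1 ?normr0.
have m1 : measurable_fun setT (fun z : V * V => z.1 - z.2) by exact: measurable_subV.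
have m2 : measurable_fun setT (fun z : V * V => z.2 + z.1).
  by apply: measurable_addV; [exact: measurable_snd|exact: measurable_fst].
(* For x in cube (s - k) the set of u with x - u in Q contains cube k, so [tail] applies. *)
have near1 x : cube (s - k) x -> `|1 - \int[mu]_u (q (x - u) * f u)| <= e.
  move=> xs; rewrite -f1; apply: (average_near (phi := fun x u => x - u) m1 mQ tail) => u uk.
  by have := cubeD xs (cubeN uk); rewrite subrK.
have near2 x : cube (s - k) x -> `|1 - \int[mu]_u (q (u + x) * f u)| <= e.
  move=> xs; rewrite -f1; apply: (average_near (phi := fun x u => u + x) m2 mQ tail) => u uk.
  by have := cubeD uk xs; rewrite addrCA subrr addr0.
(* Here T + k + 1 <= s is used: k for the tail of f and 1 for the width eps of the boxes. *)
have psis x : psi x != 0 -> cube (s - k) x.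
  by move=> /(smear_support pT); apply: cubeS; lra.
have Epsi : \int[mu]_x psi x = N%:R by exact: Rintegral_smear.
have A1 : (1 - e) * N%:R <= \int[mu2]_z kint2 psi q f z.
  rewrite (kint2_left mf fM intf ipsi iq q1) -Epsi -RintegralZl//.
  apply: le_Rintegral => //.
  - exact: integrable_scaler.
  - exact: (integrable_average mf intf fL (phi := fun x u => x - u) m1 mQ ipsi).
  move=> x _; have [E|px] := eqVneq (smear p eps x) 0; first by rewrite /psi E mulr0 mul0r.
  rewrite mulrC ler_wpM2l//; have := near1 _ (psis _ px).
  by move=> /ler_normlP[]; lra.
have A2 : (1 - e) * N%:R <= \int[mu2]_z kint2 q psi f z.
  rewrite (kint2_right mf fM intf ipsi iq q1) -Epsi -RintegralZl//.
  apply: le_Rintegral => //.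
  - exact: integrable_scaler.
  - exact: (integrable_average mf intf fL (phi := fun x u => u + x) m2 mQ ipsi).
  move=> x _; have [E|px] := eqVneq (smear p eps x) 0; first by rewrite /psi E mulr0 mul0r.
  rewrite mulrC ler_wpM2l//; have := near2 _ (psis _ px).
  by move=> /ler_normlP[]; lra.
have L0 : 0 <= L by apply: le_trans fL; exact: Rintegral_ge0.
(* Inside cube (s - k) the average of f is at most 1 + e; in the remaining shell of Q only the bound
   L is available. *)
have A3 : \int[mu2]_z kint2 q q f z <= (1 + e) * s ^+ n + L * (s ^+ n - (s - k) ^+ n).
  have i1 := integrable_scaler (1 + e) (integrable_indic_cube s).
  have i2 := integrable_scaler L
    (integrable_subr (integrable_indic_cube s) (integrable_indic_cube (s - k))).
  have -> : (1 + e) * s ^+ n + L * (s ^+ n - (s - k) ^+ n) =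
    \int[mu]_x ((1 + e) * \1_(cube s) x + L * (\1_(cube s) x - \1_(cube (s - k)) x)).
    have j1 := integrable_indic_cube s; have j2 := integrable_indic_cube (s - k).
    rewrite (RintegralD measurableT i1 i2) (RintegralZl _ measurableT j1).
    rewrite (RintegralZl _ measurableT (integrable_subr j1 j2)) (RintegralB measurableT j1 j2).
    by rewrite !Rintegral_indic_cube.
  rewrite (kint2_left mf fM intf iq iq q1); apply: le_Rintegral => //.
  - exact: (integrable_average mf intf fL (phi := fun x u => x - u) m1 mQ iq).
  - exact: integrable_addr.
  move=> x _; rewrite /q indicE -/Q; case: (boolP (x \in Q)) => /= xQ; last first.
    rewrite mul0r indicE memNset ?subrr ?mulr0 ?addr0//.
    by move=> h; move: xQ; rewrite notin_setE; apply; apply: cubeS h; lra.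
  rewrite mul1r mulr1 indicE; case: (boolP (x \in _)) => [/set_mem/near1/ler_normlP[]|_].
    rewrite subrr mulr0; lra.
  rewrite subr0 mulr1.
  have := average_le intf fL (phi := fun x u => x - u) m1 mQ x.
  by move=> /= /ler_normlP[]; have := e0; lra.
(* From here the form of f at psi - c q is expanded bilinearly and the estimates are combined. *)
have iA := integrable_subr ipsi (integrable_scaler c iq).
have := fpos iA.
have ipp := integrable_kint2 ipsi ipsi mf fM.
have ipq := integrable_kint2 ipsi iq mf fM.
have iqp := integrable_kint2 iq ipsi mf fM.
have iqq := integrable_kint2 iq iq mf fM.
have -> : \int[mu2]_z kint (fun x => psi x - c * q x) f z =
  \int[mu2]_z (kint psi f z - (c * kint2 psi q f z + c * kint2 q psi f z) + c ^+ 2 * kint2 q q f z).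
  by apply: eq_Rintegral => z _; rewrite /kint /kint2; ring.
have ic1 := integrable_scaler c ipq.
have ic2 := integrable_scaler c iqp.
have ic3 := integrable_scaler (c ^+ 2) iqq.
rewrite RintegralD//; last exact: (integrable_subr ipp (integrable_addr ic1 ic2)).
rewrite RintegralB//; last exact: (integrable_addr ic1 ic2).
rewrite RintegralD// !RintegralZl//.
have := packing_sum_le kappa pp.
have : 2 * N%:R ^+ 2 * kappa <= d.
  rewrite /kappa [leLHS]mulrA ler_pdivrMr// [leLHS]mulrC ler_wpM2l ?lerDl//; exact: ltW.
have : c * ((1 - e) * N%:R) <= c * \int[mu2]_z kint2 psi q f z by rewrite ler_wpM2l.
have : c * ((1 - e) * N%:R) <= c * \int[mu2]_z kint2 q psi f z by rewrite ler_wpM2l.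
have : c ^+ 2 * \int[mu2]_z kint2 q q f z <=
  c ^+ 2 * ((1 + e) * s ^+ n + L * (s ^+ n - (s - k) ^+ n)).
  by rewrite ler_wpM2l// exprn_ge0.
move: Uf Ug Ug0; rewrite -/psi; lra.
Qed.

(** The condition on T makes the shell term at most e s^n, with s = T + k + 1. Then 2 (1 - e) - (1 +
    2 e) = 1 - 4 e is what remains of the coefficient of c N. *)
Lemma packing_count (t : seq V) (T : R) : 0 <= L -> e < 4^-1 -> 0 < k -> 0 <= T ->
  n%:R * k * (L + 1) <= e * (T + k + 1) -> (0 < size t)%N ->
  pairwise (fun x y => 1 <= enorm (x - y)) t -> (forall x, x \in t -> cube T x) ->
  (size t)%:R * (1 - 4 * e) <= (f 0 + g 0) * (T + k + 1) ^+ n.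
Proof.
move=> L0 e4 k0 T0 hs t0 /packing_seq[ut pt] tT.
set s := T + k + 1 in hs *; pose N := size t.
have s0 : 0 < s by rewrite /s; lra.
have sn0 : 0 < s ^+ n by exact: exprn_gt0.
pose p (i : 'I_N) := nth 0 t i.
have pp i j : i != j -> 1 <= enorm (p i - p j).
  move=> ij; apply: pt; rewrite ?mem_nth// => /eqP.
  by rewrite nth_uniq//; exact/negP.
have pT i : cube T (p i) by apply: tT; rewrite mem_nth.
have N0 : 0 < N%:R :> R by rewrite ltr0n.
(* The maximiser of 2 c N - c^2 s^n. *)
pose c := N%:R / s ^+ n.
have c0 : 0 < c by rewrite divr_gt0.
have := packing_quadratic pp pT (ltW k0) T0 (lexx s) (ltW c0).
have cs : c * s ^+ n = N%:R by rewrite /c divfK// gt_eqF.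
have ks : k / s <= 1 by rewrite ler_pdivrMr// mul1r /s; lra.
(* Bernoulli's inequality, which bounds the relative volume of the shell by n k / s. *)
have bern m : 1 - m%:R * (k / s) <= (1 - k / s) ^+ m.
  have x0 : 0 <= k / s by rewrite divr_ge0 ?ltW.
  move: (k / s) x0 ks => x x0 x1; elim: m => [|m IH]; first by rewrite expr0 mul0r subr0.
  rewrite exprS -natr1.
  have : (1 - x) * (1 - m%:R * x) <= (1 - x) * (1 - x) ^+ m.
    by rewrite ler_wpM2l// subr_ge0.
  have : 0 <= m%:R * (x * x) by rewrite mulr_ge0// mulr_ge0.
  nra.
have skE : (s - k) ^+ n = s ^+ n * (1 - k / s) ^+ n.
  by rewrite -exprMn mulrBr mulr1 mulrCA divff ?mulr1// gt_eqF.
have hL : L * (s ^+ n - (s - k) ^+ n) <= e * s ^+ n.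
  apply: (@le_trans _ _ ((L + 1) * (s ^+ n * (n%:R * (k / s))))).
    apply: (@le_trans _ _ (L * (s ^+ n * (n%:R * (k / s))))).
      rewrite ler_wpM2l// skE; have : s ^+ n * (1 - n%:R * (k / s)) <= s ^+ n * (1 - k / s) ^+ n.
        by rewrite ler_wpM2l ?bern// (ltW sn0).
      lra.
    rewrite ler_wpM2r ?lerDl// mulr_ge0 ?(ltW sn0)// mulr_ge0// divr_ge0//; exact: ltW.
  rewrite (_ : (L + 1) * (s ^+ n * (n%:R * (k / s))) =
    s ^+ n * ((n%:R * k * (L + 1)) / s)); last by ring.
  by rewrite [leRHS]mulrC ler_wpM2l ?(ltW sn0)// ler_pdivrMr.
move=> H.
have H2 : c ^+ 2 * ((1 + e) * s ^+ n + L * (s ^+ n - (s - k) ^+ n)) <= c * N%:R * (1 + 2 * e).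
  rewrite -cs; have -> : c * (c * s ^+ n) * (1 + 2 * e) =
    c ^+ 2 * ((1 + e) * s ^+ n + e * s ^+ n) by ring.
  by rewrite ler_wpM2l ?exprn_ge0 ?(ltW c0)// lerD2l.
have H3 : N%:R * (c * (1 - 4 * e)) <= N%:R * (f 0 + g 0) by lra.
rewrite ler_pM2l// in H3.
have : c * (1 - 4 * e) * s ^+ n <= (f 0 + g 0) * s ^+ n by rewrite ler_wpM2r ?(ltW sn0).
by rewrite mulrAC cs.
Qed.

End main_inequality.

(** For T > T0 every finite part of P in cube T obeys [packing_count], and the limsup is at most the
    supremum over these T. *)
Lemma upper_point_density_le (f g : V -> R) (M : R) (P : set V) :
  continuous f -> continuous g ->
  (forall x, `|f x| <= M) -> (forall x, `|g x| <= M) ->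
  mu.-integrable setT (EFin \o f) -> \int[mu]_x f x = 1 ->
  (forall a, mu.-integrable setT (EFin \o a) -> 0 <= \int[mu2]_z kint a f z) ->
  (forall a (B : R), mu.-integrable setT (EFin \o a) ->
     (forall x, 0 <= a x <= B) -> 0 <= \int[mu2]_z kint a g z) ->
  (forall x, 1 <= enorm x -> f x + g x <= 0) ->
  (forall x y, P x -> P y -> x <> y -> 1 <= enorm (x - y)) ->
  (upper_point_density P <= (f 0 + g 0)%:E)%E.
Proof.
move=> cf cg fM gM intf f1 fpos gcop fg packP.
set v := f 0 + g 0; pose L := \int[mu]_x `|f x|.
have L0 : 0 <= L by apply: Rintegral_ge0.
apply/lee_addgt0Pr => d d0; rewrite -EFinD.
(* One factor l pays for 1 - 4 e = 1 / l, the other n for T + k + 1 <= l T. *)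
have [l l1 vl] := exists_scale v n.+1 d0.
pose e := (1 - l^-1) / 4.
have l0 : 0 < l by lra.
have li : l^-1 < 1 by rewrite invf_lt1.
have li0 : 0 < l^-1 by rewrite invr_gt0.
have e0 : 0 < e by rewrite /e; lra.
have e4 : e < 4^-1 by rewrite /e; lra.
have eE : 1 - 4 * e = l^-1 by rewrite /e; lra.
have [k k0 tail] := integral_tail intf e0.
have k0' : 0 < k%:R :> R by rewrite ltr0n.
(* The first bound yields the shell condition of [packing_count], the second T + k + 1 <= l T. *)
pose T0 := Num.max (n%:R * k%:R * (L + 1) / e) ((k%:R + 1) / (l - 1)).
have bound (T : R) (t : seq V) : T0 <= T ->
    pairwise (fun x y => 1 <= enorm (x - y)) t -> (forall x, x \in t -> cube T x) ->
    (0 < size t)%N -> (size t)%:R <= v * l ^+ n.+1 * T ^+ n /\ 0 <= v.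
  rewrite /T0 ge_max => /andP[T1 T2] pt tT t0.
  have T00 : 0 <= T by rewrite (le_trans _ T2)// divr_ge0; lra.
  have := @packing_count f g M L e k%:R cf cg fM gM intf (lexx L)
    f1 fpos gcop fg e0 tail t T L0 e4 k0' T00.
  have hs : n%:R * k%:R * (L + 1) <= e * (T + k%:R + 1).
    have : n%:R * k%:R * (L + 1) <= T * e by rewrite -ler_pdivrMr.
    have : 0 <= e * (k%:R + 1) by rewrite mulr_ge0 ?ltW//; lra.
    lra.
  move=> /(_ hs t0 pt tT); rewrite eE -/v => H.
  have s0 : 0 < (T + k%:R + 1) ^+ n by rewrite exprn_gt0//; lra.
  have N0 : 0 < (size t)%:R :> R by rewrite ltr0n.
  have v0 : 0 < v.
    by rewrite -(pmulr_lgt0 _ s0); apply: lt_le_trans H; rewrite mulr_gt0.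
  split; last exact: ltW.
  have Tl : T + k%:R + 1 <= l * T.
    have : k%:R + 1 <= T * (l - 1) by rewrite -ler_pdivrMr// subr_gt0.
    lra.
  have : (size t)%:R <= l * (v * (T + k%:R + 1) ^+ n).
    by rewrite -ler_pdivrMl// mulrC.
  move=> /le_trans; apply; rewrite exprS.
  have -> : v * (l * l ^+ n) * T ^+ n = l * (v * (l * T) ^+ n) by rewrite exprMn; ring.
  rewrite ler_wpM2l ?(ltW l0)// ler_wpM2l ?(ltW v0)// lerXn2r ?nnegrE//.
    lra.
  by rewrite mulr_ge0 ?(ltW l0).
have T00 : 0 <= T0.
  by rewrite le_max; apply/orP; right; rewrite divr_ge0; lra.
(* The one-point configuration gives this; it is needed where cube T contains no point of P. *)
have v0 : 0 <= v.
  have [] // := bound T0 [:: 0] (lexx _) isT _ isT.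
  move=> x; rewrite inE => /eqP ->; apply/cube_norm => i; rewrite mxE normr0; lra.
rewrite /upper_point_density limf_esupE; apply: ge_ereal_inf.
exists (ereal_sup [set (counting (P `&` cube T) * ((T ^+ n)^-1)%:E)%E | T in [set T | T0 < T]]).
  exists [set T | T0 < T] => //; exists T0; split => //; exact: num_real.
apply: ge_ereal_sup => _ [T /= TT <-].
have T_gt0 : 0 < T by lra.
have Tn0 : 0 < T ^+ n by exact: exprn_gt0.
apply: (@le_trans _ _ ((v * l ^+ n.+1 * T ^+ n)%:E * ((T ^+ n)^-1)%:E)%E).
  rewrite lee_wpmul2r//; first by rewrite lee_fin invr_ge0 ltW.
  apply: counting_le => t ut tP.
  have [t0|t0] := posnP (size t).
    rewrite t0; apply: mulr_ge0; last exact: ltW.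
    by apply: mulr_ge0 => //; exact: exprn_ge0 (ltW l0).
  have [] // := bound T t (ltW TT) _ _ t0; last by move=> x /tP[].
  elim: t ut tP {t0} => //= x t IH /andP[xt ut] tP; rewrite IH//; last first.
    by move=> y yt; apply: tP; rewrite inE yt orbT.
  rewrite andbT; apply/allP => y yt; apply: packP.
  - by have [] := tP x (mem_head _ _).
  - by have [] : (P `&` cube T) y by apply: tP; rewrite inE yt orbT.
  - by move=> xy; move: xt; rewrite xy yt.
by rewrite -EFinM lee_fin mulfK ?gt_eqF.
Qed.

Lemma Czero_bounded (f : V -> R) : Czero R n f -> exists M, forall x, `|f x| <= M.
Proof.
move=> [cf f0]; have [K cK fK] := f0 1 ltr01.
have [|M [_ HM]] := @compact_bounded R R (f @` K).
  by apply: continuous_compact => //; exact: continuous_subspaceT.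
exists (`|M| + 1) => x; have [Kx|Kx] := pselect (K x).
  apply: (HM (`|M| + 1)); first by rewrite (le_lt_trans (ler_norm _))// ltrDl.
  by exists x.
by rewrite (le_trans (ltW (fK x Kx)))// lerDr.
Qed.

Lemma Delta_le_theta (X : set (V -> R)) : X `<=` Czero R n `&` L1 R n ->
  (Delta R n <= theta_SP X (COP_inv R n))%E.
Proof.
move=> XC; apply: ge_ereal_sup => _ [P packP <-].
apply: le_ereal_inf_tmp => _ [f [g [[posf Xf] [copg Xg] ff fg ->]]].
have [C0f /Lfun1P intf] := XC _ Xf; have [C0g /Lfun1P intg] := XC _ Xg.
have [cf _] := C0f; have [cg _] := C0g.
have [Mf fM] := Czero_bounded C0f; have [Mg gM] := Czero_bounded C0g.
have mf := continuous_measurable_rV cf; have mg := continuous_measurable_rV cg.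
apply: (@upper_point_density_le f g (Num.max Mf Mg)) => //.
- by move=> x; rewrite le_max fM.
- by move=> x; rewrite le_max gM orbT.
- move: ff => /(congr1 (@complex.Re R)) /= <-; apply: eq_Rintegral => x _.
  rewrite (_ : dot 0 x = 0) ?mulr0 ?cos0 ?mulr1//.
  by rewrite /dot big1// => i _; rewrite mxE mul0r.
- move=> a ia; rewrite -(integral_star ia mf fM); case: posf => _ _; apply.
  exact/Lfun1P.
(* A bounded integrable function is square integrable; this is why the copositivity hypothesis
   carries the bound B. *)
- move=> a B ia aB.
  have ma : measurable_fun setT a by apply/measurable_EFinP; exact: measurable_int ia.
  rewrite -inner_convolution//; last exact: (integrable_kint ia mg gM).
  case: copg => _; apply; last by apply: aeW => x; case/andP : (aB x).
  apply/Lfun2P; split => //.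
  apply: (integrable_mulr_bounded ia (M := B)) => // x.
  by case/andP : (aB x) => a0 ?; rewrite ger0_norm.
Qed.

End weak_duality.

(** * Schwartz functions *)

Section schwartz.
Context {R : realType}.
Variable n : nat.
Local Notation V := 'rV[R]_n.
Local Notation mu := (@lebesgue_rV R n).

(** Each factor 1 + x_j^2 raises one exponent of the monomial by 2, so the induction on [s] runs
    over all [a]. *)
Lemma Schwartz_decay (f : V -> R) (s : seq 'I_n) (a : 'I_n -> nat) : Schwartz R n f ->
  exists M, forall x : V,
    `|(\prod_i x ord0 i ^+ a i) * (f x * \prod_(i <- s) (1 + x ord0 i ^+ 2))| <= M.
Proof.
move=> [_ Sf]; elim: s a => [|j s IH] a.
  by have [M HM] := Sf a [::]; exists M => x; rewrite big_nil mulr1; exact: HM.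
have [M1 HM1] := IH a.
have [M2 HM2] := IH (fun i => (a i + 2 * (i == j))%N).
exists (M1 + M2) => x.
have := HM2 x; under eq_bigr do rewrite exprD.
have -> : \prod_i (x ord0 i ^+ a i * x ord0 i ^+ (2 * (i == j))) =
    \prod_i x ord0 i ^+ a i * x ord0 j ^+ 2.
  rewrite big_split; congr (_ * _); rewrite (bigD1 j)//= eqxx muln1 big1 ?mulr1//.
  by move=> i /negbTE ->; rewrite muln0 expr0.
move=> h2; have h1 := HM1 x.
rewrite big_cons; apply: le_trans (lerD h1 h2).
apply: le_trans (ler_normD _ _); rewrite le_eqVlt; apply/orP; left; apply/eqP.
by congr `|_|; ring.
Qed.

Lemma integral_oneDsqrV : (\int[@lebesgue_measure R]_t ((1 + t ^+ 2)^-1)%:E = pi%:E)%E.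
Proof.
rewrite (@ge0_symfun_integralT R (fun t => (1 + t ^+ 2)^-1)); last 3 first.
- by move=> t; rewrite invr_ge0 addr_ge0// sqr_ge0.
- exact: continuous_oneDsqrV.
- by move=> t /=; rewrite sqrrN.
have := @integral0y_oneDsqr R; rewrite set_itvE /= => ->.
by rewrite -EFinM mulrC divfK.
Qed.

(** An integrable majorant for Schwartz functions; its integral factors into powers of [pi]. *)
Lemma integrable_prod_oneDsqrV :
  mu.-integrable setT (EFin \o (fun x : V => \prod_i (1 + x ord0 i ^+ 2)^-1)).
Proof.
have mu1 : measurable_fun setT (fun t : measurableTypeR R => (1 + t ^+ 2)^-1 : R).
  by apply: continuous_measurable_fun; exact: continuous_oneDsqrV.
have ge0 (t : R) : 0 <= (1 + t ^+ 2)^-1 by rewrite invr_ge0 addr_ge0// sqr_ge0.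
apply/integrableP; split.
  apply/measurable_EFinP; apply: measurable_prod => i _.
  exact: (measurableT_comp mu1 (measurable_coord i)).
under eq_integral do rewrite /= ger0_norm ?prodr_ge0//.
rewrite (@ge0_integral_rV_prod R n (fun _ t => (1 + t ^+ 2)^-1))//.
under eq_bigr do rewrite integral_oneDsqrV.
by rewrite prodEFin ltry.
Qed.

Lemma Schwartz_L1 : Schwartz R n `<=` L1 R n.
Proof.
move=> f Sf; apply/Lfun1P.
have [M HM] := Schwartz_decay (index_enum _) (fun=> 0%N) Sf.
have mf : measurable_fun setT f by apply: continuous_measurable_rV; case: (Sf.1 [::]).
have P0 (x : V) : 0 < \prod_i (1 + x ord0 i ^+ 2).
  by apply: prodr_gt0 => i _; rewrite ltr_wpDr// sqr_ge0.
have mP : measurable_fun setT (fun x : V => \prod_i (1 + x ord0 i ^+ 2)).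
  apply: measurable_prod => i _; apply: measurable_funD => //.
  apply: (measurable_funX 2); exact: measurable_coord.
have := integrable_mulr_bounded (g := fun x => f x * \prod_i (1 + x ord0 i ^+ 2)) (M := M)
  integrable_prod_oneDsqrV.
move=> /(_ (measurable_funM mf mP)) /(_ _)/wrap[].
  by move=> x; have := HM x; rewrite big1 ?mul1r// => i _; rewrite expr0.
apply: eq_integrable => // x _ /=; congr EFin.
by rewrite prodfV mulrCA mulVf ?mulr1// gt_eqF.
Qed.

Lemma Schwartz_Czero : Schwartz R n `<=` Czero R n.
Proof.
move=> f Sf; split; first by case: (Sf.1 [::]).
move=> e e0.
have Hi i : exists M, forall x : V, `|x ord0 i * f x| <= M.
  have [M HM] := Sf.2 (fun j => nat_of_bool (j == i)) [::].
  exists M => x; have := HM x; rewrite (bigD1 i)//= eqxx expr1 big1 ?mulr1//.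
  by move=> j /negbTE ->; rewrite expr0.
have [M HM] := boolp.choice Hi.
(* Outside this cube some |x_i| exceeds B / e, while |x_i f(x)| < B; the summand 1 makes the bound
   strict. *)
pose B := \sum_i `|M i| + 1.
have MB i : M i < B.
  rewrite /B (bigD1 i)//= -addrA (le_lt_trans (ler_norm _))// ltrDl ltr_wpDl//.
  exact: sumr_ge0.
exists (cube (2 * (B / e))); first exact: cube_compact.
move=> x /(contra_not (iffRL (cube_norm _ _)))/existsNP[i /negP].
rewrite -ltNge (_ : 2 * (B / e) / 2 = B / e); last by field; rewrite gt_eqF.
move=> xi; have xi0 : 0 < `|x ord0 i|.
  apply: le_lt_trans xi; rewrite divr_ge0 ?(ltW e0)// addr_ge0// sumr_ge0//.
rewrite -(ltr_pM2l xi0) -normrM.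
apply: (le_lt_trans (HM i x)); apply: (lt_trans (MB i)).
by rewrite -ltr_pdivrMr.
Qed.

Lemma continuous_monomial (a : 'I_n -> nat) :
  continuous (fun x : V => \prod_i x ord0 i ^+ a i).
Proof.
apply: (continuous_big (@mul_continuous R)) => i _ x.
apply: (@cvg_comp _ _ _ (fun y : V => y ord0 i) (fun t : R => t ^+ a i)).
  exact: continuous_coord.
exact: exprn_continuous.
Qed.

Lemma Cc_infty_Schwartz : Cc_infty R n `<=` Schwartz R n.
Proof.
move=> f [sf cK]; split=> // a s; set K := closure _ in cK.
have clK : closed K by exact: closed_closure.
(* The complement of K is open, so a function vanishing there has vanishing derivatives there. *)
have p0 x : ~ K x -> partial s f x = 0.
  elim: s x => [|i s IH] x Kx /=.
    by apply/eqP; apply: contra_notT Kx => fx; exact: subset_closure.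
  rewrite -(derive_cst (0 : R) x (delta_mx ord0 i)).
  have nK : \forall y \near x, ~ K y by apply: open_nbhs_nbhs; split => //; exact: closed_openC.
  by apply: near_eq_derive; apply: filterS nK => y /IH.
have cg : continuous (fun x : V => (\prod_i x ord0 i ^+ a i) * partial s f x).
  by move=> x; apply: (@cvgM _ _ (nbhs x)); [exact: continuous_monomial|exact: (sf s).1].
have [|M [_ HM]] := @compact_bounded R R
    ((fun x : V => (\prod_i x ord0 i ^+ a i) * partial s f x) @` K).
  by apply: continuous_compact => //; exact: continuous_subspaceT.
exists (`|M| + 1) => x; have [Kx|Kx] := pselect (K x).
  apply: (HM (`|M| + 1)); first by rewrite (le_lt_trans (ler_norm _))// ltrDl.
  by exists x.
by rewrite p0// mulr0 normr0 addr_ge0.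
Qed.

End schwartz.

Theorem corollary10p7 (R : realType) (n : nat) (hn : (2 <= n)%N) :
  (forall X : set ('rV[R]_n -> R),
     GRing.submod_closed (mem X) ->
     Cc_infty R n `<=` X ->
     X `<=` Czero R n `&` L1 R n ->
     Delta R n = theta_SP X (COP_inv R n)) /\
  Delta R n = theta_SP (Schwartz R n) (COP_inv R n).
Proof.
split=> [X _ CX XC|]; apply/le_anti/andP; split.
- exact: Delta_le_theta.
- exact: theta_le_Delta.
- by apply: Delta_le_theta => f Sf; split; [exact: Schwartz_Czero|exact: Schwartz_L1].
- exact/theta_le_Delta/Cc_infty_Schwartz.
Qed.
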